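(* Let $\Phi$ be a sequence of nonzero vectors lying in an open half-space of $V$ and spanning the lattice $\Gamma$ (i.e. $\mathbb{Z}\Phi=\Gamma$). Let $W$ be a wall of $\Phi$, $W=\{a\in V:\langle a,E\rangle=0\}$ with $E\in\Gamma^*$ primitive, and let $\mathfrak{c}_1,\mathfrak{c}_2$ be two chambers of $\Phi$ adjacent along $W$ and separated by $W$, with $\langle E,\mathfrak{c}_1\rangle>0$. Let $\Phi_0=\Phi\cap W$, and assume that $\langle\phi,E\rangle>0$ for at least one $\phi\in\Phi\setminus\Phi_0$. Let $\mathfrak{c}_{12}$ be the chamber of $\Phi_0$ in $W$ whose closure contains $\overline{\mathfrak{c}_1}\cap\overline{\mathfrak{c}_2}$, and let $k_{12}=k(\Phi_0,\mathfrak{c}_{12})$ be the associated quasi-polynomial function on $\Gamma_0=W\cap\Gamma$. Then, as functions on $\Gamma$, $$k(\Phi,\mathfrak{c}_1)-k(\Phi,\mathfrak{c}_2)=\mathrm{Para}(k_{12},\Phi\setminus\Phi_0,E).$$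
   Context: Setting. $U$ is an $r$-dimensional real vector space, $V=U^*$, $\Gamma\subset V$ a lattice of full rank, $\Gamma^*\subset U$ the dual lattice, $\Gamma_0=W\cap\Gamma$. $T=U/\Gamma^*$, $T_0=W^*/\Gamma_0^*$, and $r:T\to T_0$ is the surjective homomorphism induced by the restriction map $U=V^*\to W^*$. For $y\in T$ and $a\in\Gamma$, $e_y(a)=e^{2i\pi\langle y,a\rangle}$. A quasi-polynomial function on $\Gamma$ is a function $Q(a)=\sum_{y\in T}e_y(a)Q_y(a)$ where $Q_y$ are polynomial functions on $V$, nonzero only for finitely many $y$, all of finite order in $T$; similarly on $\Gamma_0$. Chambers. $C(\nu)$ is the closed convex cone generated by $\nu$; $C(\Phi)_{\mathrm{sing}}$ is the union of the $C(\nu)$ over subsets $\nu\subset\Phi$ of cardinality $<\dim V$; chambers are the connected components of $V\setminus C(\Phi)_{\mathrm{sing}}$. The exterior of $C(\Phi)$ is a chamber $\mathfrak{c}_{\mathrm{ext}}$; the others, contained in $C(\Phi)$, are interior. The same applies to $\Phi_0$ in $W$. A wall is a hyperplane generated by $r-1$ linearly independent elements of $\Phi$. ''Adjacent and separated by $W$, with $\langle E,\mathfrak{c}_1\rangle>0$'' means: $\langle a,E\rangle>0$ for $a\in\mathfrak{c}_1$; either $\langle a,E\rangle<0$ for all $a\in\mathfrak{c}_2$, or $\mathfrak{c}_2=\mathfrak{c}_{\mathrm{ext}}$; and $\overline{\mathfrak{c}_1}\cap\overline{\mathfrak{c}_2}\cap W$ has non-empty interior in $W$ (when $\mathfrak{c}_2=\mathfrak{c}_{\mathrm{ext}}$,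 read $\overline{\mathfrak{c}_1}\cap\overline{\mathfrak{c}_2}$ as $\overline{\mathfrak{c}_1}\cap\overline{\mathfrak{c}_2}\cap W$). Partition function. $k(\Phi)(a)$ is the number of $(n_\phi)_{\phi\in\Phi}\in\mathbb{Z}_{\ge0}^{\Phi}$ with $\sum_\phi n_\phi\phi=a$. For an interior chamber $\mathfrak{c}$, $k(\Phi,\mathfrak{c})$ is the unique quasi-polynomial function on $\Gamma$ equal to $k(\Phi)$ on $\overline{\mathfrak{c}}\cap\Gamma$; $k(\Phi,\mathfrak{c}_{\mathrm{ext}})=0$. Likewise $k(\Phi_0,\mathfrak{c}_{12})$ is a quasi-polynomial function on $\Gamma_0$. The function Para. For a polynomial $P$ on $V$, $P(\partial_x)$ is the constant coefficient differential operator in $x\in U$ with $P(\partial_x)e^{\langle a,x\rangle}=P(a)e^{\langle a,x\rangle}$. For a quasi-polynomial $Q=\sum_{y\in T}e_yQ_y$ on $\Gamma$ and a finite sequence $\Psi$ of vectors of $\Gamma$ not in $W$, for $a\in\Gamma$, $$\mathrm{Para}(Q,\Psi,E)(a)=\sum_{y\in T}\ \sum_{g\in T:\,r(g)=r(y)}\mathrm{Res}_{z=0}\left(Q_y(\partial_x)\cdot\frac{e^{\langle a,x+2i\pi g+zE\rangle}}{\prod_{\psi\in\Psi}(1-e^{-\langle\psi,x+2i\pi g+zE\rangle})}\right)_{x=0},$$ where only finitely many $g$ give a nonzero residue. This depends only on the restriction of $Q$ to $\Gamma_0$; for a quasi-polynomial $q$ on $\Gamma_0$, $\mathrm{Para}(q,\Psi,E):=\mathrm{Para}(Q,\Psi,E)$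 for any quasi-polynomial $Q$ on $\Gamma$ extending $q$. *)

(* Defs.v *)
From HB Require Import structures.
From mathcomp Require Import all_boot all_order all_algebra.
From mathcomp Require Import finmap ring_quotient complex.
From mathcomp Require Import ring.
From mathcomp Require Import -(notations) mpoly.
From mathcomp Require Import all_classical all_reals all_analysis.

Set Implicit Arguments.
Unset Strict Implicit.
Unset Printing Implicit Defensive.

Import Order.TTheory GRing.Theory Num.Theory numFieldNormedType.Exports.

Local Open Scope classical_set_scope.
Local Open Scope ring_scope.
Local Open Scope complex_scope.
Local Open Scope quotient_scope.

(* V is the primitive object and U is its dual 'Hom(V, R^o), so that <a, x>   *)
(* is x a for a in V and x in U.                                              *)

Section Lattices.
Variables (R : realType) (V : vectType R).

Definition zspan (s : seq V) : set V := [set v | inIntSpan (in_tuple s) v].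

Definition full_lattice (G : set V) : Prop :=
  exists2 b : seq V, basis_of fullv b & G = zspan b.

Definition dual_lattice (G : set V) : {pred 'Hom(V, R^o)} :=
  fun u => `[< forall a, G a -> (u a : R) \is a Num.int >].

Variable G : set V.

Lemma dual_lattice_zmod_closed : zmod_closed (dual_lattice G).
Proof.
split; first by apply/asboolP => a _; rewrite lfunE /= rpred0.
move=> u v /asboolP hu /asboolP hv; apply/asboolP => a Ga.
by rewrite add_lfunE opp_lfunE; apply: rpredB; [exact: hu | exact: hv].
Qed.

HB.instance Definition _ :=
  GRing.isZmodClosed.Build 'Hom(V, R^o) (dual_lattice G)
    dual_lattice_zmod_closed.

Definition torus := Quotient.quot (dual_lattice G).

(* The case n = 0 excludes E = 0. *)
Definition primitive_dual (E : 'Hom(V, R^o)) : Prop :=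
  E \in dual_lattice G /\
  forall (n : nat) (F : 'Hom(V, R^o)),
    F \in dual_lattice G -> E = F *+ n -> n = 1%N.

End Lattices.

Section Restriction.
Variables (R : realType) (V : vectType R) (W : {vspace V}).

Definition lattice_in (G : set V) : set (subvs_of W) := [set w | G (vsval w)].

Definition dual_restrict (u : 'Hom(V, R^o)) : 'Hom(subvs_of W, R^o) :=
  (u \o linfun (vsval : subvs_of W -> V))%VF.

(* dual_restrict maps the dual of G into the dual of lattice_in G, so the     *)
(* value does not depend on the representative of y.                          *)
Definition torus_restrict (G : set V) (y : torus G) : torus (lattice_in G) :=
  \pi_(torus (lattice_in G)) (dual_restrict (repr y)).

End Restriction.

Arguments lattice_in {R V} W G.
Arguments dual_restrict {R V} W u.
Arguments torus_restrict {R V} W {G} y.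

Section Chambers.
Variables (R : realType) (V : vectType R).

Definition coords (v : V) : 'rV[R]_(\dim {:V}) :=
  \row_i coord (vbasis {:V}) i v.

(* V with the usual topology of a finite-dimensional real vector space.       *)
Definition euclidean := initial_topology coords.
HB.instance Definition _ := Topological.on euclidean.

Definition cone (s : seq V) : set euclidean :=
  [set v | exists2 t : 'I_(size s) -> R,
     (forall i, 0 <= t i) & v = \sum_i t i *: s`_i].

Definition cone_sing (Phi : seq V) : set euclidean :=
  [set v | exists nu : seq V,
     [/\ subseq nu Phi, (size nu < \dim {:V})%N & cone nu v]].

Definition chamber (Phi : seq V) (c : set euclidean) : Prop :=
  exists2 x : euclidean, (~` cone_sing Phi) x &
    c = connected_component (~` cone_sing Phi) x.

Definition c_ext (Phi : seq V) : set euclidean := ~` cone Phi.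

Definition wall (Phi : seq V) (W : {vspace V}) : Prop :=
  exists nu : seq V,
    [/\ subseq nu Phi, (size nu).+1 = \dim {:V}, free nu & W = <<nu>>%VS].

End Chambers.
Arguments euclidean {R} V.

Definition in_open_half_space (R : realType) (V : vectType R) (Phi : seq V) :
    Prop :=
  exists u : 'Hom(V, R^o), forall phi, phi \in Phi -> 0 < (u phi : R).

Section Adjacency.
Variables (R : realType) (V : vectType R) (W : {vspace V}).

(* The intersection of both closures with W, as a subset of W; intersecting   *)
(* with W matters only when c2 is the exterior chamber.                       *)
Definition common_wall (c1 c2 : set (euclidean V)) :
    set (euclidean (subvs_of W)) :=
  [set w | closure c1 (vsval w) /\ closure c2 (vsval w)].

Definition adjacent_along (Phi : seq V) (E : 'Hom(V, R^o))
    (c1 c2 : set (euclidean V)) : Prop :=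
  [/\ forall a, c1 a -> 0 < (E a : R),
      (forall a, c2 a -> (E a : R) < 0) \/ c2 = c_ext Phi
    & (common_wall c1 c2)^° !=set0].

Definition seq_in (Phi : seq V) : seq (subvs_of W) :=
  [seq vsproj W phi | phi <- Phi & phi \in W].

Definition seq_out (Phi : seq V) : seq V := [seq phi <- Phi | phi \notin W].

End Adjacency.
Arguments common_wall {R V} W c1 c2.
Arguments seq_in {R V} W Phi.

Section QuasiPolynomials.
Variables (R : realType).

Definition cexp (z : R[i]) : R[i] :=
  (expR (complex.Re z))%:C * (cos (complex.Im z) +i* sin (complex.Im z)).

Variables (V : vectType R).

(* A complex polynomial function on V, in the coordinates of vbasis.          *)
Local Notation polyfun := (mpoly (\dim {:V}) R[i]).

Definition poly_eval (P : polyfun) (a : V) : R[i] :=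
  meval (fun i => (coord (vbasis {:V}) i a)%:C) P.

Variable G : set V.

Definition torus_char (y : torus G) (a : V) : R[i] :=
  cexp ('i * (2 * pi * ((repr y : 'Hom(V, R^o)) a : R))%:C).

(* A quasi-polynomial function on G determines its coefficients Q_y.          *)
Record quasipoly := QuasiPoly {
  qcoef :> torus G -> polyfun;
  qcoef_finite : finite_set [set y | qcoef y != 0];
  qcoef_torsion : forall y, qcoef y != 0 -> exists n, y *+ n.+1 = 0 }.

(* Meaningful at points of G only: torus_char does not depend on the          *)
(* representative of y there.                                                 *)
Definition qeval (Q : quasipoly) (a : V) : R[i] :=
  \sum_(y \in [set: torus G]) torus_char y a * poly_eval (Q y) a.

End QuasiPolynomials.

Section PartitionFunction.
Variables (R : realType) (V : vectType R).

(* Finite when Phi lies in an open half-space (fset_set is empty otherwise).   *)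
Definition partitions (Phi : seq V) (a : V) : set {ffun 'I_(size Phi) -> nat} :=
  [set n : {ffun 'I_(size Phi) -> nat} |
     \sum_(i < size Phi) Phi`_i *+ n i = a].

Arguments partitions Phi a : clear implicits.

Definition kfun (Phi : seq V) (a : V) : nat :=
  #|` fset_set (partitions Phi a)|.

Definition is_kchamber (G : set V) (Phi : seq V) (c : set (euclidean V))
    (k : quasipoly G) : Prop :=
  (c = c_ext Phi -> forall a, G a -> qeval k a = 0) /\
  (c <> c_ext Phi ->
     forall a : V, G a -> closure c (a : euclidean V) ->
       qeval k a = (kfun Phi a)%:R).

End PartitionFunction.

Section Residue.
Variable R : realType.

(* F z = \sum_n b n * z ^ (n - (m + 1)) near 0, so that b m is the coefficient *)
(* of z^-1; R[i]^o carries the topology of the complex plane.                 *)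
Definition is_residue0 (F : R[i] -> R[i]) (c : R[i]) : Prop :=
  exists (m : nat) (b : nat -> R[i]),
    c = b m /\
    \forall z \near (0 : R[i]^o)^',
      series (fun n => b n * z ^+ n : R[i]^o) @ \oo -->
        (z ^+ m.+1 * F z : R[i]^o).

Definition residue0 (F : R[i] -> R[i]) : R[i] := xget 0 (is_residue0 F).

End Residue.

Section Para.
Variables (R : realType) (V : vectType R).
Local Notation U := 'Hom(V, R^o).

Definition dirD (u : U) (F : U -> R[i]) : U -> R[i] := fun x =>
  derive1 (fun t : R => complex.Re (F (x + t *: u))) 0 +i*
  derive1 (fun t : R => complex.Im (F (x + t *: u))) 0.

(* The i-th coordinate function is an element of U and acts as the derivative *)
(* along itself; polyD_exp below is the defining property of P(d_x).          *)
Definition polyD (P : mpoly (\dim {:V}) R[i]) (F : U -> R[i]) (x : U) : R[i] :=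
  \sum_(m <- msupp P) mcoeff m P *
    foldr (fun i H => iter (m i)
             (dirD (linfun (coord (vbasis {:V}) i : V -> R^o))) H)
      F (enum 'I_(\dim {:V})) x.

(* <a, x + 2 i pi g + z E>                                                    *)
Definition cpairing (a : V) (x g E : U) (z : R[i]) : R[i] :=
  (x a : R)%:C + 'i * (2 * pi * (g a : R))%:C + z * (E a : R)%:C.

Definition para_kernel (Psi : seq V) (E : U) (a : V) (g : U) (z : R[i])
    (x : U) : R[i] :=
  cexp (cpairing a x g E z) /
    \prod_(psi <- Psi) (1 - cexp (- cpairing psi x g E z)).

Definition Para (W : {vspace V}) (G : set V) (Q : quasipoly G) (Psi : seq V)
    (E : U) (a : V) : R[i] :=
  \sum_(y \in [set: torus G])
    \sum_(g \in [set g : torus G | torus_restrict W g = torus_restrict W y])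
      residue0 (fun z => polyD (Q y) (para_kernel Psi E a (repr g) z) 0).

Definition qextends (W : {vspace V}) (G : set V) (Q : quasipoly G)
    (q : quasipoly (lattice_in W G)) : Prop :=
  forall w, lattice_in W G w -> qeval Q (vsval w) = qeval q w.

End Para.

Fact derive_kexp (R : realType) (k y s : R) :
  derive1 (fun t : R => k * expR (y + t * s)) 0 = k * s * expR y.
Proof.
rewrite derive1E.
have h : is_derive (0:R) 1 (cst y + s \*: (id : R -> R)) s.
  by apply: is_derive_eq; rewrite add0r scaler1.
have e : cst y + s \*: (id : R -> R) = (fun t : R => y + t * s).
  by apply/funext => t; rewrite [RHS]/= [t * s]mulrC.
rewrite e in h.
have h2 : is_derive (0:R) 1 (expR \o (fun t : R => y + t * s)) (s *: expR y).
  have he : is_derive (y + 0 * s) 1 (@expR R) (expR y).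
    by rewrite mul0r addr0; exact: is_derive_expR.
  by have := @is_derive1_comp R expR (fun t : R => y + t * s) 0 _ _ he h; rewrite mulrC.
have -> : (fun t => k * expR (y + t * s)) = k \*: (expR \o (fun t : R => y + t * s)).
  by [].
by rewrite derive_val -mulrA.
Qed.

Fact ReZ (R : realType) (c : R[i]) (r : R) : complex.Re (c * r%:C) = complex.Re c * r.
Proof. by case: c => p q /=; rewrite mulr0 subr0. Qed.
Fact ImZ (R : realType) (c : R[i]) (r : R) : complex.Im (c * r%:C) = complex.Im c * r.
Proof. by case: c => p q /=; rewrite mulr0 add0r. Qed.

Fact cexp_real (R : realType) (r : R) : cexp r%:C = (expR r)%:C.
Proof. by rewrite /cexp /= sin0 cos0 mulr1. Qed.

Fact dirD_exp (R : realType) (V : vectType R) (u : 'Hom(V, R^o)) (a : V) (c : R[i]) :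
  dirD u (fun x => c * cexp (x a : R)%:C) =
  fun x => c * (u a : R)%:C * cexp (x a : R)%:C.
Proof.
apply/funext => x; rewrite /dirD cexp_real.
under eq_fun do rewrite cexp_real ReZ add_lfunE scale_lfunE.
under [X in _ +i* derive1 X _]eq_fun do rewrite cexp_real ImZ add_lfunE scale_lfunE.
rewrite !derive_kexp.
case: c => p q /=; apply/eqP; rewrite eq_complex /=; apply/andP; split; apply/eqP; ring.
Qed.

Fact polyD_exp (R : realType) (V : vectType R) (P : mpoly (\dim {:V}) R[i]) (a : V) x :
  polyD P (fun x => cexp (x a : R)%:C) x = poly_eval P a * cexp (x a : R)%:C.
Proof.
rewrite /polyD /poly_eval mevalE big_distrl /=; apply: eq_bigr => m _.
rewrite -mulrA; congr (_ * _).
rewrite -big_enum.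
have -> : foldr (fun i H => iter (m i) (dirD (linfun (coord (vbasis {:V}) i : V -> R^o))) H) (fun x => cexp (x a : R)%:C) (enum 'I_(\dim {:V})) = fun x => \prod_(i <- enum 'I_(\dim {:V})) (coord (vbasis {:V}) i a)%:C ^+ m i * cexp (x a : R)%:C.
  elim: (enum _) => [|i s IH] /=.
    by apply/funext => y; rewrite big_nil mul1r.
  rewrite IH big_cons; elim: (m i) => [|k IHk] /=.
    by apply/funext => y; rewrite expr0 mul1r.
  rewrite IHk dirD_exp; apply/funext => y; rewrite lfunE /= exprS. by ring.
by [].
Qed.

(* Main.v *)
Require Import Defs.
From mathcomp Require Import all_boot all_order all_algebra complex.
From mathcomp Require Import zify ring lra.
From mathcomp Require Import finmap ring_quotient.
From mathcomp Require Import -(notations) mpoly.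
From mathcomp Require Import all_classical all_reals all_analysis.
Import Order.TTheory GRing.Theory Num.Theory numFieldNormedType.Exports.
Set Implicit Arguments.
Unset Strict Implicit.
Unset Printing Implicit Defensive.
Local Open Scope classical_set_scope.
Local Open Scope ring_scope.

(** Let Psi be the list of the vectors of Phi outside W, and let D be the
product, over psi in Psi, of the operators f |-> f - f (. - psi). The formula
is proved by comparing two functions on the lattice through D.

The partition function is a fundamental solution: D k(Phi) is k(Phi_0) on the
wall and 0 off the wall (diff_kfun), because multiplying generating series by
the product of the 1 - e^psi removes the vectors of Psi. On the other side,
Para is a sum of residues of a kernel with denominator the product of the
1 - e^(-psi). Factor by factor, D cancels this denominator, so that D
annihilates Para. The value of Para on a strip of levels of E around the wall
is explicit (Para_recurrence): it vanishes there, except on the lower edge of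
the strip, where it copies k_12 up to sign and translation. Hence Para, cut
off below the wall, satisfies the same equation as a partition function: D of
it is k_12 on the wall, and 0 off the wall.

The strip is computed as follows. A vector psi is flipped to the positive side
of the wall by 1 / (1 - v) = - v^-1 / (1 - v^-1), and replaced by a multiple
by 1 / (1 - v) = (1 + v + ... + v^(k-1)) / (1 - v^k), until all the vectors
have the same level N and a trivial character at y. The contributing points of
the torus are then the y + (i / N) E for i < N; their sum selects the levels
divisible by N, and there only residues at 0 of e^(pz) / (e^z - 1)^q with
0 < p <= q remain, which are 0 for p < q and 1 for p = q
(exp_quotient_residue, phase_sum_strip, phase_sum_wall).

It remains to use the chambers. There is a lattice vector g of the wall such
that, for every a, the points a + k g with k large lie in the closure of c_1
if a is on the wall or above it, in c_2 if a is below it, and in c_12 if a is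
on it (wall_geometry). So k(Phi, c_1) agrees far along g with k(Phi) above
the wall, k(Phi, c_2) agrees with it below the wall, and k_12 with k(Phi_0) on
the wall. Consequently the difference of the two sides of the formula, cut off
below the wall, has an image under D that vanishes far along g. Induction on
the level shows that the difference itself does (level_induction): at a
suitable translate of a point, D f is the value of f at this point, up to
sign, plus values at lower levels. A solution of a linear recurrence along g
with nonzero roots, which quasi-polynomials and Para are, can only vanish far
along g by vanishing identically (recurrent_evanescent). This proves the
formula above the wall, and the same induction from the other side proves it
below (jump_formula). *)

(** * Power series expansions with explicit remainders *)

Section Expansions.
Variable K : numFieldType.
Implicit Types (f g : K -> K) (b c : nat -> K) (x y z t : K).

(** The remainder of every order is bounded by one geometric sequence. For
complex functions this amounts to f being the sum of the power series b on a
punctured disc around 0, and products and inverses become elementary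
estimates. *)
Definition expands f b :=
  exists rho C : K, [/\ 0 < rho, 0 <= C & forall z, z != 0 -> rho * `|z| < 1 ->
    forall N, `|f z - \sum_(n < N) b n * z ^+ n| <= C * (rho * `|z|) ^+ N].

Let ler_CX (C x y : K) N : 0 <= C -> 0 <= x -> x <= y -> C * x ^+ N <= C * y ^+ N.
Proof. by move=> C0 x0 xy; rewrite ler_wpM2l// lerXn2r// nnegrE (le_trans x0). Qed.

Let eqle (x y : K) : x = y -> x <= y.
Proof. by move->. Qed.

(** Punctured discs are described by a bound on rho |z|, so that adding the
constants rho intersects two of them. *)
Definition near_zero (P : K -> Prop) :=
  exists2 rho : K, 0 < rho & forall z, z != 0 -> rho * `|z| < 1 -> P z.

Lemma near_zeroI (P Q : K -> Prop) :
  near_zero P -> near_zero Q -> near_zero (fun z => P z /\ Q z).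
Proof.
move=> [r r0 hr] [s s0 hs]; exists (r + s); first exact: addr_gt0.
move=> z z0 hz; split; [apply: hr | apply: hs] => //; apply: le_lt_trans hz;
  by rewrite ler_wpM2r// ?lerDl ?lerDr ltW.
Qed.

Lemma near_zeroW (P Q : K -> Prop) :
  (forall z, z != 0 -> P z -> Q z) -> near_zero P -> near_zero Q.
Proof. by move=> PQ [r r0 hr]; exists r => // z z0 hz; apply: PQ => //; exact: hr. Qed.

Lemma near_zero_all (P : K -> Prop) : (forall z, z != 0 -> P z) -> near_zero P.
Proof. by move=> h; exists 1 => // z z0 _; exact: h. Qed.

Lemma near_zero_allin (T : eqType) (s : seq T) (P : T -> K -> Prop) :
  (forall i, i \in s -> near_zero (P i)) ->
  near_zero (fun z => forall i, i \in s -> P i z).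
Proof.
elim: s => [_|i s IH h]; first exact: near_zero_all.
have hi : near_zero (P i) by apply: h; rewrite mem_head.
have hs : near_zero (fun z => forall j, j \in s -> P j z).
  by apply: IH => j js; apply: h; rewrite inE js orbT.
apply: near_zeroW (near_zeroI hi hs) => z _ [hi' hs'] j.
by rewrite inE => /predU1P[->|/hs'].
Qed.

Lemma expands_eq f g b : near_zero (fun z => f z = g z) -> expands f b -> expands g b.
Proof.
move=> [r r0 hr] [rho [C [rho0 C0 h]]]; exists (rho + r), C; split=> //.
  exact: addr_gt0.
move=> z z0 hz N.
have hz1 : rho * `|z| < 1.
  by apply: le_lt_trans hz; rewrite ler_wpM2r// lerDl ltW.
have hz2 : r * `|z| < 1.
  by apply: le_lt_trans hz; rewrite ler_wpM2r// lerDr ltW.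
rewrite -hr//; apply: le_trans (h _ z0 hz1 N) _.
apply: ler_CX => //; first by rewrite mulr_ge0// ltW.
by rewrite ler_wpM2r// lerDl ltW.
Qed.

(** The n-th coefficient is the difference of two consecutive remainders, taken
at z = 1 / (2 rho). *)
Lemma expands_coef f b : expands f b ->
  exists rho C : K, [/\ 0 < rho, 0 <= C & forall n, `|b n| <= C * rho ^+ n].
Proof.
move=> [rho [C [rho0 C0 h]]]; exists rho, (2 * C); split=> //.
  by rewrite mulr_ge0.
move=> n; set z := (2 * rho)^-1.
have r20 : 0 < 2 * rho by rewrite mulr_gt0.
have z0 : 0 < z by rewrite invr_gt0.
have ez : rho * z = 2^-1 by rewrite /z invfM mulrCA divff ?gt_eqF// mulr1.
have nz : `|z| = z by rewrite ger0_norm// ltW.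
have hz : rho * `|z| < 1 by rewrite nz ez invf_lt1// ltr1n.
have h1 := h _ (lt0r_neq0 z0) hz n; have h2 := h _ (lt0r_neq0 z0) hz n.+1.
rewrite big_ord_recr/= nz ez in h2; rewrite nz ez in h1.
have : `|b n * z ^+ n| <= 2 * C * (2^-1) ^+ n.
  set S := \sum_(i < n) _ in h1 h2.
  have -> : b n * z ^+ n = (f z - S) - (f z - (S + b n * z ^+ n)) by ring.
  apply: le_trans (ler_normB _ _) _.
  have -> : 2 * C * 2^-1 ^+ n = C * 2^-1 ^+ n + C * 2^-1 ^+ n by ring.
  apply: lerD => //; apply: le_trans h2 _; rewrite ler_wpM2l//.
  rewrite exprS ler_piMl ?exprn_ge0 ?invr_ge0//.
  by rewrite invf_le1// ler1n.
rewrite -ez exprMn mulrA normrM (ger0_norm (exprn_ge0 _ (ltW z0))).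
by rewrite ler_pM2r// exprn_gt0.
Qed.

Lemma expandsD f g b c : expands f b -> expands g c ->
  expands (fun z => f z + g z) (fun n => b n + c n).
Proof.
move=> [r [C [r0 C0 hf]]] [s [D [s0 D0 hg]]]; exists (r + s), (C + D).
split; [exact: addr_gt0 | exact: addr_ge0 |] => z z0 hz N.
have hz1 : r * `|z| < 1.
  by apply: le_lt_trans hz; rewrite ler_wpM2r// lerDl ltW.
have hz2 : s * `|z| < 1.
  by apply: le_lt_trans hz; rewrite ler_wpM2r// lerDr ltW.
under eq_bigr do rewrite mulrDl.
rewrite big_split/= mulrDl.
have -> : f z + g z - (\sum_(i < N) b i * z ^+ i + \sum_(i < N) c i * z ^+ i) =
  (f z - \sum_(i < N) b i * z ^+ i) + (g z - \sum_(i < N) c i * z ^+ i) by ring.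
apply: le_trans (ler_normD _ _) _; apply: lerD.
  apply: le_trans (hf _ z0 hz1 N) _; apply: ler_CX => //.
    by rewrite mulr_ge0// ltW.
  by rewrite ler_wpM2r// lerDl ltW.
apply: le_trans (hg _ z0 hz2 N) _; apply: ler_CX => //.
  by rewrite mulr_ge0// ltW.
by rewrite ler_wpM2r// lerDr ltW.
Qed.

Lemma expandsZ k f b : expands f b -> expands (fun z => k * f z) (fun n => k * b n).
Proof.
move=> [r [C [r0 C0 hf]]]; exists r, (`|k| * C); split; rewrite ?mulr_ge0//.
move=> z z0 hz N; under eq_bigr do rewrite -mulrA.
by rewrite -mulr_sumr -mulrBr normrM -mulrA ler_wpM2l// hf.
Qed.

Lemma expands_cst k : expands (fun=> k) (fun n => if n is 0 then k else 0).
Proof.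
exists 1, `|k|; split=> // z z0 hz [|N].
  by rewrite big_ord0 subr0 expr0 mulr1.
have e0 : \sum_(i < N) 0 * z ^+ bump 0 i = 0 :> K by apply: big1 => i _; rewrite mul0r.
rewrite big_ord_recl/= expr0 mulr1 e0 addr0 subrr normr0.
by rewrite mulr_ge0// exprn_ge0// mulr_ge0.
Qed.

Lemma expandsXM f b : expands f b ->
  expands (fun z => z * f z) (fun n => if n is n'.+1 then b n' else 0).
Proof.
move=> [r [C [r0 C0 hf]]]; exists r, ((r^-1 * C) + C); split=> //.
  by rewrite addr_ge0// mulr_ge0// invr_ge0 ltW.
have rz z : 0 <= r * `|z| by rewrite mulr_ge0// ltW.
move=> z z0 hz [|N].
  rewrite big_ord0 subr0 expr0 mulr1 normrM.
  have := hf z z0 hz 0; rewrite big_ord0 subr0 expr0 mulr1 => h.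
  have h1 : `|z| <= r^-1 by rewrite -[r^-1]mulr1 ler_pdivlMl// ltW.
  by rewrite -[leLHS]addr0 lerD// ler_pM.
rewrite big_ord_recl/= mul0r add0r.
have -> : \sum_(i < N) b i * z ^+ (bump 0 i) = z * \sum_(i < N) b i * z ^+ i.
  by rewrite mulr_sumr; apply: eq_bigr => i _; rewrite /bump/= add1n exprS mulrCA.
rewrite -mulrBr normrM exprS mulrDl -[leLHS]addr0 lerD//; last first.
  by rewrite mulr_ge0// mulr_ge0// exprn_ge0.
have -> : r^-1 * C * (r * `|z| * (r * `|z|) ^+ N) = `|z| * (C * (r * `|z|) ^+ N).
  by field; rewrite gt_eqF.
by rewrite ler_wpM2l// hf.
Qed.

Lemma expandsXV f b : expands f b -> b 0%N = 0 ->
  expands (fun z => f z / z) (fun n => b n.+1).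
Proof.
move=> [r [C [r0 C0 hf]]] b0; exists r, (C * r); split=> //.
  by rewrite mulr_ge0// ltW.
move=> z z0 hz N.
have /(_ N.+1) := hf z z0 hz; rewrite big_ord_recl b0 mul0r add0r => h.
have nz : 0 < `|z| by rewrite normr_gt0.
rewrite -(ler_pM2l nz) -normrM mulrBr mulrCA divff// mulr1 mulr_sumr.
apply: le_trans (_ : C * (r * `|z|) ^+ N.+1 <= _).
  apply: le_trans h; apply: eqle; congr (`|_ - _|); apply: eq_bigr => i _.
  by rewrite !lift0 exprS mulrCA.
by apply: eqle; rewrite exprS; ring.
Qed.

End Expansions.

Section ExpandsMul.
Variable K : numFieldType.
Implicit Types (f g : K -> K) (b c : nat -> K) (x y z t : K).

(** Cauchy product of two coefficient sequences. *)
Definition conv b c n := \sum_(k < n.+1) b k * c (n - k)%N.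

Lemma conv_partial_sum b c N :
  \sum_(n < N) conv b c n = \sum_(k < N) b k * \sum_(j < N - k) c j.
Proof.
elim: N => [|N IH]; first by rewrite !big_ord0.
rewrite big_ord_recr/= IH /conv big_ord_recr/= [in RHS]big_ord_recr/= subSnn.
rewrite big_ord_recl big_ord0 addr0 subnn addrA; congr (_ + _).
rewrite -big_split/=; apply: eq_bigr => i _.
by rewrite -mulrDr subSn 1?ltnW// big_ord_recr.
Qed.

(** The error is that of the first factor times G, plus the terms u_k times the
errors of the second factor. There are N such terms of size t ^ N, and N is
absorbed into 2 ^ N. *)
Lemma partial_sum_mul F G (u v : nat -> K) C D t : 0 <= C -> 0 <= D ->
  0 <= t -> t <= 1 ->
  (forall N, `|F - \sum_(n < N) u n| <= C * t ^+ N) ->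
  (forall N, `|G - \sum_(n < N) v n| <= D * t ^+ N) ->
  forall N, `|F * G - \sum_(n < N) conv u v n| <= 3 * C * D * (2 * t) ^+ N.
Proof.
move=> C0 D0 t0 t1 hF hG N; rewrite conv_partial_sum.
have hu n : `|u n| <= 2 * C * t ^+ n.
  have -> : u n = (F - \sum_(i < n) u i) - (F - \sum_(i < n.+1) u i).
    by rewrite big_ord_recr/=; ring.
  apply: le_trans (ler_normB _ _) _.
  have -> : 2 * C * t ^+ n = C * t ^+ n + C * t ^+ n by ring.
  apply: lerD => //; apply: le_trans (hF _) _; rewrite ler_wpM2l// exprS.
  by rewrite ler_piMl ?exprn_ge0.
have -> : F * G - \sum_(k < N) u k * (\sum_(j < N - k) v j) =
  (F - \sum_(k < N) u k) * G + \sum_(k < N) u k * (G - \sum_(j < N - k) v j).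
  have -> : \sum_(k < N) u k * (G - \sum_(j < N - k) v j) =
      (\sum_(k < N) u k) * G - \sum_(k < N) u k * \sum_(j < N - k) v j.
    by rewrite mulr_suml -sumrB; apply: eq_bigr => k _; rewrite mulrBr.
  by rewrite mulrBl addrA subrK.
apply: le_trans (ler_normD _ _) _.
apply: le_trans (_ : C * D * t ^+ N + \sum_(k < N) 2 * C * D * t ^+ N <= _).
  apply: lerD.
    rewrite normrM mulrAC ler_pM//.
    by have := hG 0%N; rewrite big_ord0 subr0 expr0 mulr1.
  apply: le_trans (ler_norm_sum _ _ _) _; apply: ler_sum => k _.
  rewrite normrM.
  have -> : 2 * C * D * t ^+ N = (2 * C * t ^+ k) * (D * t ^+ (N - k)).
    by rewrite -[in LHS](subnKC (ltnW (ltn_ord k))) exprD; ring.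
  by rewrite ler_pM.
rewrite sumr_const card_ord exprMn -[X in _ + X]mulr_natr.
have -> : C * D * t ^+ N + 2 * C * D * t ^+ N * N%:R = C * D * t ^+ N * (1 + 2 * N)%:R.
  by rewrite natrD natrM; ring.
have -> : 3 * C * D * (2 ^+ N * t ^+ N) = C * D * t ^+ N * (3 * 2 ^ N)%:R.
  by rewrite natrM natrX; ring.
rewrite ler_wpM2l ?mulr_ge0 ?exprn_ge0// ler_nat.
by elim: (N) => [//|m IH]; rewrite expnS; lia.
Qed.

Lemma expandsM f g b c : expands f b -> expands g c ->
  expands (fun z => f z * g z) (conv b c).
Proof.
move=> [r [C [r0 C0 hf]]] [s [D [s0 D0 hg]]].
have rs0 : 0 < r + s by exact: addr_gt0.
exists (2 * (r + s)), (3 * C * D); split; rewrite ?mulr_gt0 ?mulr_ge0//.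
move=> z z0 hz N.
have t0 : 0 <= (r + s) * `|z| by rewrite mulr_ge0// ltW.
have t1 : (r + s) * `|z| < 1.
  apply: le_lt_trans hz; rewrite -mulrA ler_peMl// ler1n//.
have hr : r * `|z| <= (r + s) * `|z| by rewrite ler_wpM2r// lerDl ltW.
have hs : s * `|z| <= (r + s) * `|z| by rewrite ler_wpM2r// lerDr ltW.
have -> : \sum_(n < N) conv b c n * z ^+ n =
    \sum_(n < N) conv (fun n => b n * z ^+ n) (fun n => c n * z ^+ n) n.
  apply: eq_bigr => n _; rewrite mulr_suml; apply: eq_bigr => k _.
  by rewrite -{1}[in z ^+ n](subnKC (leq_ord k : (k <= n)%N)) exprD; ring.
rewrite -(mulrA 2); apply: partial_sum_mul => //; first exact: ltW.
  move=> M; apply: le_trans (hf _ z0 (le_lt_trans hr t1) M) _.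
  by rewrite ler_wpM2l// lerXn2r// nnegrE mulr_ge0// ltW.
move=> M; apply: le_trans (hg _ z0 (le_lt_trans hs t1) M) _.
by rewrite ler_wpM2l// lerXn2r// nnegrE mulr_ge0// ltW.
Qed.

End ExpandsMul.

Section ExpandsInverse.
Variable K : numFieldType.
Implicit Types (f g : K -> K) (b c : nat -> K) (x y z t : K).

(** For z small compared with b_0 / C, the remainder of order one would be
smaller than b_0. *)
Lemma expands0_coef0 b : expands (fun=> 0) b -> b 0%N = 0.
Proof.
move=> [r [C [r0 C0 h]]]; apply/eqP/negPn/negP => b0.
have nb : 0 < `|b 0%N| by rewrite normr_gt0.
have D0 : 0 < `|b 0%N| + C by rewrite ltr_pwDl.
set t := `|b 0%N| / (2 * (`|b 0%N| + C)).
have t0 : 0 < t by rewrite divr_gt0 ?mulr_gt0.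
have t1 : t < 1.
  rewrite ltr_pdivrMr ?mulr_gt0// mul1r (@lt_le_trans _ _ (2 * `|b 0%N|))//.
    by rewrite ltr_pMl// ltr1n.
  by rewrite ler_pM2l// lerDl.
have z0 : r^-1 * t != 0 by rewrite mulf_neq0 ?invr_eq0 ?gt_eqF.
have ez : r * `|r^-1 * t| = t.
  have rt0 : 0 < r^-1 * t by rewrite mulr_gt0// invr_gt0.
  by rewrite gtr0_norm// mulrA divff ?mul1r// gt_eqF.
have := h _ z0; rewrite ez => /(_ t1 1%N).
rewrite big_ord1 !expr1 expr0 mulr1 sub0r normrN => hb.
have : `|b 0%N| < `|b 0%N|.
  apply: le_lt_trans hb _.
  apply: le_lt_trans (_ : (`|b 0%N| + C) * t < _).
    by rewrite ler_wpM2r ?(ltW t0)// lerDr ltW.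
  rewrite /t.
  have -> : (`|b 0%N| + C) * (`|b 0%N| / (2 * (`|b 0%N| + C))) = `|b 0%N| / 2.
    by field; rewrite gt_eqF.
  by rewrite ltr_pdivrMr// ltr_pMr// ltr1n.
by rewrite ltxx.
Qed.

Lemma expands0_coef b n : expands (fun=> 0) b -> b n = 0.
Proof.
elim: n b => [|n IH] b eb; first exact: expands0_coef0.
apply: (IH (fun n => b n.+1)); apply: expands_eq (expandsXV eb (expands0_coef0 eb)).
by apply: near_zero_all => z _; rewrite mul0r.
Qed.

Lemma expands_uniq f g b c : near_zero (fun z => f z = g z) ->
  expands f b -> expands g c -> b = c.
Proof.
move=> fg fb gc; apply/funext => n; apply/eqP; rewrite -subr_eq0; apply/eqP.
apply: (@expands0_coef (fun n => b n - c n)).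
have -> : (fun n => b n - c n) = (fun n => b n + -1 * c n).
  by apply/funext => m; rewrite mulN1r.
apply: expands_eq (expandsD fb (expandsZ (-1) gc)).
by apply: near_zeroW fg => z _ ->; rewrite mulN1r subrr.
Qed.

Lemma expands_comp_scale f b k : k != 0 -> expands f b ->
  expands (fun z => f (k * z)) (fun n => b n * k ^+ n).
Proof.
move=> k0 [r [C [r0 C0 h]]]; exists (r * `|k|), C; split=> //.
  by rewrite mulr_gt0// normr_gt0.
move=> z z0; rewrite -mulrA -normrM => hz N.
under eq_bigr do rewrite -mulrA -exprMn.
by apply: h => //; rewrite mulf_neq0.
Qed.

(** Each coefficient of an inverse series involves all the previous ones, so
the recursion carries the whole prefix along. *)
Fixpoint inverse_prefix b n : seq K :=
  if n is n'.+1 then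
    let s := inverse_prefix b n' in
    rcons s ((b 0%N)^-1 * ((n' == 0%N)%:R - \sum_(k < n') nth 0 s k * b (n' - k)%N))
  else [::].

Definition inverse_coef b n := nth 0 (inverse_prefix b n.+1) n.

Lemma size_inverse_prefix b n : size (inverse_prefix b n) = n.
Proof. by elim: n => //= n IH; rewrite size_rcons IH. Qed.

Lemma nth_inverse_prefix b n k : (k < n)%N ->
  nth 0 (inverse_prefix b n) k = inverse_coef b k.
Proof.
elim: n => // n IH; rewrite ltnS leq_eqVlt => /predU1P[->//|kn] /=.
by rewrite nth_rcons size_inverse_prefix kn IH.
Qed.

Lemma inverse_coefE b n : inverse_coef b n =
  (b 0%N)^-1 * ((n == 0%N)%:R - \sum_(k < n) inverse_coef b k * b (n - k)%N).
Proof.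
rewrite {1}/inverse_coef/= nth_rcons size_inverse_prefix ltnn eqxx.
congr (_ * (_ - _)); apply: eq_bigr => k _; by rewrite nth_inverse_prefix.
Qed.

Lemma conv_inverse b n : b 0%N != 0 -> conv (inverse_coef b) b n = (n == 0%N)%:R.
Proof.
move=> b0; rewrite /conv big_ord_recr/= subnn [X in _ + X * _]inverse_coefE.
by rewrite mulrAC mulVf// mul1r addrC subrK.
Qed.

(** The recursion sums a geometric series of ratio m = 1 + B / |b_0|, whose
value is controlled by the next power of m. *)
Lemma inverse_coef_bound b (rho B : K) : b 0%N != 0 -> 0 < rho -> 0 <= B ->
  (forall n, `|b n| <= B * rho ^+ n) ->
  exists2 sigma : K, rho <= sigma &
    forall n, `|inverse_coef b n| <= `|b 0%N|^-1 * sigma ^+ n.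
Proof.
move=> b0 r0 B0 hb; set A := `|b 0%N|^-1.
have A0 : 0 < A by rewrite invr_gt0 normr_gt0.
set m := 1 + B * A; have m0 : 0 < m by rewrite ltr_pwDl// mulr_ge0// ltW.
exists (rho * m).
  by apply: ler_peMr; rewrite ?lerDl ?mulr_ge0 ?(ltW r0) ?(ltW A0).
elim/ltn_ind => n IH; rewrite inverse_coefE normrM normfV -/A.
rewrite ler_pM2l//; case: n IH => [|n] IH.
  by rewrite big_ord0 subr0 expr0 normr1.
rewrite sub0r normrN; apply: le_trans (ler_norm_sum _ _ _) _.
apply: le_trans (_ : \sum_(k < n.+1) A * B * rho ^+ n.+1 * m ^+ k <= _).
  apply: ler_sum => k _; rewrite normrM.
  apply: le_trans (ler_pM _ _ (IH _ (ltn_ord k)) (hb _)) _ => //.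
  have -> : rho ^+ n.+1 = rho ^+ k * rho ^+ (n.+1 - k).
    by rewrite -exprD subnKC// ltnW.
  by rewrite exprMn le_eqVlt; apply/orP; left; apply/eqP; ring.
rewrite -mulr_sumr exprMn (mulrC (A * B)) -mulrA ler_wpM2l ?exprn_ge0 ?(ltW r0)//.
have -> : A * B = m - 1 by rewrite /m addrAC subrr add0r mulrC.
by rewrite -subrX1 gerBl.
Qed.

(** The remainder of order one keeps f close to b_0. *)
Lemma near_zero_coef0 f b : expands f b -> b 0%N != 0 ->
  near_zero (fun z => `|b 0%N| / 2 <= `|f z|).
Proof.
move=> [r [C [r0 C0 hf]]] b0.
have nb : 0 < `|b 0%N| by rewrite normr_gt0.
set D := 2 * C / `|b 0%N|; have D0 : 0 <= D by rewrite divr_ge0 ?mulr_ge0.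
exists (r * (1 + D)); first by rewrite mulr_gt0// ltr_pwDl.
move=> z z0 hz.
have rz0 : 0 <= r * `|z| by rewrite mulr_ge0// ltW.
have rD : 1 <= 1 + D by rewrite lerDl.
have hz1 : r * `|z| < 1.
  by apply: le_lt_trans hz; rewrite mulrAC ler_peMr.
have hz2 : D * (r * `|z|) <= 1.
  apply: le_trans (ltW hz); have -> : D * (r * `|z|) = r * D * `|z| by ring.
  by rewrite ler_wpM2r// ler_wpM2l ?(ltW r0)// lerDr.
have := hf _ z0 hz1 1%N; rewrite big_ord1 expr0 mulr1 expr1 => h.
have : C * (r * `|z|) <= `|b 0%N| / 2.
  have -> : C * (r * `|z|) = `|b 0%N| / 2 * (D * (r * `|z|)).
    by rewrite /D; field; rewrite gt_eqF.
  by rewrite ler_piMr// divr_ge0 ?ltW.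
move=> /(le_trans h) {}h.
have := ler_normB (f z - b 0%N) (f z).
rewrite addrAC subrr add0r normrN => /le_trans/(_ (lerD h (lexx _))).
have {1}-> : `|b 0%N| = `|b 0%N| / 2 + `|b 0%N| / 2 by field.
by rewrite lerD2l.
Qed.

Lemma near_zero_neq0 f b : expands f b -> b 0%N != 0 -> near_zero (fun z => f z != 0).
Proof.
move=> fb b0; apply: near_zeroW (near_zero_coef0 fb b0) => z _.
by apply: contraTneq => ->; rewrite normr0 lt_geF// divr_gt0// normr_gt0.
Qed.

(** If T is a partial sum of the inverse series, then 1/f - T = (1 - f T) / f,
and 1 - f T only involves the remainders of f, because the Cauchy product of
the two series is 1. *)
Lemma expandsV f b : expands f b -> b 0%N != 0 ->
  expands (fun z => (f z)^-1) (inverse_coef b).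
Proof.
move=> fb b0; have [r1 r10 hlow] := near_zero_coef0 fb b0.
have [rho [B [rho0 B0 hb]]] := expands_coef fb.
have [sg rsg hc] := inverse_coef_bound b0 rho0 B0 hb.
have [r [C [r0 C0 hf]]] := fb.
set A := `|b 0%N|^-1 in hc *.
have nb : 0 < `|b 0%N| by rewrite normr_gt0.
have A0 : 0 < A by rewrite invr_gt0.
have sg0 : 0 < sg by exact: lt_le_trans rsg.
pose s := sg + r + r1.
have s0 : 0 < s by rewrite !addr_gt0.
exists (2 * s), (2 * A * (1 + A * C)); split; first by rewrite mulr_gt0.
  by rewrite !mulr_ge0 ?addr_ge0 ?mulr_ge0// ltW.
move=> z z0 hz N.
have t0 : 0 <= s * `|z| by rewrite mulr_ge0// ltW.
have t1 : s * `|z| < 1 by apply: le_lt_trans hz; rewrite -mulrA ler_peMl// ler1n.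
have lerz u : u <= s -> u * `|z| <= s * `|z| by move=> us; rewrite ler_wpM2r.
have sgs : sg * `|z| <= s * `|z|.
  by apply: lerz; rewrite /s -addrA lerDl addr_ge0// ltW.
have rs : r * `|z| <= s * `|z|.
  by apply: lerz; rewrite /s addrAC lerDr addr_ge0// ltW.
have r1s : r1 * `|z| <= s * `|z|.
  by apply: lerz; rewrite /s lerDr addr_ge0// ltW.
have flow := hlow z z0 (le_lt_trans r1s t1).
have f0 : f z != 0.
  by apply: contraTneq flow => ->; rewrite normr0 lt_geF// divr_gt0.
have nf : `|(f z)^-1| <= 2 * A.
  have -> : 2 * A = (`|b 0%N| / 2)^-1 by rewrite invfM invrK mulrC.
  by rewrite normfV lef_pV2// ?posrE ?normr_gt0// divr_gt0.
pose T M := \sum_(k < M) inverse_coef b k * z ^+ k.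
rewrite -/(T N).
have key : `|1 - f z * T N| <= (1 + A * C) * (2 * (s * `|z|)) ^+ N.
  case: N => [|N].
    by rewrite /T big_ord0 mulr0 subr0 normr1 expr0 mulr1 lerDl mulr_ge0// ltW.
  have -> : 1 - f z * T N.+1 = - \sum_(k < N.+1) inverse_coef b k * z ^+ k *
      (f z - \sum_(j < N.+1 - k) b j * z ^+ j).
    have : \sum_(n < N.+1) conv (fun n => inverse_coef b n * z ^+ n)
              (fun n => b n * z ^+ n) n = 1.
      rewrite big_ord_recl big1 ?addr0.
        rewrite /conv big_ord_recl big_ord0 addr0 !expr0 !mulr1.
        by have := conv_inverse 0 b0; rewrite /conv big_ord_recl big_ord0 addr0 => ->.
      move=> i _; rewrite lift0.
      transitivity (conv (inverse_coef b) b i.+1 * z ^+ i.+1).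
        rewrite /conv mulr_suml; apply: eq_bigr => k _.
        have -> : z ^+ i.+1 = z ^+ k * z ^+ (i.+1 - k).
          by rewrite -exprD subnKC// leq_ord.
        by ring.
      by rewrite conv_inverse// mul0r.
    rewrite conv_partial_sum => {1}<-; rewrite /T mulr_sumr -sumrB -sumrN.
    by apply: eq_bigr => k _; ring.
  rewrite normrN; apply: le_trans (ler_norm_sum _ _ _) _.
  apply: le_trans (_ : \sum_(k < N.+1) A * C * (s * `|z|) ^+ N.+1 <= _).
    apply: ler_sum => k _; rewrite normrM.
    have -> : A * C * (s * `|z|) ^+ N.+1 =
      (A * (s * `|z|) ^+ k) * (C * (s * `|z|) ^+ (N.+1 - k)).
      have -> : (s * `|z|) ^+ N.+1 = (s * `|z|) ^+ k * (s * `|z|) ^+ (N.+1 - k).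
        by rewrite -exprD subnKC// ltnW.
      by ring.
    rewrite ler_pM//.
      rewrite normrM normrX; apply: le_trans (ler_wpM2r (exprn_ge0 _ (normr_ge0 z)) (hc k)) _.
      rewrite -mulrA -exprMn ler_wpM2l ?(ltW A0)// lerXn2r// nnegrE//.
      by rewrite mulr_ge0// ltW.
    apply: le_trans (hf _ z0 (le_lt_trans rs t1) _) _.
    by rewrite ler_wpM2l// lerXn2r// nnegrE// mulr_ge0// ltW.
  rewrite sumr_const card_ord (exprMn _ 2) -[leLHS]mulr_natr.
  apply: le_trans (_ : (1 + A * C) * (s * `|z|) ^+ N.+1 * N.+1%:R <= _).
    rewrite ler_wpM2r ?ler0n// ler_wpM2r ?exprn_ge0// lerDr//.
  rewrite [X in _ <= _ * X]mulrC mulrA ler_wpM2l//.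
    by rewrite mulr_ge0 ?exprn_ge0// addr_ge0// mulr_ge0// ltW.
  by rewrite -natrX ler_nat ltnW// ltn_expl.
have -> : (f z)^-1 - T N = (f z)^-1 * (1 - f z * T N).
  by rewrite mulrBr mulr1 mulrA mulVf// mul1r.
rewrite normrM -(mulrA (2 * A)); apply: ler_pM => //.
by rewrite -(mulrA 2 s).
Qed.

End ExpandsInverse.

(** * Laurent expansions and residues *)

Section Laurent.
Variable K : numFieldType.
Implicit Types (f g F : K -> K) (b c : nat -> K) (x y z t : K).

(** The coefficient of 1/z is b m, with the indexing of is_residue0. *)
Definition laurent F (m : nat) b := expands (fun z => z ^+ m.+1 * F z) b.

Definition meromorphic0 F := exists m b, laurent F m b.

Lemma laurent_eq F H m b : near_zero (fun z => F z = H z) ->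
  laurent F m b -> laurent H m b.
Proof. by move=> h; apply: expands_eq; apply: near_zeroW h => z _ ->. Qed.

(** Allowing a pole of higher order shifts the coefficients without changing
that of 1/z, which is how expansions with different m are compared. *)
Lemma laurent_raise F m b k : laurent F m b ->
  exists2 c, laurent F (m + k)%N c & c (m + k)%N = b m.
Proof.
move=> h; elim: k => [|k [c hc ec]]; first by exists b; rewrite ?addn0.
exists (fun n => if n is n'.+1 then c n' else 0); last by rewrite addnS.
rewrite /laurent addnS; apply: expands_eq (expandsXM hc).
by apply: near_zero_all => z _; rewrite mulrA -exprS.
Qed.

Lemma laurent_uniq F m m' b b' : laurent F m b -> laurent F m' b' -> b m = b' m'.
Proof.
move=> /(laurent_raise m')[c hc <-] /(laurent_raise m)[c' hc' <-].
rewrite (addnC m') in hc' *.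
by rewrite (expands_uniq _ hc hc')//; exact: near_zero_all.
Qed.

Lemma laurentD F H m m' b b' : laurent F m b -> laurent H m' b' ->
  exists m'' b'', laurent (fun z => F z + H z) m'' b'' /\ b'' m'' = b m + b' m'.
Proof.
move=> /(laurent_raise m')[c hc <-] /(laurent_raise m)[c' hc' <-].
rewrite (addnC m') in hc' *.
exists (m + m')%N, (fun n => c n + c' n); split=> //.
apply: expands_eq (expandsD hc hc').
by apply: near_zero_all => z _; rewrite mulrDr.
Qed.

Lemma laurentZ k F m b : laurent F m b ->
  laurent (fun z => k * F z) m (fun n => k * b n).
Proof.
move=> h; apply: expands_eq (expandsZ k h).
by apply: near_zero_all => z _; rewrite mulrCA.
Qed.

Lemma meromorphic0_eq F H : near_zero (fun z => F z = H z) ->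
  meromorphic0 F -> meromorphic0 H.
Proof. by move=> h [m [b hb]]; exists m, b; exact: laurent_eq hb. Qed.

Lemma meromorphic0D F H : meromorphic0 F -> meromorphic0 H ->
  meromorphic0 (fun z => F z + H z).
Proof.
move=> [m [b hb]] [m' [b' hb']]; have [m2 [b2 [h _]]] := laurentD hb hb'.
by exists m2, b2.
Qed.

Lemma meromorphic0M F H : meromorphic0 F -> meromorphic0 H ->
  meromorphic0 (fun z => F z * H z).
Proof.
move=> [m [b hb]] [m' [b' hb']]; exists (m + m').+1, (conv b b').
apply: expands_eq (expandsM hb hb').
by apply: near_zero_all => z _; rewrite -addnS -addSn exprD; ring.
Qed.

Lemma expands_laurent f b : expands f b ->
  laurent f 0 (fun n => if n is n'.+1 then b n' else 0).
Proof. exact: expandsXM. Qed.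

Lemma expands_meromorphic0 f b : expands f b -> meromorphic0 f.
Proof. by move=> /expands_laurent h; exists 0%N; eexists; exact: h. Qed.

Lemma meromorphic0_cst k : meromorphic0 (fun=> k).
Proof. exact: expands_meromorphic0 (expands_cst k). Qed.

Lemma meromorphic0X F n : meromorphic0 F -> meromorphic0 (fun z => F z ^+ n).
Proof.
move=> h; elim: n => [|n IH]; first exact: meromorphic0_cst.
by under eq_fun do rewrite exprS; exact: meromorphic0M.
Qed.

Lemma meromorphic0_sum (I : Type) (s : seq I) (F : I -> K -> K) :
  (forall i, meromorphic0 (F i)) -> meromorphic0 (fun z => \sum_(i <- s) F i z).
Proof.
move=> h; elim: s => [|i s IH].
  by under eq_fun do rewrite big_nil; exact: meromorphic0_cst.
by under eq_fun do rewrite big_cons; exact: meromorphic0D.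
Qed.

Definition analytic0 f := exists b, expands f b.

Lemma analytic0_meromorphic0 f : analytic0 f -> meromorphic0 f.
Proof. by move=> [b]; exact: expands_meromorphic0. Qed.

Lemma analytic0_cst k : analytic0 (fun=> k).
Proof. by eexists; exact: expands_cst. Qed.

Lemma analytic0D f g : analytic0 f -> analytic0 g -> analytic0 (fun z => f z + g z).
Proof. by move=> [b hb] [c hc]; eexists; exact: expandsD hb hc. Qed.

Lemma analytic0M f g : analytic0 f -> analytic0 g -> analytic0 (fun z => f z * g z).
Proof. by move=> [b hb] [c hc]; eexists; exact: expandsM hb hc. Qed.

Lemma analytic0X F n : analytic0 F -> analytic0 (fun z => F z ^+ n).
Proof.
move=> h; elim: n => [|n IH]; first exact: analytic0_cst.
by under eq_fun do rewrite exprS; exact: analytic0M.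
Qed.

Lemma analytic0_sum (I : Type) (s : seq I) (F : I -> K -> K) :
  (forall i, analytic0 (F i)) -> analytic0 (fun z => \sum_(i <- s) F i z).
Proof.
move=> h; elim: s => [|i s IH].
  by under eq_fun do rewrite big_nil; exact: analytic0_cst.
by under eq_fun do rewrite big_cons; exact: analytic0D.
Qed.

Lemma sum_tail_bound (u : nat -> K) C t N M : 0 <= C -> 0 <= t -> t <= 2^-1 ->
  (forall n, `|u n| <= C * t ^+ n) ->
  `|\sum_(n < N + M) u n - \sum_(n < N) u n| <= 2 * C * t ^+ N.
Proof.
move=> C0 t0 t2 hu.
suff : `|\sum_(n < N + M) u n - \sum_(n < N) u n| <=
    2 * C * (t ^+ N - t ^+ N * 2^-1 ^+ M).
  move=> /le_trans; apply; rewrite ler_wpM2l ?mulr_ge0// gerBl.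
  by rewrite mulr_ge0 ?exprn_ge0// invr_ge0.
elim: M => [|M IH].
  by rewrite addn0 subrr normr0 expr0 mulr1 subrr mulr0.
rewrite addnS big_ord_recr/= addrAC; apply: le_trans (ler_normD _ _) _.
apply: le_trans (lerD IH (hu _)) _.
have -> : 2 * C * (t ^+ N - t ^+ N * 2^-1 ^+ M.+1) =
    2 * C * (t ^+ N - t ^+ N * 2^-1 ^+ M) + C * (t ^+ N * 2^-1 ^+ M).
  by rewrite exprS; field.
rewrite lerD2l ler_wpM2l// exprD ler_wpM2l ?exprn_ge0//.
by rewrite lerXn2r// nnegrE// invr_ge0.
Qed.

(** A series dominated by a geometric one of ratio at most 1/2 has a tail at
most twice its first bound. *)
Lemma series_remainder (u : nat -> K) C t (L : K) N :
  0 <= C -> 0 <= t -> t <= 2^-1 -> (forall n, `|u n| <= C * t ^+ n) ->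
  series (u : nat -> K^o) @ \oo --> (L : K^o) ->
  `|L - \sum_(n < N) u n| <= 2 * C * t ^+ N.
Proof.
move=> C0 t0 t2 hu /(@cvgrPdist_lt _ K^o) hL; apply/ler_addgt0Pr => e e0.
have [M _ hM] := hL e e0.
have /= := hM (N + M)%N (leq_addl _ _).
rewrite seriesEord/= => h.
have -> : L - \sum_(n < N) u n =
  (L - \sum_(n < N + M) u n) + (\sum_(n < N + M) u n - \sum_(n < N) u n) by ring.
rewrite [leRHS]addrC; apply: le_trans (ler_normD _ _) _.
by apply: lerD; [exact: ltW | exact: sum_tail_bound].
Qed.

End Laurent.

Section LaurentConvergence.
Variable K : numFieldType.
Implicit Types (F : K -> K) (b : nat -> K).

(** Convergence at one point bounds the terms there, which makes the remainders
geometric at points twice as close to 0. *)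
Lemma convergent_laurent F m b :
  (\forall z \near (0 : K^o)^', series (fun n => b n * z ^+ n : K^o) @ \oo -->
        (z ^+ m.+1 * F z : K^o)) -> laurent F m b.
Proof.
move=> h.
  have [e /= e0 he] := (@nbhs_ballP K K^o _ _).1 h.
  have z00 : 0 < e / 2 by rewrite divr_gt0.
  have cz : series (fun n => b n * (e / 2) ^+ n : K^o) @ \oo -->
      ((e / 2) ^+ m.+1 * F (e / 2) : K^o).
    apply: he; last by rewrite gt_eqF.
    rewrite /ball/= sub0r normrN gtr0_norm// ltr_pdivrMr// ltr_pMr// ltr1n//.
  have /cvg_series_cvg_0 : cvgn (series (fun n => b n * (e / 2) ^+ n : K^o)).
    by apply/cvg_ex; eexists; exact: cz.
  move=> /(@cvgrPdist_lt _ K^o)/(_ 1 ltr01)[M _ hM].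
  set D := 1 + \sum_(n < M) `|b n * (e / 2) ^+ n|.
  have D0 : 0 <= D by rewrite addr_ge0// sumr_ge0.
  have hD n : `|b n| <= D * (e / 2)^-1 ^+ n.
    rewrite exprVn ler_pdivlMr ?exprn_gt0//.
    rewrite -[X in _ * X](@gtr0_norm _ ((e / 2) ^+ n)) ?exprn_gt0// -normrM.
    have [Mn|nM] := leqP M n.
      have := hM n Mn; rewrite /= sub0r normrN => /ltW/le_trans; apply.
      by rewrite lerDl sumr_ge0.
    rewrite /D (bigD1 (Ordinal nM))//= addrCA lerDl addr_ge0// sumr_ge0//.
  have r0 : 0 < (e / 2)^-1 by rewrite invr_gt0.
  exists (2 * (e / 2)^-1), (2 * D); split; [exact: mulr_gt0|exact: mulr_ge0|].
  move=> z z0 hz N.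
  have hz2 : (e / 2)^-1 * `|z| <= 2^-1.
    by rewrite -[leRHS]mulr1 ler_pdivlMl// mulrA ltW.
  apply: le_trans (_ : 2 * D * ((e / 2)^-1 * `|z|) ^+ N <= _); last first.
    rewrite ler_wpM2l ?mulr_ge0// lerXn2r// ?nnegrE ?mulr_ge0// ?(ltW r0)//.
    by rewrite -mulrA ler_peMl ?ler1n// mulr_ge0// ltW.
  apply: (@series_remainder K (fun n => b n * z ^+ n)) => //.
  - by rewrite mulr_ge0// ltW.
  - move=> n; rewrite normrM exprMn normrX mulrA ler_wpM2r ?exprn_ge0//.
  - apply: he => //; rewrite /ball/= sub0r normrN.
    have : `|z| <= (e / 2) * 2^-1 by rewrite -ler_pdivrMl.
    move=> /le_lt_trans; apply; rewrite -mulrA gtr_pMr// -invfM -natrM.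
    by rewrite invf_lt1 ?ltr1n ?ltr0n.
Qed.

(** The first hypothesis is the Archimedean property in the form needed to let
the remainders tend to 0. *)
Lemma laurent_convergent F m b :
  (forall c e : K, 0 <= c -> 0 < e ->
    exists N, forall n, (N <= n)%N -> c * 2^-1 ^+ n < e) ->
  laurent F m b ->
  \forall z \near (0 : K^o)^', series (fun n => b n * z ^+ n : K^o) @ \oo -->
        (z ^+ m.+1 * F z : K^o).
Proof.
move=> small [r [D [r0 D0 h]]].
apply/(@nbhs_ballP K K^o); exists (2 * r)^-1; first by rewrite /= invr_gt0 mulr_gt0.
move=> z; rewrite /ball/= sub0r normrN => hz z0.
have rz : r * `|z| <= 2^-1.
  by rewrite -ler_pdivlMl// -invfM mulrC ltW// mulrC.
have rz1 : r * `|z| < 1 by apply: le_lt_trans rz _; rewrite invf_lt1// ltr1n.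
apply/(@cvgrPdist_lt _ K^o) => e e0.
have [N hN] := small _ _ D0 e0.
exists N => // n /= /hN; apply: le_lt_trans.
rewrite seriesEord/=; apply: le_trans (h _ z0 rz1 n) _.
by rewrite ler_wpM2l// lerXn2r// nnegrE ?invr_ge0// mulr_ge0// ltW.
Qed.

End LaurentConvergence.

Section Residues.
Variable R : realType.
Local Notation C := R[i].
Local Open Scope complex_scope.

Lemma complex_half_power_small (c e : C) : 0 <= c -> 0 < e ->
  exists N, forall n, (N <= n)%N -> c * 2^-1 ^+ n < e.
Proof.
move=> c0 e0; have ce0 : 0 <= c / e by rewrite divr_ge0// ltW.
exists (Num.Def.archi_bound (complex.Re (c / e))) => n Nn.
rewrite exprVn ltr_pdivrMr ?exprn_gt0// -ltr_pdivrMl// mulrC.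
have -> : c / e = (complex.Re (c / e))%:C.
  by apply/esym/RRe_real; rewrite realE ce0.
have re0 : 0 <= complex.Re (c / e) by have := ce0; rewrite lecE => /andP[].
apply: lt_le_trans (_ : (Num.Def.archi_bound (complex.Re (c / e)))%:R <= _).
  by rewrite -(rmorph_nat (real_complex R)) ltcR archi_boundP.
rewrite -natrX ler_nat (leq_trans Nn)// ltnW//; exact: ltn_expl.
Qed.

(** Residues are defined by convergent series; from here on they are computed
from expansions with remainders. *)
Lemma is_residue0P (F : C -> C) c :
  is_residue0 F c <-> exists m b, laurent F m b /\ c = b m.
Proof.
split=> [[m [b [-> h]]]|[m [b [h ->]]]].
  by exists m, b; split=> //; exact: convergent_laurent h.
exists m, b; split=> //; apply: laurent_convergent h.
exact: complex_half_power_small.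
Qed.

Lemma laurent_residue0 (F : C -> C) m b : laurent F m b -> residue0 F = b m.
Proof.
move=> h; have hF : is_residue0 F (b m) by apply/is_residue0P; exists m, b.
have /is_residue0P[m' [b' [h' ]]] := xgetPex 0 (ex_intro _ _ hF : exists x, _ x).
by rewrite /residue0 => ->; exact: laurent_uniq h' h.
Qed.

Lemma residue0_eq (F H : C -> C) : near_zero (fun z => F z = H z) ->
  residue0 F = residue0 H.
Proof.
move=> FH; have HF : near_zero (fun z => H z = F z) by apply: near_zeroW FH => z _ ->.
have hr (A B : C -> C) c : near_zero (fun z => A z = B z) ->
    is_residue0 A c -> is_residue0 B c.
  move=> AB /is_residue0P[m [b [h ->]]]; apply/is_residue0P.
  exists m, b; split; [exact: laurent_eq AB h | reflexivity].
have e : is_residue0 F = is_residue0 H.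
  apply/funext => c; apply/propext; split; exact: hr.
by rewrite /residue0 e.
Qed.

Lemma residue0D (F H : C -> C) : meromorphic0 F -> meromorphic0 H ->
  residue0 (fun z => F z + H z) = residue0 F + residue0 H.
Proof.
move=> [m [b hb]] [m' [b' hb']]; have [m2 [b2 [h e]]] := laurentD hb hb'.
by rewrite (laurent_residue0 hb) (laurent_residue0 hb') (laurent_residue0 h).
Qed.

Lemma residue0Z k (F : C -> C) : meromorphic0 F ->
  residue0 (fun z => k * F z) = k * residue0 F.
Proof.
move=> [m [b hb]].
by rewrite (laurent_residue0 hb) (laurent_residue0 (laurentZ k hb)).
Qed.

Lemma analytic0_residue0 (F : C -> C) : analytic0 F -> residue0 F = 0.
Proof. by move=> [b hb]; rewrite (laurent_residue0 (expands_laurent hb)). Qed.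

Lemma residue0_0 : residue0 (fun=> 0 : C) = 0.
Proof. exact: analytic0_residue0 (analytic0_cst 0). Qed.

Lemma residue0_sum (I : Type) (s : seq I) (F : I -> C -> C) :
  (forall i, meromorphic0 (F i)) ->
  residue0 (fun z => \sum_(i <- s) F i z) = \sum_(i <- s) residue0 (F i).
Proof.
move=> h; elim: s => [|i s IH].
  have e : (fun z : C => \sum_(i <- [::]) F i z) = fun=> 0.
    by apply/funext => z; rewrite big_nil.
  by rewrite e big_nil residue0_0.
have e : (fun z : C => \sum_(i <- i :: s) F i z) =
    fun z => F i z + \sum_(i <- s) F i z.
  by apply/funext => z; rewrite big_cons.
rewrite e big_cons residue0D//; first by rewrite IH.
exact: meromorphic0_sum.
Qed.

End Residues.

(** * The complex exponential *)

Section ComplexExponential.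
Variable R : realType.
Local Notation C := R[i].
Local Open Scope complex_scope.

Lemma cexpD (z w : C) : cexp (z + w) = cexp z * cexp w.
Proof.
case: z w => [a b] [c d]; rewrite /cexp/= expRD cosD sinD.
by apply/eqP; rewrite eq_complex/=; apply/andP; split; apply/eqP; ring.
Qed.

Lemma cexp0 : cexp (0 : C) = 1.
Proof. by rewrite /cexp/= expR0 cos0 sin0 mul1r. Qed.

Lemma cexpN (z : C) : cexp (- z) = (cexp z)^-1.
Proof.
have h : cexp (- z) * cexp z = 1 by rewrite -cexpD addNr cexp0.
have z0 : cexp z != 0.
  by apply/eqP => e; move/eqP: h; rewrite e mulr0 eq_sym oner_eq0.
by rewrite -[LHS](mulfK z0) h mul1r.
Qed.

Lemma cexp_neq0 (z : C) : cexp z != 0.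
Proof.
apply/eqP => e; have /eqP := cexpD z (- z).
by rewrite e mul0r subrr cexp0 oner_eq0.
Qed.

Lemma cexpMn (z : C) n : cexp (z *+ n) = cexp z ^+ n.
Proof. by elim: n => [|n IH]; rewrite ?cexp0// mulrS exprS cexpD IH. Qed.

Lemma imaginary_power (y : R) n :
  ('i * y%:C) ^+ n / n`!%:R = (cos_coeff y n)%:C + 'i * (sin_coeff y n)%:C :> C.
Proof.
have e2 k : ('i * y%:C : C) ^+ k.*2 = ((-1) ^+ k * y ^+ k.*2)%:C.
  have i2 : ('i * y%:C : C) ^+ 2 = (-1 * y ^+ 2)%:C.
    rewrite expr2; apply/eqP; rewrite eq_complex/=; apply/andP; split; apply/eqP; ring.
  by rewrite -mul2n !exprM i2 -rmorphXn/= exprMn.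
have ef : (n`!%:R : C)^-1 = (n`!%:R^-1)%:C by rewrite fmorphV rmorph_nat.
rewrite ef /cos_coeff /sin_coeff/=.
rewrite -(odd_double_half n); set k := n./2; case: (odd n) => /=.
  rewrite add1n exprS e2 add0n odd_double/= !mul0r add0r mul1r doubleK.
  rewrite -!mulrA; congr ('i * _); rewrite -!rmorphM/=; congr (_%:C).
  by rewrite exprS; ring.
by rewrite add0n e2 odd_double/= !mul0r mulr0 addr0 mul1r doubleK -rmorphM.
Qed.

Lemma norm_complex_le (a b : R) : `|a%:C + 'i * b%:C| <= (`|a| + `|b|)%:C.
Proof.
apply: le_trans (ler_normD _ _) _; rewrite normrM rmorphD/=.
have nR (x : R) : `|x%:C| = `|x|%:C :> C.
  by rewrite normc_def/= expr0n/= addr0 sqrtr_sqr.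
rewrite !nR; have -> : `|'i : C| = 1.
  by rewrite normc_def/= expr0n/= add0r expr1n sqrtr1.
by rewrite mul1r.
Qed.

(** The real series of exp, cos and sin have geometric remainders in terms of
|Re z| + |Im z|, which is at most 2 |z|. The expansion of the product exp (Re
z) (cos (Im z) + i sin (Im z)) is a Cauchy product, and the binomial formula
identifies it with the exponential series. *)
Lemma expands_cexp : expands (@cexp R) (fun n => n`!%:R^-1).
Proof.
pose t (z : C) := `|complex.Re z| + `|complex.Im z|.
have tz z : (t z)%:C <= 2 * `|z|.
  rewrite /t rmorphD/= mulr_natl mulr2n lerD ?normc_ge_Re//.
  have := normc_ge_Re (z * 'i); rewrite ReiNIm normrN normrM.
  have -> : `|'i : C| = 1 by rewrite normc_def/= expr0n/= add0r expr1n sqrtr1.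
  by rewrite mulr1.
have fact1 n : (n`!%:R : R)^-1 <= 1 by rewrite invf_le1 ?ltr0n ?fact_gt0// ler1n fact_gt0.
exists 8, (3 * 2 * 4); split; rewrite ?ltr0n ?ler0n// ?mulr_ge0 ?ler0n//.
move=> z z0 hz N.
have h8 : 2 * (2 * `|z|) <= 2^-1 :> C.
  rewrite -[2^-1]mulr1 ler_pdivlMl// !mulrA -!natrM; exact: ltW.
set T := (t z); have T0 : 0 <= T by rewrite addr_ge0.
have T2 : T <= 2^-1.
  rewrite -lecR; apply: le_trans (tz z) _.
  have -> : (2^-1)%:C = 2^-1 :> C by rewrite fmorphV rmorph_nat.
  by apply: le_trans h8; rewrite ler_peMl ?mulr_ge0// ler1n.
have reT : `|complex.Re z| <= T by rewrite lerDl.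
have imT : `|complex.Im z| <= T by rewrite lerDr.
have bnd (x : R) (k : R) n : `|x| <= T -> `|k| <= 1 -> `|k * x ^+ n / n`!%:R| <= 1 * T ^+ n.
  move=> xT k1; rewrite -mulrA normrM ler_pM// normrM normrX.
  rewrite -[leRHS]mulr1 ler_pM ?exprn_ge0// ?lerXn2r// ?nnegrE//.
  by rewrite ger0_norm ?invr_ge0.
have hRe M : `|expR (complex.Re z) - \sum_(n < M) exp_coeff (complex.Re z) n| <= 2 * 1 * T ^+ M.
  apply: (@series_remainder R (exp_coeff (complex.Re z)) 1 T) => //.
    by move=> n; rewrite /exp_coeff/= -[_ ^+ n]mul1r bnd// normr1.
  exact: (@is_cvg_series_exp_coeff R (complex.Re z)).
have hcos M : `|cos (complex.Im z) - \sum_(n < M) cos_coeff (complex.Im z) n| <= 2 * 1 * T ^+ M.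
  apply: (@series_remainder R (cos_coeff (complex.Im z)) 1 T) => //.
    move=> n; rewrite /cos_coeff/= bnd// normrM normr_nat.
    by rewrite -exprnP normrX normrN1 expr1n mulr1 lern1; case: odd.
  rewrite unlock; exact: (@is_cvg_series_cos_coeff R (complex.Im z)).
have hsin M : `|sin (complex.Im z) - \sum_(n < M) sin_coeff (complex.Im z) n| <= 2 * 1 * T ^+ M.
  apply: (@series_remainder R (sin_coeff (complex.Im z)) 1 T) => //.
    move=> n; rewrite /sin_coeff/= bnd// normrM normr_nat normrX normrN1 expr1n mulr1.
    by rewrite lern1; case: odd.
  rewrite unlock; exact: (@is_cvg_series_sin_coeff R (complex.Im z)).
have nR (x : R) : `|x%:C| = `|x|%:C :> C.
  by rewrite normc_def/= expr0n/= addr0 sqrtr_sqr.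
have hF M : `|(expR (complex.Re z))%:C - \sum_(n < M) ((complex.Re z)%:C ^+ n / n`!%:R)| <= 2 * T%:C ^+ M.
  have -> : \sum_(n < M) ((complex.Re z)%:C ^+ n / n`!%:R) =
      (\sum_(n < M) exp_coeff (complex.Re z) n)%:C :> C.
    rewrite rmorph_sum; apply: eq_bigr => n _; rewrite /exp_coeff/=.
    by rewrite rmorphM/= rmorphXn/= fmorphV rmorph_nat.
  rewrite -rmorphB nR -rmorphXn/= -[2](rmorph_nat (real_complex R)) -rmorphM lecR.
  by have := hRe M; rewrite mulr1.
have hG M : `|(cos (complex.Im z) +i* sin (complex.Im z)) -
    \sum_(n < M) (('i * (complex.Im z)%:C) ^+ n / n`!%:R)| <= 4 * T%:C ^+ M.
  under eq_bigr do rewrite imaginary_power.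
  rewrite big_split/= -mulr_sumr -!rmorph_sum.
  rewrite [_ +i* _]complexE/= opprD addrACA -mulrBr -!rmorphB.
  apply: le_trans (norm_complex_le _ _) _.
  rewrite -rmorphXn/= -[4](rmorph_nat (real_complex R)) -rmorphM lecR.
  have -> : 4 * T ^+ M = 2 * 1 * T ^+ M + 2 * 1 * T ^+ M by ring.
  exact: lerD (hcos M) (hsin M).
have TC0 : 0 <= T%:C :> C by rewrite ler0c.
have TC1 : T%:C <= 1 :> C.
  by rewrite -[1](rmorph1 (real_complex R)) lecR (le_trans T2)// invf_le1 ?ler1n.
have hP := @partial_sum_mul C _ _ (fun n => (complex.Re z)%:C ^+ n / n`!%:R)
  (fun n => ('i * (complex.Im z)%:C) ^+ n / n`!%:R) _ _ _ (ler0n _ 2) (ler0n _ 4) TC0 TC1 hF hG N.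
have -> : \sum_(n < N) n`!%:R^-1 * z ^+ n = \sum_(n < N) conv
   (fun n => (complex.Re z)%:C ^+ n / n`!%:R)
   (fun n => ('i * (complex.Im z)%:C) ^+ n / n`!%:R) n.
  apply: eq_bigr => n _; rewrite /conv {1}[z]complexE addrC exprDn mulr_sumr.
  apply: eq_bigr => k _; have kn : (k <= n)%N by exact: leq_ord.
  rewrite -mulr_natr -(bin_fact kn) !natrM.
  have f0 m : m`!%:R != 0 :> C by rewrite pnatr_eq0 -lt0n fact_gt0.
  have b0 : 'C(n, k)%:R != 0 :> C by rewrite pnatr_eq0 -lt0n bin_gt0.
  by field; rewrite !f0 b0.
have T8 : 2 * T%:C <= 8 * `|z|.
  apply: (@le_trans _ _ (2 * (2 * `|z|))).
    by apply: ler_wpM2l; [exact: ler0n | exact: tz].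
  by rewrite mulrA -natrM ler_wpM2r// ler_nat.
apply: le_trans hP _; apply: ler_wpM2l.
  by rewrite -!natrM ler0n.
by rewrite lerXn2r ?nnegrE// mulr_ge0 ?ler0n.
Qed.

End ComplexExponential.

(** * Residues of quotients of exponentials *)

Section EulerOperator.
Variable K : numFieldType.
Implicit Types (f g : K -> K) (b c : nat -> K).

(** The relation g = z f', read on the coefficients. Integration by parts for
residues needs no analytic differentiation. *)
Definition euler f g := exists2 b, expands f b & expands g (fun n => n%:R * b n).

Lemma eulerM f f' g g' : euler f f' -> euler g g' ->
  euler (fun z => f z * g z) (fun z => f' z * g z + f z * g' z).
Proof.
move=> [b hf hf'] [c hg hg']; exists (conv b c); first exact: expandsM.
have -> : (fun n => n%:R * conv b c n) =
  (fun n => conv (fun n => n%:R * b n) c n + conv b (fun n => n%:R * c n) n).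
  apply/funext => n; rewrite /conv mulr_sumr -big_split/=; apply: eq_bigr => k _.
  have -> : n%:R = k%:R + (n - k)%:R :> K by rewrite -natrD subnKC// leq_ord.
  by ring.
by apply: expandsD; exact: expandsM.
Qed.

Lemma euler_eq f f' g g' : near_zero (fun z => f z = g z) ->
  near_zero (fun z => f' z = g' z) -> euler f f' -> euler g g'.
Proof.
move=> h h' [b hf hf']; exists b; [exact: expands_eq hf | exact: expands_eq hf'].
Qed.

Lemma euler_cst k : euler (fun=> k) (fun=> 0).
Proof.
eexists; first exact: expands_cst.
have -> : (fun n : nat => n%:R * (if n is 0 then k else 0)) =
    (fun n => if n is 0 then 0 else 0).
  by apply/funext => -[|n]; rewrite ?mul0r ?mulr0.
exact: expands_cst.
Qed.

Lemma eulerX f f' n : euler f f' ->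
  euler (fun z => f z ^+ n) (fun z => n%:R * f z ^+ n.-1 * f' z).
Proof.
move=> h; elim: n => [|n IH].
  apply: euler_eq (euler_cst 1); apply: near_zero_all => z _ //.
  by rewrite !mul0r.
apply: euler_eq (eulerM h IH); apply: near_zero_all => z _; first by rewrite exprS.
case: n {IH} => [|n]; first by rewrite /= !expr0; ring.
by rewrite /= -[n.+2]addn1 natrD exprS; ring.
Qed.

(** The coefficients of z (1/f)' and of - z f' / f^2 have the same Cauchy
product with those of f, by the product rule applied to f (1/f) = 1. *)
Lemma eulerV f f' b : expands f b -> expands f' (fun n => n%:R * b n) ->
  b 0%N != 0 -> euler (fun z => (f z)^-1) (fun z => - f' z / f z ^+ 2).
Proof.
move=> fb fb' b0; have hV := expandsV fb b0; set c := inverse_coef b in hV.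
exists c => //; pose d := conv (fun n => -1 * (n%:R * b n)) (conv c c).
have hd : expands (fun z => - f' z / f z ^+ 2) d.
  apply: expands_eq (expandsM (expandsZ (-1) fb') (expandsM hV hV)).
  by apply: near_zero_all => z _; rewrite mulN1r -invfM -expr2.
suff -> : (fun n => n%:R * c n) = d by [].
(* f times the unknown derivative of 1/f is determined by f * (1/f) = 1. *)
have e1 : conv b d = conv b (fun n => n%:R * c n).
  apply/funext => n.
  have -> : conv b d n = - conv (fun n => n%:R * b n) c n.
    suff -> : conv b d = (fun n => -1 * conv (fun n => n%:R * b n) c n) by rewrite mulN1r.
    apply: expands_uniq (expandsM fb hd) (expandsZ (-1) (expandsM fb' hV)).
    apply: near_zeroW (near_zero_neq0 fb b0) => z _ fz; rewrite mulN1r.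
    by field.
  apply/eqP; rewrite eq_sym -subr_eq0 opprK addrC; apply/eqP.
  have -> : conv (fun n => n%:R * b n) c n + conv b (fun n => n%:R * c n) n =
      n%:R * conv b c n.
    rewrite /conv mulr_sumr -big_split/=; apply: eq_bigr => k _.
    have -> : n%:R = k%:R + (n - k)%:R :> K by rewrite -natrD subnKC// leq_ord.
  by ring.
  have -> : conv b c = (fun n => if n is 0 then 1 else 0).
    apply: expands_uniq (expandsM fb hV) (expands_cst 1).
    by apply: near_zeroW (near_zero_neq0 fb b0) => z _ fz; rewrite divff.
  by case: n => [|n]; rewrite ?mul0r ?mulr0.
apply/funext; elim/ltn_ind => n IH.
have := congr1 (fun u => u n) e1; rewrite /conv !big_ord_recl/= !subn0.
rewrite (eq_bigr (fun i : 'I_n => b (lift ord0 i) * ((n - lift ord0 i)%:R * c (n - lift ord0 i)%N))).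
  by move=> /addIr/mulfI => /(_ b0) ->.
move=> i _; congr (_ * _); rewrite IH// lift0.
by have := ltn_ord i; lia.
Qed.

End EulerOperator.

Section ExponentialResidues.
Variable R : realType.
Local Notation C := R[i].

Definition exp_quotient p q (z : C) : C := cexp z ^+ p / (cexp z - 1) ^+ q.

Let quot (z : C) : C := (cexp z - 1) / z.
Let Dquot (z : C) : C := cexp z - quot z.

Let expands_quot : expands quot (fun n => n.+1`!%:R^-1).
Proof.
have h := expandsD (@expands_cexp R) (expands_cst (-1)).
have h0 : 0`!%:R^-1 + -1 = 0 :> C by rewrite fact0 invr1 subrr.
have := expandsXV h h0.
by congr (expands _ _); apply/funext => n; rewrite addr0.
Qed.

Let expands_Dquot : expands Dquot (fun n => n%:R * n.+1`!%:R^-1).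
Proof.
have := expandsD (@expands_cexp R) (expandsZ (-1) expands_quot).
congr (expands _ _); apply/funext => z; first by rewrite mulN1r.
have f0 : z`!%:R != 0 :> C by rewrite pnatr_eq0 -lt0n fact_gt0.
have s0 : z.+1%:R != 0 :> C by rewrite pnatr_eq0.
have -> : z%:R = z.+1%:R - 1 :> C by rewrite -natr1 addrK.
rewrite factS natrM; move: (z.+1%:R : C) s0 (z`!%:R : C) f0 => s s0 f f0.
by field; rewrite f0 s0.
Qed.

Let quot0 : (1`!%:R^-1 : C) != 0.
Proof. by rewrite invr1 oner_eq0. Qed.

Let near_quot : near_zero (fun z : C => quot z != 0).
Proof. exact: near_zero_neq0 expands_quot quot0. Qed.

Lemma near_zero_cexp_neq1 : near_zero (fun z : C => cexp z != 1).
Proof.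
apply: near_zeroW near_quot => z z0; apply: contra_neq => e.
by rewrite /quot e subrr mul0r.
Qed.

Let invquot (z : C) := (quot z)^-1.
Let phi p q (z : C) := cexp z ^+ p * invquot z ^+ q.

Let phi_expands p q : exists b, expands (phi p q) b.
Proof.
apply: analytic0M; apply: analytic0X; first by eexists; exact: expands_cexp.
by eexists; exact: expandsV expands_quot quot0.
Qed.

Let laurent_phi p q b : expands (phi p q.+1) b -> laurent (exp_quotient p q.+1) q b.
Proof.
apply: expands_eq; apply: near_zeroW near_zero_cexp_neq1 => z z0 hz.
have e0 : cexp z - 1 != 0 by rewrite subr_eq0.
by rewrite /phi /exp_quotient /invquot /quot invf_div expr_div_n; field; exact: expf_neq0.
Qed.

Lemma meromorphic0_exp_quotient p q : meromorphic0 (exp_quotient p q).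
Proof.
case: q => [|q]; last by have [b /laurent_phi h] := phi_expands p q.+1; exists q, b.
apply: analytic0_meromorphic0; apply: analytic0M; last first.
  by under eq_fun do rewrite expr0; exact: analytic0_cst.
by apply: analytic0X; eexists; exact: expands_cexp.
Qed.

Let euler_cexp : euler (@cexp R) (fun z => z * cexp z).
Proof.
eexists; first exact: expands_cexp.
have := expandsXM (@expands_cexp R).
congr (expands _ _); apply/funext => -[|n]; first by rewrite mul0r.
have s0 : n.+1%:R != 0 :> C by rewrite pnatr_eq0.
by rewrite factS natrM invfM mulrA divff// mul1r.
Qed.

(** The derivative of e^(pz) / (e^z - 1)^(q+1) has no residue. *)
Lemma exp_quotient_rec p q :
  q.+1%:R * residue0 (exp_quotient p.+1 q.+2) = p%:R * residue0 (exp_quotient p q.+1).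
Proof.
have [b hb] := phi_expands p q.+1; have [c hc] := phi_expands p.+1 q.+2.
rewrite (laurent_residue0 (laurent_phi hb)) (laurent_residue0 (laurent_phi hc)).
have [b' hb' hDb] := eulerM (eulerX p euler_cexp)
  (eulerX q.+1 (eulerV expands_quot expands_Dquot quot0)).
have bb : b' = b by apply: expands_uniq hb' hb; exact: near_zero_all.
rewrite {b' hb'}bb in hDb.
have hR := expandsD (expandsZ p%:R (expandsXM hb))
  (expandsD (expandsZ (- q.+1%:R) hc) (expandsZ q.+1%:R hb)).
(* The operator z d/dz on e^(pz) quot^-(q+1), computed in two ways; the residues
   are read on the coefficients of z^(q+1). *)
have N : near_zero (fun z => p%:R * cexp z ^+ p.-1 * (z * cexp z) * invquot z ^+ q.+1 +
      cexp z ^+ p * (q.+1%:R * invquot z ^+ q * (- Dquot z / quot z ^+ 2)) =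
    p%:R * (z * phi p q.+1 z) +
      (- q.+1%:R * phi p.+1 q.+2 z + q.+1%:R * phi p q.+1 z)).
  apply: near_zeroW near_quot => z z0.
  rewrite /phi /invquot /Dquot; move: (quot z) (cexp z) => h e hz.
  by case: p {hb hc b c hDb hR} => [|p]; rewrite /= !exprS; field.
have /(congr1 (fun u => u q.+1))/= E := expands_uniq N hDb hR.
have : q.+1%:R * b q.+1 - q.+1%:R * b q.+1 + q.+1%:R * c q.+1 = p%:R * b q.
  by rewrite {1}E; ring.
by rewrite subrr add0r.
Qed.

(** The recursion lowers p and q together. For p < q it ends at p = 0, where
its factor p kills the residue; for p = q it ends at e^z / (e^z - 1). *)
Lemma exp_quotient_residue p q : (0 < p <= q)%N ->
  residue0 (exp_quotient p q) = (p == q)%:R.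
Proof.
elim: p q => [//|p IH] [//|q] /andP[_]; rewrite ltnS eqSS => pq.
case: q pq => [|q] pq.
  move: pq; rewrite leqn0 => /eqP ->; rewrite eqxx.
  have hb : expands (phi 1 1) (conv (fun n => n`!%:R^-1) (inverse_coef (fun n => n.+1`!%:R^-1))).
    apply: expands_eq (expandsM (@expands_cexp R) (expandsV expands_quot quot0)).
    by apply: near_zero_all => z _; rewrite /phi !expr1.
  rewrite (laurent_residue0 (laurent_phi hb)) /conv big_ord1 inverse_coefE big_ord0.
  by rewrite !invr1 !mul1r subr0.
have q0 : q.+1%:R != 0 :> C by rewrite pnatr_eq0.
apply: (mulfI q0); rewrite exp_quotient_rec.
case: p IH pq => [|p] IH pq; first by rewrite mul0r mulr0.
rewrite IH//; have [->|_] := eqVneq p.+1 q.+1; first by [].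
by rewrite !mulr0.
Qed.

End ExponentialResidues.

(** * Poles of inverse exponential factors *)

Section Scaling.
Variable K : numFieldType.

Lemma near_zero_scale (k : K) (P : K -> Prop) : k != 0 -> near_zero P ->
  near_zero (fun z => P (k * z)).
Proof.
move=> k0 [r r0 h]; exists (r * `|k|); first by rewrite mulr_gt0// normr_gt0.
by move=> z z0; rewrite -mulrA -normrM => hz; apply: h; rewrite ?mulf_neq0.
Qed.

Lemma laurent_scale (k : K) F m b : k != 0 -> laurent F m b ->
  laurent (fun z => F (k * z)) m (fun n => k ^- m.+1 * (b n * k ^+ n)).
Proof.
move=> k0 /(expands_comp_scale k0)/(expandsZ (k ^- m.+1)); apply: expands_eq.
apply: near_zero_all => z _.
by rewrite exprMn mulrA mulrA mulVf ?mul1r// expf_neq0.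
Qed.

Lemma meromorphic0_scale (k : K) F : k != 0 -> meromorphic0 F ->
  meromorphic0 (fun z => F (k * z)).
Proof. by move=> k0 [m [b h]]; eexists; eexists; exact: laurent_scale h. Qed.

End Scaling.

Section ExponentialPoles.
Variable R : realType.
Local Notation C := R[i].

Lemma residue0_scale (k : C) F : k != 0 -> meromorphic0 F ->
  residue0 (fun z => F (k * z)) = k^-1 * residue0 F.
Proof.
move=> k0 [m [b h]].
rewrite (laurent_residue0 (laurent_scale k0 h)) (laurent_residue0 h).
have := expf_neq0 m k0; rewrite exprS; move: (k ^+ m) => t t0.
by field; rewrite t0 k0.
Qed.

Lemma analytic0_cexp_scale (k : C) : analytic0 (fun z => cexp (k * z)).
Proof.
have [->|k0] := eqVneq k 0; last first.
  by eexists; exact: expands_comp_scale k0 (@expands_cexp R).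
by under eq_fun do rewrite mul0r cexp0; exact: analytic0_cst.
Qed.

(** With k <> 0, its inverse has a pole at 0 exactly when c = 1. *)
Definition one_minus_exp (c k z : C) := 1 - c * cexp (k * z).

Lemma expands_one_minus_exp (c k : C) :
  exists2 b, expands (one_minus_exp c k) b & b 0%N = 1 - c.
Proof.
have [->|k0] := eqVneq k 0.
  exists (fun n => if n is 0 then 1 - c else 0) => //.
  apply: expands_eq (expands_cst (1 - c)).
  by apply: near_zero_all => z _; rewrite /one_minus_exp mul0r cexp0 mulr1.
have h := expandsD (expands_cst 1)
  (expandsZ (- c) (expands_comp_scale k0 (@expands_cexp R))).
exists (fun n => (if n is 0 then 1 else 0) + - c * (n`!%:R^-1 * k ^+ n)).
  by apply: expands_eq h; apply: near_zero_all => z _; rewrite /one_minus_exp mulNr.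
by rewrite /= expr0 mulr1 fact0 invr1 mulr1.
Qed.

Lemma analytic0_one_minus_expV (c k : C) : c != 1 ->
  analytic0 (fun z => (one_minus_exp c k z)^-1).
Proof.
move=> c1; have [b hb b0] := expands_one_minus_exp c k.
by eexists; apply: expandsV hb _; rewrite b0 subr_eq0 eq_sym.
Qed.

Lemma near_zero_one_minus_exp (c k : C) : k != 0 ->
  near_zero (fun z => one_minus_exp c k z != 0).
Proof.
move=> k0; have [->|c1] := eqVneq c 1.
  apply: near_zeroW (near_zero_scale k0 (near_zero_cexp_neq1 R)) => z _.
  by rewrite /one_minus_exp mul1r subr_eq0 eq_sym.
have [b hb b0] := expands_one_minus_exp c k.
by apply: near_zero_neq0 hb _; rewrite b0 subr_eq0 eq_sym.
Qed.

Lemma meromorphic0_one_minus_expV (c k : C) : k != 0 ->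
  meromorphic0 (fun z => (one_minus_exp c k z)^-1).
Proof.
move=> k0; have [->|c1] := eqVneq c 1; last first.
  exact: analytic0_meromorphic0 (analytic0_one_minus_expV k c1).
have h := meromorphic0M (meromorphic0_cst (-1))
  (meromorphic0_scale k0 (meromorphic0_exp_quotient R 0 1)).
apply: meromorphic0_eq h; apply: near_zero_all => z _.
by rewrite /exp_quotient /one_minus_exp expr0 expr1 !mul1r mulN1r -invrN opprB.
Qed.

End ExponentialPoles.

(** * Difference operators and induction on levels *)

Section Differences.
Variables (R : realType) (K : comNzRingType) (V : zmodType) (E : V -> R).
Implicit Types (a b g psi : V) (l : seq V) (f h : V -> K).

Definition neg_part l := \sum_(psi <- l | E psi < 0) psi.
Definition pos_part l := \sum_(psi <- l | 0 < E psi) psi.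
Definition neg_count l := count (fun psi => E psi < 0) l.

(** The product over psi in l of the operators f |-> f - f (. - psi): on
generating series, the multiplication by the product of the 1 - e^psi. *)
Fixpoint diff l f a : K :=
  if l is psi :: l' then diff l' f a - diff l' f (a - psi) else f a.

(** The form in which values inside a chamber are used: every point ends up in
the right chamber when it moves far along g. *)
Definition evanescent g f a := exists k0, forall k, (k0 <= k)%N -> f (a + g *+ k) = 0.

Lemma diffB l f h a : diff l (fun b => f b - h b) a = diff l f a - diff l h a.
Proof. by elim: l a => //= psi l IH a; rewrite !IH; ring. Qed.

Lemma diff_translate l f g a : diff l (fun b => f (b + g)) a = diff l f (a + g).
Proof. by elim: l a => //= psi l IH a; rewrite !IH addrAC. Qed.

Lemma evanescent0 g f a : (forall k, f (a + g *+ k) = 0) -> evanescent g f a.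
Proof. by move=> h; exists 0%N. Qed.

Lemma evanescentB g f h a : evanescent g f a -> evanescent g h a ->
  evanescent g (fun b => f b - h b) a.
Proof.
move=> [k1 h1] [k2 h2]; exists (k1 + k2)%N => k kk.
by rewrite h1 ?h2 ?subrr//; [exact: leq_trans (leq_addl _ _) kk|exact: leq_trans (leq_addr _ _) kk].
Qed.

Lemma evanescent_eq g f h a : (forall k, f (a + g *+ k) = h (a + g *+ k)) ->
  evanescent g f a -> evanescent g h a.
Proof. by move=> fh [k0 hk]; exists k0 => k kk; rewrite -fh hk. Qed.

Lemma evanescent_at0 f a : evanescent 0 f a -> f a = 0.
Proof. by move=> [k0 /(_ k0 (leqnn _))]; rewrite mul0rn addr0. Qed.

Variable G : V -> Prop.
Hypothesis ED : forall a b, E (a + b) = E a + E b.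
Hypothesis GD : forall a b, G a -> G b -> G (a + b).
Hypothesis GN : forall a, G a -> G (- a).

Let E0 : E 0 = 0.
Proof. by apply: (addIr (E 0)); rewrite -ED !add0r. Qed.

Let EN a : E (- a) = - E a.
Proof. by apply/eqP; rewrite -addr_eq0 -ED addNr E0. Qed.

Let EB a b : E (a - b) = E a - E b.
Proof. by rewrite ED EN. Qed.

Let GB a b : G a -> G b -> G (a - b).
Proof. by move=> Ga Gb; apply: GD => //; exact: GN. Qed.

Definition admissible l := forall psi, psi \in l -> G psi /\ E psi != 0.

Lemma admissible_cons psi l : admissible (psi :: l) ->
  [/\ G psi, E psi != 0 & admissible l].
Proof.
move=> h; have [? ?] := h psi (mem_head _ _); split=> // phi pl.
by apply: h; rewrite inE pl orbT.
Qed.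

Lemma neg_part_cons psi l :
  neg_part (psi :: l) = (if E psi < 0 then psi else 0) + neg_part l.
Proof. by rewrite /neg_part big_cons; case: ifP; rewrite ?add0r. Qed.

Lemma pos_part_cons psi l :
  pos_part (psi :: l) = (if 0 < E psi then psi else 0) + pos_part l.
Proof. by rewrite /pos_part big_cons; case: ifP; rewrite ?add0r. Qed.

Lemma E_neg_part_le0 l : E (neg_part l) <= 0.
Proof.
elim: l => [|psi l IH]; first by rewrite /neg_part big_nil E0.
by rewrite neg_part_cons ED; case: ifP => [/ltW|_]; rewrite ?E0; lra.
Qed.

Lemma E_pos_part_ge0 l : 0 <= E (pos_part l).
Proof.
elim: l => [|psi l IH]; first by rewrite /pos_part big_nil E0.
by rewrite pos_part_cons ED; case: ifP => [/ltW|_]; rewrite ?E0; lra.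
Qed.

Lemma G_neg_part l : G 0 -> admissible l -> G (neg_part l).
Proof.
move=> G0; elim: l => [|psi l IH]; first by rewrite /neg_part big_nil.
by move=> /admissible_cons[Gp _ al]; rewrite neg_part_cons; case: ifP => _;
  apply: GD => //; exact: IH.
Qed.

Lemma E_pos_part_gt0 l psi : psi \in l -> 0 < E psi -> 0 < E (pos_part l).
Proof.
elim: l => // phi l IH; rewrite inE => /predU1P[<- p0|pl p0].
  by rewrite pos_part_cons p0 ED; have := E_pos_part_ge0 l; lra.
by rewrite pos_part_cons ED; have := IH pl p0; case: ifP => [|_]; rewrite ?E0; lra.
Qed.

(** The translates of a that occur in diff l f a have levels E between those
two bounds. *)
Lemma diff_local l f h a : admissible l -> G a ->
  (forall b, G b -> E a - E (pos_part l) <= E b <= E a - E (neg_part l) -> f b = h b) ->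
  diff l f a = diff l h a.
Proof.
elim: l a => [|psi l IH] a /=.
  move=> _ Ga; apply => //; rewrite /pos_part /neg_part !big_nil E0 subr0 lexx//.
move=> /admissible_cons[Gp Ep al] Ga fh.
rewrite pos_part_cons neg_part_cons !ED in fh.
congr (_ - _); apply: IH => //.
- move=> b Gb /andP[b1 b2]; apply: fh => //; apply/andP.
  by split; case: ifP => [|_]; rewrite ?E0; lra.
- exact: GB.
- move=> b Gb; rewrite EB => /andP[b1 b2]; apply: fh => //; apply/andP.
  case: (ltgtP (E psi) 0) Ep => //; rewrite ?E0; lra.
Qed.

Lemma diff_local_evanescent l f g a : admissible l -> G a ->
  (forall b, G b -> E a - E (pos_part l) <= E b <= E a - E (neg_part l) ->
     evanescent g f b) ->
  evanescent g (diff l f) a.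
Proof.
elim: l a => [|psi l IH] a /=.
  move=> _ Ga; apply => //; rewrite /pos_part /neg_part !big_nil E0 subr0 lexx//.
move=> /admissible_cons[Gp Ep al] Ga fh.
rewrite pos_part_cons neg_part_cons !ED in fh.
have h1 : evanescent g (diff l f) a.
  apply: IH => // b Gb /andP[b1 b2]; apply: fh => //; apply/andP.
  by split; case: ifP => [|_]; rewrite ?E0; lra.
have h2 : evanescent g (diff l f) (a - psi).
  apply: IH => //; first exact: GB.
  move=> b Gb; rewrite EB => /andP[b1 b2]; apply: fh => //; apply/andP.
  case: (ltgtP (E psi) 0) Ep => //; rewrite ?E0; lra.
apply: (evanescentB h1); case: h2 => k0 hk; exists k0 => k /hk.
by rewrite addrAC.
Qed.

(** At a + neg_part l, the translate by the vectors of negative level is a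
itself, and every other translate lies at a lower level. Hence diff l f
determines f at the level of a up to a sign and to lower levels. *)
Lemma diff_top_term l f g a : admissible l -> G a -> G 0 ->
  (forall b, G b -> E b < E a -> evanescent g f b) ->
  evanescent g (fun c => diff l f (c + neg_part l) - (-1) ^+ neg_count l * f c) a.
Proof.
move=> al Ga G0; elim: l a al Ga => [|psi l IH] a.
  move=> _ Ga _; apply: evanescent0 => k.
  by rewrite /= /neg_part big_nil addr0 mul1r subrr.
move=> /admissible_cons[Gp Ep al] Ga low.
have [En|Epos] := ltrP (E psi) 0.
  have h1 := IH a al Ga low.
  have Ea' : E (a + psi) < E a by rewrite ED; lra.
  have h2 : evanescent g (fun c => diff l f (c + neg_part l) - (-1) ^+ neg_count l * f c) (a + psi).
    apply: IH => //; first exact: GD.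
    by move=> b Gb /lt_trans/(_ Ea'); exact: low.
  have h3 := low _ (GD Ga Gp) Ea'.
  case: h1 h2 h3 => k1 h1 [k2 h2] [k3 h3]; exists (k1 + k2 + k3)%N => k kk.
  have := h1 k; have := h2 k; have := h3 k.
  rewrite !(leq_trans _ kk) ?leq_addl//; last 2 first.
  - by rewrite -addnA leq_addr.
  - by rewrite addnAC leq_addl.
  move=> /(_ isT) e3 /(_ isT) e2 /(_ isT) e1.
  rewrite /= neg_part_cons /neg_count/= En exprS.
  rewrite e3 mulr0 subr0 in e2.
  have -> : a + g *+ k + (psi + neg_part l) = a + psi + g *+ k + neg_part l.
    by rewrite addrA (addrAC a).
  rewrite e2 sub0r.
  have -> : a + psi + g *+ k + neg_part l - psi = a + g *+ k + neg_part l.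
    by rewrite (addrAC a) (addrAC _ psi) addrK.
  by rewrite mulN1r mulNr opprK addrC -opprB e1 oppr0.
have {}Epos : 0 < E psi by rewrite lt_neqAle eq_sym Ep.
have h1 := IH a al Ga low.
have Ea' : E (a - psi) < E a by rewrite EB; lra.
have h2 : evanescent g (fun c => diff l f (c + neg_part l) - (-1) ^+ neg_count l * f c) (a - psi).
  apply: IH => //; first exact: GB.
  by move=> b Gb /lt_trans/(_ Ea'); exact: low.
have h3 := low _ (GB Ga Gp) Ea'.
case: h1 h2 h3 => k1 h1 [k2 h2] [k3 h3]; exists (k1 + k2 + k3)%N => k kk.
have := h1 k; have := h2 k; have := h3 k.
rewrite !(leq_trans _ kk) ?leq_addl//; last 2 first.
- by rewrite -addnA leq_addr.
- by rewrite addnAC leq_addl.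
move=> /(_ isT) e3 /(_ isT) e2 /(_ isT) e1.
rewrite /= neg_part_cons /neg_count/= ltNge (ltW Epos)/= add0r add0n.
rewrite e3 mulr0 subr0 in e2.
have -> : a + g *+ k + neg_part l - psi = a - psi + g *+ k + neg_part l.
  by rewrite addrAC (addrAC a).
by rewrite e2 subr0.
Qed.

(** Levels are integers and f is negligible at negative ones, so diff_top_term
propagates the vanishing upwards. *)
Lemma level_induction l f g : admissible l -> G 0 ->
  (forall a, G a -> E a \is a Num.int) ->
  (forall b, G b -> E b < 0 -> evanescent g f b) ->
  (forall a, G a -> evanescent g (diff l f) a) ->
  forall a, G a -> evanescent g f a.
Proof.
move=> al G0 Eint low hd.
suff H n a : G a -> E a < n%:R -> evanescent g f a.
  move=> a Ga; have [n Ean] : exists n : nat, E a < n%:R.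
    exists (Num.Def.archi_bound (`|E a|)).
    by apply: le_lt_trans (ler_norm _) _; exact: archi_boundP.
  exact: H Ean.
elim: n a => [|n IH] a Ga Ean; first exact: low.
have lower b : G b -> E b < E a -> evanescent g f b.
  move=> Gb ba; apply: IH => //.
  have /intrP[i ei] := Eint _ Gb; have /intrP[j ej] := Eint _ Ga.
  move: ba Ean; rewrite ei ej !pmulrn !ltr_int; lia.
have [k1 h1] := diff_top_term al Ga G0 lower.
have [k2 h2] := hd _ (GD Ga (G_neg_part G0 al)).
exists (k1 + k2)%N => k kk; have := h1 k (leq_trans (leq_addr _ _) kk).
have := h2 k (leq_trans (leq_addl _ _) kk).
have -> : a + neg_part l + g *+ k = a + g *+ k + neg_part l by rewrite addrAC.
move=> -> /eqP; rewrite sub0r oppr_eq0 => /eqP e.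
have : (-1) ^+ neg_count l * ((-1) ^+ neg_count l * f (a + g *+ k)) = 0 by rewrite e mulr0.
by rewrite mulrA -expr2 sqrr_sign mul1r.
Qed.

End Differences.

(** * Linear recurrences along a direction *)

Section Recurrences.
Variables (K : fieldType) (V : zmodType).
Implicit Types (a b g : V) (c : K) (f h : V -> K).

Definition shift_sub g c f : V -> K := fun a => f (a + g) - c * f a.

(** The roots c are nonzero so that recurrences can also be run backwards. *)
Definition recurrent g f := exists2 cs : seq K, all (fun c => c != 0) cs &
  forall a, foldr (shift_sub g) f cs a = 0.

Lemma foldr_shift_sub_ext g cs f h : (forall b, f b = h b) ->
  forall a, foldr (shift_sub g) f cs a = foldr (shift_sub g) h cs a.
Proof. by move=> fh; elim: cs => //= c cs IH a; rewrite /shift_sub !IH. Qed.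

Lemma foldr_shift_subB g cs f h a :
  foldr (shift_sub g) (fun b => f b - h b) cs a =
  foldr (shift_sub g) f cs a - foldr (shift_sub g) h cs a.
Proof. by elim: cs a => //= c cs IH a; rewrite /shift_sub !IH; ring. Qed.

Lemma foldr_shift_sub0 g cs f a : (forall b, f b = 0) -> foldr (shift_sub g) f cs a = 0.
Proof.
by move=> f0; elim: cs a => //= c cs IH a; rewrite /shift_sub !IH mulr0 subr0.
Qed.

Lemma shift_subC g c cs f a : foldr (shift_sub g) (shift_sub g c f) cs a =
  shift_sub g c (foldr (shift_sub g) f cs) a.
Proof.
by elim: cs a => //= d cs IH a; rewrite {1}/shift_sub !IH /shift_sub; ring.
Qed.

Lemma foldr_shift_sub_swap g cs ds f a :
  foldr (shift_sub g) (foldr (shift_sub g) f ds) cs a =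
  foldr (shift_sub g) (foldr (shift_sub g) f cs) ds a.
Proof.
elim: cs a => //= c cs IH a; rewrite shift_subC {1}/shift_sub !IH //.
Qed.

Lemma recurrentB g f h : recurrent g f -> recurrent g h ->
  recurrent g (fun b => f b - h b).
Proof.
move=> [cs cs0 hf] [ds ds0 hh]; exists (cs ++ ds); first by rewrite all_cat cs0.
move=> a; rewrite foldr_cat.
have -> : foldr (shift_sub g) (foldr (shift_sub g) (fun b => f b - h b) ds) cs a =
  foldr (shift_sub g) (fun b => foldr (shift_sub g) f ds b - foldr (shift_sub g) h ds b) cs a.
  by apply: foldr_shift_sub_ext => b; exact: foldr_shift_subB.
rewrite foldr_shift_subB (foldr_shift_sub0 _ _ _ hh) foldr_shift_sub_swap.
by rewrite (foldr_shift_sub0 _ _ _ hf) subrr.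
Qed.

Lemma recurrent0 g : recurrent g (fun=> 0).
Proof. by exists [::]. Qed.

Lemma recurrent_sum g (I : Type) (s : seq I) (F : I -> V -> K) :
  (forall i, recurrent g (F i)) -> recurrent g (fun a => \sum_(i <- s) F i a).
Proof.
move=> hF; elim: s => [|i s IH].
  by under eq_fun do rewrite big_nil; exact: recurrent0.
have -> : (fun a => \sum_(j <- i :: s) F j a) =
    (fun a => F i a - (0 - \sum_(j <- s) F j a)).
  by apply/funext => a; rewrite big_cons sub0r opprK.
by apply: recurrentB (hF i) _; apply: recurrentB IH; exact: recurrent0.
Qed.

Lemma recurrent_translate g d f : recurrent g f -> recurrent g (fun b => f (b + d)).
Proof.
move=> [cs cs0 hf]; exists cs => // a.
suff -> : foldr (shift_sub g) (fun b => f (b + d)) cs a = foldr (shift_sub g) f cs (a + d) by [].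
by elim: cs a {cs0 hf} => //= c cs IH a; rewrite /shift_sub !IH addrAC.
Qed.

Lemma recurrent_diff g l f : recurrent g f -> recurrent g (diff l f).
Proof.
elim: l => //= psi l IH /IH h.
exact: recurrentB h (recurrent_translate (- psi) h).
Qed.

Lemma recurrent_iter g c n f : c != 0 -> (forall a, iter n (shift_sub g c) f a = 0) ->
  recurrent g f.
Proof.
move=> c0 h; exists (nseq n c); first by rewrite all_nseq c0 orbT.
move=> a; rewrite -[RHS](h a); congr (_ a).
by elim: n {h} => //= n ->.
Qed.

(** After all roots but one, the function is multiplied by the nonzero c at
each step, and so can vanish eventually only by vanishing at once. *)
Lemma recurrent_evanescent (D : V -> Prop) g f : (forall a, D a -> D (a + g)) ->
  recurrent g f -> (forall a, D a -> evanescent g f a) -> forall a, D a -> f a = 0.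
Proof.
move=> Dg [cs cs0 hf] ev.
have {hf} : forall a, D a -> foldr (shift_sub g) f cs a = 0 by move=> a _; exact: hf.
elim: cs cs0 => [_ h|c cs IH /= /andP[c0 cs0] h]; first exact: h.
apply: (IH cs0).
have {ev} : forall a, D a -> evanescent g (foldr (shift_sub g) f cs) a.
  elim: cs {IH cs0 h} => //= d cs IH a Da.
  case: (IH a Da) => k0 hk; exists k0 => k kk; rewrite /shift_sub hk// mulr0 subr0.
  by rewrite -addrA -mulrSr hk// leqW.
move: (foldr _ f cs) h => h hS ev a Da.
have hk k : h (a + g *+ k) = c ^+ k * h a.
  elim: k => [|k IHk]; first by rewrite mulr0n addr0 mul1r.
  have Dk : D (a + g *+ k).
    by elim: (k) => [|j Dj]; rewrite ?mulr0n ?addr0// mulrSr addrA; exact: Dg.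
  have /eqP := hS _ Dk; rewrite /shift_sub subr_eq0 => /eqP.
  by rewrite -addrA -mulrSr IHk exprS mulrA.
have [k0 /(_ k0 (leqnn _))] := ev a Da; rewrite hk => /eqP.
by rewrite mulf_eq0 expf_eq0 (negPf c0) andbF /= => /eqP.
Qed.

End Recurrences.

Section Jump.
Variables (R : realType) (K : fieldType) (V : zmodType) (E : V -> R) (G : V -> Prop).
Implicit Types (a b psi : V).
Hypothesis ED : forall a b, E (a + b) = E a + E b.
Hypothesis G0 : G 0.
Hypothesis GD : forall a b, G a -> G b -> G (a + b).
Hypothesis GN : forall a, G a -> G (- a).
Hypothesis E_int : forall a, G a -> E a \is a Num.int.
Variables (l : seq V) (k1 k2 P kPhi t q : V -> K) (g phi : V).
Hypothesis al : admissible E G l.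
Hypothesis Gg : G g.
Hypothesis Eg : E g = 0.
Hypothesis phi_l : phi \in l.
Hypothesis Ephi : 0 < E phi.

(* Here k1 and k2 are the quasi-polynomials of the two chambers, kPhi is the
   partition function, t its source on the wall and q the quasi-polynomial that
   agrees with t far along g; P plays the role of Para. *)
Hypothesis k1_kPhi : forall a, G a -> 0 <= E a ->
  evanescent g (fun b => k1 b - kPhi b) a.
Hypothesis k2_kPhi : forall a, G a -> E a < 0 ->
  evanescent g (fun b => k2 b - kPhi b) a.
Hypothesis t_q : forall a, G a -> E a = 0 -> evanescent g (fun b => t b - q b) a.
Hypothesis rec1 : forall d, recurrent d k1.
Hypothesis rec2 : forall d, recurrent d k2.
Hypothesis recP : recurrent g P.
Hypothesis diff_kPhi : forall a, G a -> diff l kPhi a = (E a == 0)%:R * t a.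
Hypothesis diff_P : forall a, G a -> diff l P a = 0.
Hypothesis strip_P : forall a, G a -> - E (pos_part E l) < E a ->
  E (a + neg_part E l) <= 0 ->
  P a = (E (a + neg_part E l) == 0)%:R * ((-1) ^+ neg_count E l * q (a + neg_part E l)).

Let E0 : E 0 = 0.
Proof. by apply: (addIr (E 0)); rewrite -ED !add0r. Qed.

Let EN a : E (- a) = - E a.
Proof. by apply/eqP; rewrite -addr_eq0 -ED addNr E0. Qed.

Let EMn a n : E (a *+ n) = n%:R * E a.
Proof. by elim: n => [|n IH]; rewrite ?mulr0n ?E0 ?mul0r// mulrS ED IH -natr1; ring. Qed.

Let Gphi : G phi. Proof. by have [] := al phi_l. Qed.

Let GMn a n : G a -> G (a *+ n).
Proof. by move=> Ga; elim: n => [|n IH]; rewrite ?mulr0n// mulrS; exact: GD. Qed.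

Let Egk a k : E (a + g *+ k) = E a.
Proof. by rewrite ED EMn Eg mulr0 addr0. Qed.

Let pos_gt0 : 0 < E (pos_part E l).
Proof. exact: (E_pos_part_gt0 ED phi_l Ephi). Qed.

Let neg_le0 : E (neg_part E l) <= 0.
Proof. exact: (E_neg_part_le0 ED l). Qed.

(** Far enough on one side of the wall diff l k is evanescent along g, hence
zero there by recurrence along g, hence zero everywhere by recurrence along d,
which leads to that side. *)
Lemma diff_recurrent_eq0 (k : V -> K) d (s : bool) : (forall d, recurrent d k) -> G d ->
  (forall x : R, exists n : nat, forall m, (n <= m)%N -> 0 <= (-1) ^+ s * (m%:R * E d + x)) ->
  (forall a, G a -> (if s then E a <= E (neg_part E l) - 1 else E (pos_part E l) + 1 <= E a) ->
     evanescent g (diff l k) a) ->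
  forall a, G a -> diff l k a = 0.
Proof.
move=> rk Gd far ev; set bnd : R := if s then E (neg_part E l) - 1 else E (pos_part E l) + 1.
pose D a := G a /\ 0 <= (-1) ^+ s * (E a - bnd).
have zero a : D a -> diff l k a = 0.
  apply: (@recurrent_evanescent _ _ D g).
  - by move=> b [Gb hb]; split; [exact: GD | rewrite ED Eg addr0].
  - exact: recurrent_diff.
  move=> b [Gb hb]; apply: ev => //; move: hb; rewrite /bnd.
  by case: (s); rewrite ?expr1 ?expr0; lra.
apply: (@recurrent_evanescent _ _ G d).
- by move=> a Ga; exact: GD.
- exact: recurrent_diff.
move=> a Ga; have [n hn] := far (E a - bnd).
exists n => m nm; apply: zero; split; first by apply: GD => //; exact: GMn.
rewrite ED EMn; have -> : E a + m%:R * E d - bnd = m%:R * E d + (E a - bnd) by ring.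
exact: hn.
Qed.

Let far_pos x : exists n : nat, forall m, (n <= m)%N -> 0 <= (-1) ^+ false * (m%:R * E phi + x).
Proof.
exists (Num.Def.archi_bound (`|x| / E phi)) => m nm; rewrite expr0 mul1r.
have : `|x| / E phi < m%:R.
  apply: lt_le_trans (archi_boundP _) _; first by rewrite divr_ge0// ltW.
  by rewrite ler_nat.
rewrite ltr_pdivrMr// => h; have := ler_norm (- x); rewrite normrN; lra.
Qed.

Let far_neg x : exists n : nat, forall m, (n <= m)%N ->
  0 <= (-1) ^+ true * (m%:R * E (- phi) + x).
Proof.
have [n hn] := far_pos (- x); exists n => m /hn; rewrite expr0 expr1 EN; lra.
Qed.

Let diff_k2 a : G a -> diff l k2 a = 0.
Proof.
apply: (@diff_recurrent_eq0 k2 (- phi) true rec2 (GN Gphi) far_neg) => {}a Ga /= Ea.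
have h : evanescent g (diff l (fun b => k2 b - kPhi b)) a.
  apply: (diff_local_evanescent ED GD GN al Ga) => b Gb /andP[_ hb].
  by apply: k2_kPhi => //; lra.
apply: evanescent_eq h => k; rewrite diffB diff_kPhi; last by apply: GD => //; exact: GMn.
by rewrite Egk lt_eqF ?mul0r ?subr0//; have := neg_le0; lra.
Qed.

Let diff_k1 a : G a -> diff l k1 a = 0.
Proof.
apply: (@diff_recurrent_eq0 k1 phi false rec1 Gphi far_pos) => {}a Ga /= Ea.
have h : evanescent g (diff l (fun b => k1 b - kPhi b)) a.
  apply: (diff_local_evanescent ED GD GN al Ga) => b Gb /andP[hb _].
  by apply: k1_kPhi => //; lra.
apply: evanescent_eq h => k; rewrite diffB diff_kPhi; last by apply: GD => //; exact: GMn.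
by rewrite Egk gt_eqF ?mul0r ?subr0//; have := pos_gt0; lra.
Qed.

Let half (f : V -> K) a : K := (0 <= E a)%R%:R * f a.

(* Cutting P off below the wall produces exactly the source q on the wall.   *)
Let diff_half_P a : G a -> diff l (half P) a = (E a == 0)%:R * q a.
Proof.
move=> Ga; have strip0 b : G b -> 0 <= E b -> E (b + neg_part E l) < 0 -> P b = 0.
  move=> Gb b0 bn; rewrite strip_P//; last 2 first.
  - by have := pos_gt0; lra.
  - exact: ltW.
  by rewrite lt_eqF// mul0r.
case: (ltrgtP (E a) 0) => [an|ap|a0].
- rewrite mul0r (@diff_local _ _ _ _ _ ED GD GN l _ (fun=> 0) a al Ga).
    by elim: (l) (a) => //= psi l' IH b; rewrite !IH subrr.
  move=> b Gb /andP[_ b2]; rewrite /half; have [b0|b0] := lerP 0 (E b); last exact: mul0r.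
  by rewrite strip0 ?mulr0// ED; have := neg_le0; lra.
- rewrite mul0r -(diff_P Ga); apply: (diff_local ED GD GN al Ga) => b Gb /andP[b1 _].
  rewrite /half; have [b0|b0] := lerP 0 (E b); first exact: mul1r.
  have nl := neg_le0; rewrite mul0r strip_P//; [|by lra|by rewrite ED; lra].
  by rewrite lt_eqF ?mul0r// ED; lra.
rewrite mul1r; have Ga' : G (a - neg_part E l).
  by apply: GD => //; apply: GN; exact: (G_neg_part GD).
have Ea' : E (a - neg_part E l) = - E (neg_part E l) by rewrite ED EN a0 add0r.
have low b : G b -> E b < E (a - neg_part E l) -> evanescent 0 (half P) b.
  move=> Gb lb; apply: evanescent0 => k; rewrite mul0rn addr0 /half.
  have [b0|_] := lerP 0 (E b); last by rewrite mul0r.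
  by rewrite strip0 ?mulr0// ED; have := neg_le0; lra.
have /evanescent_at0 := diff_top_term ED GD GN al Ga' G0 low.
rewrite subrK => /eqP; rewrite subr_eq0 => /eqP ->.
rewrite /half Ea' oppr_ge0 neg_le0 mul1r strip_P//; last 2 first.
- by rewrite Ea'; have := pos_gt0; have := neg_le0; lra.
- by rewrite subrK a0.
by rewrite subrK a0 eqxx mul1r mulrA -expr2 sqrr_sign mul1r.
Qed.

Let jump b := k1 b - k2 b - P b.

Let half_jump_approx b : G b ->
  evanescent g (fun c => half jump c - (kPhi c - k2 c - half P c)) b.
Proof.
move=> Gb; have [b0|b0] := lerP 0 (E b).
  apply: evanescent_eq (k1_kPhi Gb b0) => k.
  by rewrite /half /jump Egk b0 !mul1r; ring.
apply: evanescent_eq (k2_kPhi Gb b0) => k.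
by rewrite /half /jump Egk lt_geF// !mul0r; ring.
Qed.

Let diff_half_jump a : G a -> evanescent g (diff l (half jump)) a.
Proof.
move=> Ga; have h : evanescent g (diff l
    (fun c => half jump c - (kPhi c - k2 c - half P c))) a.
  by apply: (diff_local_evanescent ED GD GN al Ga) => b Gb _; exact: half_jump_approx.
have Gk k : G (a + g *+ k) by apply: GD => //; exact: GMn.
have e k : diff l (fun c => half jump c - (kPhi c - k2 c - half P c)) (a + g *+ k) =
  diff l (half jump) (a + g *+ k) - (E a == 0)%:R * (t (a + g *+ k) - q (a + g *+ k)).
  by rewrite !diffB diff_kPhi// diff_k2// diff_half_P// Egk; ring.
have [a0|a0] := eqVneq (E a) 0; last first.
  by apply: evanescent_eq h => k; rewrite e (negPf a0) mul0r subr0.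
case: h (t_q Ga a0) => n1 h1 [n2 h2]; exists (n1 + n2)%N => k nk.
have := h1 k (leq_trans (leq_addr _ _) nk).
by rewrite e h2 ?mulr0 ?subr0// (leq_trans (leq_addl _ _) nk).
Qed.

(** Let J be k1 - k2 - P, cut off below the wall. Along g, it coincides with
kPhi - k2 minus P cut off, so that diff l J is eventually the source t of kPhi
minus the source q of the cut P, that is 0. Level induction makes J evanescent,
and recurrence along g makes it vanish above the wall. Since diff l annihilates
k1 - k2 - P exactly, level induction for -E then gives the vanishing below the
wall. *)
Theorem jump_formula a : G a -> k1 a - k2 a = P a.
Proof.
have ev : forall a, G a -> evanescent g (half jump) a.
  apply: (level_induction ED GD GN al G0 E_int _ diff_half_jump) => b Gb b0.
  by apply: evanescent0 => k; rewrite /half Egk lt_geF// mul0r.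
have recJ : recurrent g jump by apply: recurrentB => //; exact: recurrentB.
have above b : G b /\ 0 <= E b -> jump b = 0.
  apply: (@recurrent_evanescent _ _ (fun b => G b /\ 0 <= E b) g jump _ recJ).
  - by move=> c [Gc c0]; split; [exact: GD | rewrite ED Eg addr0].
  move=> c [Gc c0]; apply: evanescent_eq (ev c Gc) => k.
  by rewrite /half Egk c0 mul1r.
have ED' b c : - E (b + c) = - E b + - E c by rewrite ED opprD.
have al' : admissible (fun b => - E b) G l.
  by move=> psi /al[Gp Ep]; split=> //; rewrite oppr_eq0.
have int' b : G b -> - E b \is a Num.int by move=> Gb; rewrite rpredN E_int.
have low b : G b -> - E b < 0 -> evanescent 0 jump b.
  move=> Gb b0; apply: evanescent0 => k; rewrite mul0rn addr0; apply: above.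
  by split=> //; lra.
have dJ b : G b -> evanescent 0 (diff l jump) b.
  move=> Gb; apply: evanescent0 => k; rewrite mul0rn addr0.
  by rewrite !diffB diff_k1// diff_k2// diff_P// !subr0.
move=> Ga; have := evanescent_at0 (level_induction ED' GD GN al' G0 int' low dJ Ga).
by rewrite /jump => /eqP; rewrite subr_eq0 => /eqP.
Qed.

End Jump.

(** * Expressions in exponentials and their derivatives *)

Section SymbolicExpressions.
Variables (R : realType) (V : vectType R).
Local Notation C := R[i].
Local Notation U := 'Hom(V, R^o).
Local Open Scope complex_scope.

(** Functions of x in U built from the exponentials e^b and the factors
1 / (1 - k e^(-psi)). On this syntax, derivatives of any order are given by
recursion, and their values are compared without further analysis. *)
Inductive expr :=
  | Exp of V
  | Inv of C & V
  | Add of expr & expr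
  | Mul of expr & expr
  | Scale of C & expr.

Fixpoint eval e (x : U) : C := match e with
  | Exp b => cexp (x b : R)%:C
  | Inv k psi => (1 - k * cexp (- (x psi : R)%:C))^-1
  | Add e1 e2 => eval e1 x + eval e2 x
  | Mul e1 e2 => eval e1 x * eval e2 x
  | Scale c e1 => c * eval e1 x
  end.

Fixpoint regular e (x : U) : Prop := match e with
  | Exp _ => True
  | Inv k psi => 1 - k * cexp (- (x psi : R)%:C) != 0
  | Add e1 e2 | Mul e1 e2 => regular e1 x /\ regular e2 x
  | Scale _ e1 => regular e1 x
  end.

Fixpoint deriv_expr (u : U) e := match e with
  | Exp b => Scale (u b : R)%:C (Exp b)
  | Inv k psi => Scale (- (k * (u psi : R)%:C))
      (Mul (Exp (- psi)) (Mul (Inv k psi) (Inv k psi)))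
  | Add e1 e2 => Add (deriv_expr u e1) (deriv_expr u e2)
  | Mul e1 e2 => Add (Mul (deriv_expr u e1) e2) (Mul e1 (deriv_expr u e2))
  | Scale c e1 => Scale c (deriv_expr u e1)
  end.

Lemma regular_deriv u e x : regular e x -> regular (deriv_expr u e) x.
Proof.
by elim: e => //= [e1 IH1 e2 IH2 [h1 h2]|e1 IH1 e2 IH2 [h1 h2]]; split;
  [exact: IH1|exact: IH2|split=> //; exact: IH1|split=> //; exact: IH2].
Qed.

(** Complex derivative at 0 of a function of a real variable, taken
componentwise as in dirD. *)
Definition has_cderiv (f : R -> C) (d : C) :=
  is_derive (0 : R) 1 (fun t => complex.Re (f t)) (complex.Re d) /\
  is_derive (0 : R) 1 (fun t => complex.Im (f t)) (complex.Im d).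

Lemma has_cderivD f g d e : has_cderiv f d -> has_cderiv g e ->
  has_cderiv (fun t => f t + g t) (d + e).
Proof.
move=> [fr fi] [gr gi]; split.
- have -> : (fun t => complex.Re (f t + g t)) =
    (fun t => complex.Re (f t)) + (fun t => complex.Re (g t)).
    by apply/funext => t; rewrite !raddfD.
  by rewrite raddfD; exact: is_deriveD.
- have -> : (fun t => complex.Im (f t + g t)) =
    (fun t => complex.Im (f t)) + (fun t => complex.Im (g t)).
    by apply/funext => t; rewrite !raddfD.
  by rewrite raddfD; exact: is_deriveD.
Qed.

Lemma ReD (z w : C) : complex.Re (z + w) = complex.Re z + complex.Re w.
Proof. by case: z w => [a b] [c d]. Qed.

Lemma ImD (z w : C) : complex.Im (z + w) = complex.Im z + complex.Im w.
Proof. by case: z w => [a b] [c d]. Qed.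

Lemma ReM (z w : C) : complex.Re (z * w) =
  complex.Re z * complex.Re w - complex.Im z * complex.Im w.
Proof. by case: z w => [a b] [c d]. Qed.

Lemma ImM (z w : C) : complex.Im (z * w) =
  complex.Re z * complex.Im w + complex.Im z * complex.Re w.
Proof. by case: z w => [a b] [c d]. Qed.

Lemma has_cderivM f g d e : has_cderiv f d -> has_cderiv g e ->
  has_cderiv (fun t => f t * g t) (d * g 0 + f 0 * e).
Proof.
move=> [fr fi] [gr gi]; split.
- have -> : (fun t => complex.Re (f t * g t)) =
    (fun t => complex.Re (f t)) * (fun t => complex.Re (g t)) -
    (fun t => complex.Im (f t)) * (fun t => complex.Im (g t)).
    by apply/funext => t; rewrite ReM.
  have h := is_deriveB (is_deriveM fr gr) (is_deriveM fi gi).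
  apply: (is_derive_eq h).
  by rewrite ReD !ReM /GRing.scale/=; ring.
- have -> : (fun t => complex.Im (f t * g t)) =
    (fun t => complex.Re (f t)) * (fun t => complex.Im (g t)) +
    (fun t => complex.Im (f t)) * (fun t => complex.Re (g t)).
    by apply/funext => t; rewrite ImM.
  have h := is_deriveD (is_deriveM fr gi) (is_deriveM fi gr).
  apply: (is_derive_eq h).
  by rewrite ImD !ImM /GRing.scale/=; ring.
Qed.

Lemma has_cderiv_cst c : has_cderiv (fun=> c) 0.
Proof.
split.
- have -> : (fun t : R => complex.Re c) = cst (complex.Re c) by [].
  exact: is_derive_cst.
- have -> : (fun t : R => complex.Im c) = cst (complex.Im c) by [].
  exact: is_derive_cst.
Qed.

Lemma has_cderivV f d : f 0 != 0 -> has_cderiv f d ->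
  has_cderiv (fun t => (f t)^-1) (- d * (f 0)^-1 * (f 0)^-1).
Proof.
move=> f0 [fr fi].
pose N t := (complex.Re (f t)) ^+ 2 + (complex.Im (f t)) ^+ 2.
have ReV (z : C) : complex.Re z^-1 =
    complex.Re z * (complex.Re z ^+ 2 + complex.Im z ^+ 2)^-1 by case: z.
have ImV (z : C) : complex.Im z^-1 =
    - complex.Im z * (complex.Re z ^+ 2 + complex.Im z ^+ 2)^-1.
  by case: z => a b /=; rewrite mulNr.
have N0 : N 0 != 0.
  apply: contraNneq f0 => /eqP; rewrite paddr_eq0 ?sqr_ge0// !sqrf_eq0.
  by rewrite eq_complex/= => /andP[-> ->].
have dN : is_derive (0 : R) 1 N (2 * (complex.Re (f 0) * complex.Re d +
    complex.Im (f 0) * complex.Im d)).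
  have -> : N = (fun t => complex.Re (f t)) * (fun t => complex.Re (f t)) +
    (fun t => complex.Im (f t)) * (fun t => complex.Im (f t)).
    by apply/funext => t; rewrite /N !expr2.
  have h := is_deriveD (is_deriveM fr fr) (is_deriveM fi fi).
  apply: (is_derive_eq h).
  by rewrite /GRing.scale/=; ring.
have dNV := is_deriveV N0 dN.
split.
- have -> : (fun t => complex.Re (f t)^-1) =
    (fun t => complex.Re (f t)) * (fun t => (N t)^-1).
    by apply/funext => t; rewrite ReV.
  have h := is_deriveM fr dNV.
  apply: (is_derive_eq h).
  rewrite !ReM !ImM !ReV !ImV /GRing.scale/= -/(N 0); rewrite /N in N0 *.
  by case: (f 0) d {fr fi dN dNV f0 h} N0 => a b [c e] /= N0; field.
- have -> : (fun t => complex.Im (f t)^-1) =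
    - (fun t => complex.Im (f t)) * (fun t => (N t)^-1).
    by apply/funext => t; rewrite ImV.
  have h := is_deriveM (is_deriveN fi) dNV.
  apply: (is_derive_eq h).
  have -> : (- (fun t : R => complex.Im (f t))) 0 = - complex.Im (f 0) by [].
  rewrite !ImM !ReM ?ImM !ReV !ImV /GRing.scale/= -/(N 0); rewrite /N in N0 *.
  by case: (f 0) d {fr fi dN dNV f0 h} N0 => a b [c e] /= N0; field.
Qed.

Lemma is_derive_exp_line (y s : R) :
  is_derive (0 : R) 1 (fun t : R => expR (y + t * s)) (s * expR y).
Proof.
have h : is_derive (0 : R) 1 (cst y + s \*: (id : R -> R)) s.
  by apply: is_derive_eq; rewrite add0r scaler1.
have e : cst y + s \*: (id : R -> R) = (fun t : R => y + t * s).
  by apply/funext => t; rewrite [RHS]/= [t * s]mulrC.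
rewrite e in h.
have he : is_derive (y + 0 * s) 1 (@expR R) (expR y).
  by rewrite mul0r addr0; exact: is_derive_expR.
by have := @is_derive1_comp R expR (fun t : R => y + t * s) 0 _ _ he h; rewrite mulrC.
Qed.

Lemma has_cderiv_cexp_line (y s : R) :
  has_cderiv (fun t => cexp (y + t * s)%:C) (s%:C * cexp y%:C).
Proof.
have e (t : R) : cexp (y + t * s)%:C = (expR (y + t * s))%:C by rewrite cexp_real.
split.
- have -> : (fun t => complex.Re (cexp (y + t * s)%:C)) = fun t => expR (y + t * s).
    by apply/funext => t; rewrite e.
  by rewrite cexp_real -rmorphM; exact: is_derive_exp_line.
- have -> : (fun t => complex.Im (cexp (y + t * s)%:C)) = cst 0.
    by apply/funext => t; rewrite e.
  by rewrite cexp_real -rmorphM; exact: is_derive_cst.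
Qed.

Lemma has_cderiv_eval u e x : regular e x ->
  has_cderiv (fun t => eval e (x + t *: u)) (eval (deriv_expr u e) x).
Proof.
have x0 : x + 0 *: u = x by rewrite scale0r addr0.
have line (b : V) (t : R) : ((x + t *: u) b : R) = (x b : R) + t * (u b : R).
  by rewrite add_lfunE scale_lfunE.
elim: e => /= [b _|k psi h|e1 IH1 e2 IH2 [h1 h2]|e1 IH1 e2 IH2 [h1 h2]|c e1 IH1 h].
- under eq_fun do rewrite line; exact: has_cderiv_cexp_line.
- have D : has_cderiv (fun t => 1 - k * cexp (- ((x + t *: u) psi : R)%:C))
     (k * (u psi : R)%:C * cexp (- (x psi : R)%:C)).
    have -> : (fun t => 1 - k * cexp (- ((x + t *: u) psi : R)%:C)) =
      (fun t => 1 + - k * cexp (- (x psi : R) + t * - (u psi : R))%:C).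
      by apply/funext => t; rewrite line -rmorphN mulrN -opprD mulNr.
    have -> : k * (u psi : R)%:C * cexp (- (x psi : R)%:C) = 0 +
      (0 * cexp (- (x psi : R) + 0 * - (u psi : R))%:C +
        - k * ((- (u psi : R))%:C * cexp (- (x psi : R))%:C)).
      by rewrite !rmorphN; ring.
    apply: has_cderivD; first exact: has_cderiv_cst.
    by apply: has_cderivM; [exact: has_cderiv_cst|exact: has_cderiv_cexp_line].
  have := has_cderivV _ D; rewrite x0 => /(_ h).
  rewrite (_ : cexp ((x (- psi) : R)%:C) = cexp (- (x psi : R)%:C)).
    by congr has_cderiv; rewrite !mulrA; congr (_ * _ * _); ring.
  by rewrite linearN rmorphN.
- by apply: has_cderivD; [exact: IH1|exact: IH2].
- by have := has_cderivM (IH1 h1) (IH2 h2); rewrite x0.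
- have := has_cderivM (has_cderiv_cst c) (IH1 h).
  by rewrite mul0r add0r.
Qed.

Lemma has_cderiv_neq0 f d : has_cderiv f d -> f 0 != 0 ->
  \forall t \near (0 : R), f t != 0.
Proof.
move=> [fr fi] f0.
have nz (h : R -> R) e : is_derive (0 : R) 1 h e -> h 0 != 0 ->
    \forall t \near (0 : R), h t != 0.
  move=> [hd _] h0; have /derivable1_diffP/differentiable_continuous hc := hd.
  exact: (cvgr_neq0 (h 0) hc h0).
have : (complex.Re (f 0) != 0) || (complex.Im (f 0) != 0).
  by rewrite -negb_and; apply: contra f0 => h; rewrite eq_complex.
case/orP => [/(nz _ _ fr)|/(nz _ _ fi)]; apply: filterS => t;
  by apply: contra_neq => ->.
Qed.

Lemma regular_near u e x : regular e x ->
  \forall t \near (0 : R), regular e (x + t *: u).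
Proof.
elim: e => /= [b _|k psi h|e1 IH1 e2 IH2 [h1 h2]|e1 IH1 e2 IH2 [h1 h2]|c e1 IH1 h].
- by apply: filterE.
- have h0 := @has_cderiv_eval u (Inv k psi) x h.
  have x0 : eval (Inv k psi) (x + 0 *: u) != 0.
    by rewrite /= scale0r addr0 invr_eq0.
  by apply: filterS (has_cderiv_neq0 h0 x0) => t; rewrite /= invr_eq0.
- by apply: filterS2 (IH1 h1) (IH2 h2).
- by apply: filterS2 (IH1 h1) (IH2 h2).
- exact: IH1.
Qed.

Lemma has_cderiv_dirD u (F : U -> C) x d :
  has_cderiv (fun t => F (x + t *: u)) d -> dirD u F x = d.
Proof.
move=> [fr fi]; rewrite /dirD !derive1E.
have -> := @derive_val _ _ _ _ _ _ _ fr; have -> := @derive_val _ _ _ _ _ _ _ fi.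
by case: d {fr fi}.
Qed.

Lemma has_cderiv_near f g d : (\forall t \near (0 : R), f t = g t) ->
  has_cderiv f d -> has_cderiv g d.
Proof.
move=> fg [fr fi]; split; [apply: near_eq_is_derive fr|apply: near_eq_is_derive fi];
  by apply: filterS fg => t ->.
Qed.

(** Agreement of F with e where e is regular is enough, since regularity
persists for a short time along any line. *)
Lemma iterated_dirD (F : U -> C) e (w : seq U) x :
  (forall x, regular e x -> F x = eval e x) -> regular e x ->
  foldr (@dirD R V) F w x = eval (foldr deriv_expr e w) x.
Proof.
move=> Fe; elim: w x => [|u w IH] x rx /=; first exact: Fe.
have rw : regular (foldr deriv_expr e w) x.
  by elim: w {IH} => //= u' w; exact: regular_deriv.
apply: has_cderiv_dirD; apply: has_cderiv_near (has_cderiv_eval u rw).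
by apply: filterS (regular_near u rx) => t rt; rewrite IH.
Qed.

End SymbolicExpressions.

(** * Constant coefficient operators on expressions *)

Section PolyDSymbolic.
Variables (R : realType) (V : vectType R).
Local Notation C := R[i].
Local Notation U := 'Hom(V, R^o).
Local Notation polyfun := (mpoly (\dim {:V}) C).
Local Notation expr := (@expr R V).
Local Open Scope complex_scope.
Implicit Types (P : polyfun) (e n : expr).

(** The coordinate functions listed in the order in which a monomial
differential operator applies them. *)
Definition coord_word (m : multinom (\dim {:V})) : seq U :=
  flatten [seq nseq (m i) (linfun (coord (vbasis {:V}) i : V -> R^o))
          | i <- enum 'I_(\dim {:V})].

Lemma foldr_dirD_word (m : multinom (\dim {:V})) (F : U -> C) :
  foldr (fun i H => iter (m i)
             (dirD (linfun (coord (vbasis {:V}) i : V -> R^o))) H)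
      F (enum 'I_(\dim {:V})) = foldr (@dirD R V) F (coord_word m).
Proof.
rewrite /coord_word; elim: (enum _) => //= i s ->; rewrite foldr_cat.
by elim: (m i) => //= k ->.
Qed.

(** The value at 0 of P(d) applied to an expression. *)
Definition polyD_expr P e : C :=
  \sum_(m <- msupp P) mcoeff m P * eval (foldr (@deriv_expr R V) e (coord_word m)) 0.

Lemma polyD_exprE P e (F : U -> C) : (forall x, regular e x -> F x = eval e x) ->
  regular e 0 -> polyD P F 0 = polyD_expr P e.
Proof.
move=> Fe r0; rewrite /polyD /polyD_expr; apply: eq_bigr => m _.
by rewrite foldr_dirD_word (iterated_dirD _ Fe).
Qed.

Lemma polyD_expr_Add P e1 e2 : polyD_expr P (Add e1 e2) = polyD_expr P e1 + polyD_expr P e2.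
Proof.
rewrite /polyD_expr -big_split; apply: eq_bigr => m _ /=; rewrite -mulrDr; congr (_ * _).
have -> : foldr (@deriv_expr R V) (Add e1 e2) (coord_word m) =
  Add (foldr (@deriv_expr R V) e1 (coord_word m))
      (foldr (@deriv_expr R V) e2 (coord_word m)).
  by elim: (coord_word m) => //= u w ->.
by [].
Qed.

Lemma polyD_expr_Scale P c e : polyD_expr P (Scale c e) = c * polyD_expr P e.
Proof.
rewrite /polyD_expr mulr_sumr; apply: eq_bigr => m _.
have -> : foldr (@deriv_expr R V) (Scale c e) (coord_word m) =
  Scale c (foldr (@deriv_expr R V) e (coord_word m)).
  by elim: (coord_word m) => //= u w ->.
exact: mulrCA.
Qed.

(** The two expressions may be regular at different points; adding 0 times the
first one to the second restricts the comparison to the points where both are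
regular. *)
Lemma polyD_expr_eq P e1 e2 : regular e1 0 -> regular e2 0 ->
  (forall x, regular e1 x -> regular e2 x -> eval e1 x = eval e2 x) ->
  polyD_expr P e1 = polyD_expr P e2.
Proof.
move=> r1 r2 e12.
have h1 : polyD P (eval e1) 0 = polyD_expr P e1 by apply: polyD_exprE.
have h2 : polyD P (eval e1) 0 = polyD_expr P (Add e2 (Scale 0 e1)).
  apply: polyD_exprE => [x [rx2 rx1]|//].
  by rewrite /= mul0r addr0; exact: e12.
by rewrite -h1 h2 polyD_expr_Add polyD_expr_Scale mul0r addr0.
Qed.

(** Vanishing at 0 of all the derivatives of order less than k. *)
Fixpoint vanishes k e : Prop :=
  if k is k'.+1 then eval e 0 = 0 /\ forall u, vanishes k' (deriv_expr u e) else True.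

Lemma vanishesW k e : vanishes k.+1 e -> vanishes k e.
Proof.
elim: k e => // k IH e [e0 h]; split=> // u; apply: IH; exact: h.
Qed.

Lemma vanishes_Add k e1 e2 : vanishes k e1 -> vanishes k e2 -> vanishes k (Add e1 e2).
Proof.
elim: k e1 e2 => // k IH e1 e2 [z1 h1] [z2 h2]; split=> [|u] /=.
  by rewrite z1 z2 addr0.
exact: IH (h1 u) (h2 u).
Qed.

Lemma vanishes_Mull k e1 e2 : vanishes k e1 -> vanishes k (Mul e1 e2).
Proof.
elim: k e1 e2 => // k IH e1 e2 h; have [z1 h1] := h; split=> [|u] /=.
  by rewrite z1 mul0r.
apply: vanishes_Add; first exact: IH (h1 u).
exact: IH (vanishesW h).
Qed.

Lemma vanishes_MulS k e1 e2 : vanishes k e1 -> vanishes 1 e2 ->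
  vanishes k.+1 (Mul e1 e2).
Proof.
elim: k e1 e2 => [|k IH] e1 e2 h1 h2; first by split=> //=; rewrite h2.1 mulr0.
split=> [|u]; first by rewrite /= h2.1 mulr0.
apply: (@vanishes_Add k.+1 (Mul _ e2) (Mul e1 _)); first exact: IH (h1.2 u) h2.
exact: (vanishes_Mull (deriv_expr u e2) h1).
Qed.

Lemma vanishes_deriv k e w : vanishes k e ->
  vanishes (k - size w) (foldr (@deriv_expr R V) e w).
Proof.
move=> h; elim: w => [|u w IH] /=; first by rewrite subn0.
by rewrite subnS; case: (k - size w)%N IH => //= m [_]; exact.
Qed.

(** A strict bound for the order of P(d). *)
Definition pdeg P := (\max_(m <- msupp P) size (coord_word m)).+1.

Lemma polyD_expr_vanishes P e : vanishes (pdeg P) e -> polyD_expr P e = 0.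
Proof.
move=> h; rewrite /polyD_expr big_seq big1// => m mP.
have : vanishes 1 (foldr (@deriv_expr R V) e (coord_word m)).
  have := vanishes_deriv (coord_word m) h.
  have : (size (coord_word m) < pdeg P)%N.
    by rewrite /pdeg ltnS; exact: leq_bigmax_seq.
  rewrite -subn_gt0; case: (_ - _)%N => // k _ hk.
  by elim: k hk => // k IH /vanishesW.
by case=> -> _; rewrite mulr0.
Qed.

Definition One : expr := Exp (0 : V).
Definition OneSub e : expr := Add One (Scale (-1) e).
Definition Pow e k : expr := iter k (fun e' => Mul e' e) One.

Lemma eval_One x : eval One x = 1.
Proof. by rewrite /= linear0 cexp0. Qed.

Lemma eval_OneSub e x : eval (OneSub e) x = 1 - eval e x.
Proof. by rewrite /= linear0 cexp0 mulN1r. Qed.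

Lemma eval_Pow e k x : eval (Pow e k) x = eval e x ^+ k.
Proof.
elim: k => [|k IH]; first by rewrite expr0 -[RHS](eval_One x).
by rewrite exprSr -IH.
Qed.

Lemma regular_Pow e k x : regular e x -> regular (Pow e k) x.
Proof. by move=> h; elim: k => //= k IH; split. Qed.

Lemma vanishes_Pow e k : eval e 0 = 0 -> vanishes k (Pow e k).
Proof. by move=> e0; elim: k => //= k IH; apply: vanishes_MulS. Qed.

Definition OneSubExp (psi : V) := OneSub (Exp (- psi)).

Lemma eval_OneSubExp psi x : eval (OneSubExp psi) x = 1 - cexp (- (x psi : R)%:C).
Proof. by rewrite eval_OneSub /= linearN rmorphN. Qed.

Lemma eval_OneSubExp0 psi : eval (OneSubExp psi) 0 = 0.
Proof. by rewrite eval_OneSubExp lfunE/= oppr0 cexp0 subrr. Qed.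

Fixpoint Sum (f : nat -> expr) k : expr :=
  if k is k'.+1 then Add (Sum f k') (f k') else Scale 0 One.

Lemma eval_Sum f k x : eval (Sum f k) x = \sum_(j < k) eval (f j) x.
Proof.
elim: k => [|k IH]; first by rewrite big_ord0 /= mul0r.
by rewrite big_ord_recr/= IH.
Qed.

Lemma polyD_expr_Sum P f k : polyD_expr P (Sum f k) = \sum_(j < k) polyD_expr P (f j).
Proof.
elim: k => [|k IH]; first by rewrite big_ord0 /= polyD_expr_Scale mul0r.
by rewrite big_ord_recr/= polyD_expr_Add IH.
Qed.

Lemma regular_Sum f k x : (forall j, regular (f j) x) -> regular (Sum f k) x.
Proof. by move=> h; elim: k => //= k IH; split. Qed.

Fixpoint Invs (l : seq (C * V)) : expr :=
  if l is kp :: l' then Mul (Inv kp.1 kp.2) (Invs l') else One.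

Lemma eval_Invs l x : eval (Invs l) x =
  \prod_(kp <- l) (1 - kp.1 * cexp (- (x kp.2 : R)%:C))^-1.
Proof.
elim: l => [|kp l IH]; first by rewrite big_nil; exact: eval_One.
by rewrite big_cons /= IH.
Qed.

Lemma regular_Invs l x : regular (Invs l) x <->
  (forall kp, kp \in l -> 1 - kp.1 * cexp (- (x kp.2 : R)%:C) != 0).
Proof.
elim: l => [|kp l IH] /=; first by split.
rewrite IH; split=> [[h1 h2] kq|h].
  by rewrite inE => /predU1P[->//|]; exact: h2.
by split=> [|kq kl]; apply: h; rewrite inE ?eqxx// kl orbT.
Qed.

Lemma regular_Invs0 l : (forall kp, kp \in l -> kp.1 != 1) -> regular (Invs l) 0.
Proof.
move=> h; apply/regular_Invs => kp /h.
by rewrite lfunE/= oppr0 cexp0 mulr1 subr_eq0 eq_sym.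
Qed.

(** The value at 0 of P(d) on n times the product of the 1 / (1 - k e^(-psi)),
each factor being expanded in powers of 1 - e^(-psi) up to the order of P. It
is a polynomial in the k and the 1 / (1 - k), hence meromorphic in z when k
is. *)
Fixpoint expand_invs P n (l : seq (C * V)) : C :=
  if l is kp :: l' then
    \sum_(j < pdeg P) (- kp.1) ^+ j / (1 - kp.1) ^+ j.+1 *
      expand_invs P (Mul n (Pow (OneSubExp kp.2) j)) l'
  else polyD_expr P n.

Lemma inv_geometric (k v : C) M : 1 - k != 0 -> 1 - k * v != 0 ->
  (1 - k * v)^-1 = \sum_(j < M) (- k) ^+ j / (1 - k) ^+ j.+1 * (1 - v) ^+ j +
     (- k) ^+ M / (1 - k) ^+ M * ((1 - v) ^+ M * (1 - k * v)^-1).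
Proof.
move=> k1 kv; elim: M => [|M IH].
  by rewrite big_ord0 add0r !expr0 mul1r invr1 !mul1r.
rewrite big_ord_recr/= {1}IH -addrA; congr (_ + _).
rewrite !exprS; have := expf_neq0 M k1; move: ((1 - k) ^+ M) => t t0.
move: ((- k) ^+ M) ((1 - v) ^+ M) => s r; field.
by rewrite kv t0 k1.
Qed.

Let distribute_step (K : comNzRingType) (S c w i N I : K) :
  N * ((S + c * (w * i)) * I) = N * S * I + c * (w * (N * (i * I))).
Proof. by ring. Qed.

(** The remainder of the geometric expansion of each factor contains a power of
1 - e^(-psi) that P(d) annihilates at 0. *)
Lemma polyD_expr_Invs P n l : (forall x, regular n x) -> (forall kp, kp \in l -> kp.1 != 1) ->
  polyD_expr P (Mul n (Invs l)) = expand_invs P n l.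
Proof.
elim: l n => [|kp l IH] n rn h.
  rewrite /expand_invs; apply: polyD_expr_eq => //= x _ _.
  by rewrite linear0 cexp0 mulr1.
have kp1 : kp.1 != 1 by apply: h; rewrite mem_head.
have hl kq : kq \in l -> kq.1 != 1 by move=> kl; apply: h; rewrite inE kl orbT.
have k1 : 1 - kp.1 != 0 by rewrite subr_eq0 eq_sym.
pose f j := Scale ((- kp.1) ^+ j / (1 - kp.1) ^+ j.+1)
  (Mul (Mul n (Pow (OneSubExp kp.2) j)) (Invs l)).
pose M := pdeg P.
pose rest := Scale ((- kp.1) ^+ M / (1 - kp.1) ^+ M)
  (Mul (Pow (OneSubExp kp.2) M) (Mul n (Invs (kp :: l)))).
have rl0 : regular (Invs l) 0 by exact: regular_Invs0.
have rI0 : regular (Inv kp.1 kp.2) 0.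
  by rewrite /= lfunE/= oppr0 cexp0 mulr1.
have rP j x : regular (Pow (OneSubExp kp.2) j) x by exact: regular_Pow.
transitivity (polyD_expr P (Add (Sum f M) rest)).
  apply: polyD_expr_eq => //.
  - by split; [apply: regular_Sum => j|].
  - move=> x [_ [r1 r2]] _.
    have eS : eval (Sum f M) x = eval n x * (\sum_(j < M)
        (- kp.1) ^+ j / (1 - kp.1) ^+ j.+1 * (1 - cexp (- (x kp.2 : R)%:C)) ^+ j) *
        eval (Invs l) x.
      rewrite eval_Sum mulr_sumr mulr_suml; apply: eq_bigr => j _.
      by rewrite /f [LHS]/= eval_Pow eval_OneSubExp; ring.
    have -> : eval (Add (Sum f M) rest) x = eval (Sum f M) x + eval rest x by [].
    have -> : eval rest x = (- kp.1) ^+ M / (1 - kp.1) ^+ M *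
      (eval (Pow (OneSubExp kp.2) M) x * (eval n x *
        ((1 - kp.1 * cexp (- (x kp.2 : R)%:C))^-1 * eval (Invs l) x))) by [].
    have -> : eval (Mul n (Invs (kp :: l))) x =
      eval n x * ((1 - kp.1 * cexp (- (x kp.2 : R)%:C))^-1 * eval (Invs l) x) by [].
    rewrite eS eval_Pow eval_OneSubExp {1}(inv_geometric M k1 r1).
    exact: distribute_step.
rewrite polyD_expr_Add polyD_expr_Sum [X in _ + X]polyD_expr_Scale.
rewrite [polyD_expr P (Mul (Pow _ _) _)]polyD_expr_vanishes ?mulr0 ?addr0; last first.
  by apply: vanishes_Mull; apply: vanishes_Pow; exact: eval_OneSubExp0.
apply: eq_bigr => j _; by rewrite /f polyD_expr_Scale IH.
Qed.

End PolyDSymbolic.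

(** * The kernel of Para at a fixed z *)

Section Phase.
Variable R : realType.
Local Notation C := R[i].
Local Open Scope complex_scope.

Definition phase (t : R) : C := cexp ('i * (2 * pi * t)%:C).

Lemma phaseD s t : phase (s + t) = phase s * phase t.
Proof. by rewrite /phase mulrDr rmorphD mulrDr cexpD. Qed.

Lemma phase0 : phase 0 = 1.
Proof. by rewrite /phase mulr0 mulr0 cexp0. Qed.

Lemma phase_neq0 t : phase t != 0.
Proof. exact: cexp_neq0. Qed.

Lemma phaseN t : phase (- t) = (phase t)^-1.
Proof. by rewrite /phase mulrN rmorphN mulrN cexpN. Qed.

Lemma phaseMn t n : phase (t *+ n) = phase t ^+ n.
Proof. by elim: n => [|n IH]; rewrite ?mulr0n ?phase0// mulrS exprS phaseD IH. Qed.

Lemma phaseE t : phase t = cos (2 * pi * t) +i* sin (2 * pi * t).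
Proof.
rewrite /phase /cexp ReM ImM /= !mul0r mulr0 subr0 mul1r add0r expR0.
exact: mul1r.
Qed.

Lemma phase1 : phase 1 = 1.
Proof. by rewrite phaseE mulr1 mulr_natl cos2pi sin2pi. Qed.

Lemma phase_int t : t \is a Num.int -> phase t = 1.
Proof.
move=> /intrP[[n|n] ->]; first by rewrite /= -pmulrn phaseMn phase1 expr1n.
by rewrite NegzE mulrNz phaseN -pmulrn phaseMn phase1 expr1n invr1.
Qed.

Lemma phase_eq1 t : phase t = 1 -> t \is a Num.int.
Proof.
move=> t1; pose s := t - (Num.floor t)%:~R.
have s1 : phase s = 1.
  by rewrite /s phaseD t1 mul1r phase_int// rpredN; exact: intr_int.
have s01 : 0 <= s < 1.
  by have := floor_itv t; rewrite /s intrD1 subr_ge0 ltrBlDl.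
suff s0 : s = 0 by rewrite -(subrK (Num.floor t)%:~R t) -/s s0 add0r.
(* cos (2 pi s) = 1 forces sin (pi s) = 0 with 0 <= pi s < pi. *)
have : cos (2 * pi * s) = 1 by move: s1; rewrite phaseE => -[].
rewrite -mulrA mulr_natl cos_mulr2n => /eqP; rewrite subr_eq -mulr2n.
rewrite eqrMn2r/= => /eqP c1; have := sin2cos2 (pi * s); rewrite c1 subrr => /eqP.
rewrite sqrf_eq0 => /eqP sin0; apply/eqP; rewrite eq_le; case/andP: s01 => -> s1'.
rewrite andbT leNgt; apply/negP => s_gt0.
have : 0 < sin (pi * s).
  by apply: sin_gt0_pi; rewrite mulr_gt0 ?pi_gt0//= gtr_pMr// pi_gt0.
by rewrite sin0 ltxx.
Qed.

End Phase.

Section FieldIdentities.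
Variable K : fieldType.
Implicit Types a b c e f k : K.

Lemma mul_rotate a b c e : a * (b * (c * e)) = c * (a * (b * e)).
Proof. by ring. Qed.

Lemma mul_cycle a b c : a * b * c = b * c * a.
Proof. by ring. Qed.

Lemma mul_regroup a b c e f : a * b * (c * e * f) = b * e * (a * (c * f)).
Proof. by ring. Qed.

Lemma pole_difference k e f : 1 - k * e != 0 ->
  (1 - k * e)^-1 * f + -1 * (k * e * ((1 - k * e)^-1 * f)) = f.
Proof. by move=> h; field. Qed.

Lemma pole_flip k e f : k != 0 -> e != 0 -> 1 - k * e != 0 -> 1 - k^-1 * e^-1 != 0 ->
  (1 - k * e)^-1 * f = -1 * (k^-1 * e^-1 * ((1 - k^-1 * e^-1)^-1 * f)).
Proof.
move=> k0 e0; rewrite -invfM; have := mulf_neq0 k0 e0.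
move: (k * e) => w w0 h1 h2; have h3 : w - 1 != 0 by rewrite -opprB oppr_eq0.
have -> : 1 - w^-1 = (w - 1) / w by field.
have -> : 1 - w = - (w - 1) by rewrite opprB.
by field; rewrite oppr_eq0 h3 w0.
Qed.

Lemma pole_multiple v f n : 1 - v != 0 -> 1 - v ^+ n != 0 ->
  (1 - v)^-1 * f = \sum_(i < n) v ^+ i * ((1 - v ^+ n)^-1 * f).
Proof.
move=> h1 h2; rewrite -mulr_suml.
have := subrX1 v n; rewrite -[v - 1]opprB -[v ^+ n - 1]opprB mulNr => /oppr_inj.
move=> e; apply: (mulfI h1); rewrite mulrA divff// mul1r [RHS]mulrA -e.
by rewrite mulrA divff// mul1r.
Qed.

End FieldIdentities.

Section Kernel.
Variables (R : realType) (V : vectType R).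
Local Notation C := R[i].
Local Notation U := 'Hom(V, R^o).
Local Notation polyfun := (mpoly (\dim {:V}) C).
Local Open Scope complex_scope.
Variables (E : U) (P : polyfun).
Implicit Types (g : U) (a psi : V) (l : seq V) (z : C).

(** The value at x = 0 of e^<a, x + 2 i pi g + z E>. *)
Definition lift_char g a z : C := phase (g a : R) * cexp ((E a : R)%:C * z).

(** The coefficient k of the pole factor 1 - k e^(-psi) of the kernel. *)
Definition pole_coef g psi z : C := lift_char g (- psi) z.

Definition pole_coefs g l z := [seq (pole_coef g psi z, psi) | psi <- l].

Definition kernel_expr g l a z : expr V :=
  Scale (lift_char g a z) (Mul (Exp a) (Invs (pole_coefs g l z))).

Lemma lift_charD g a b z : lift_char g (a + b) z = lift_char g a z * lift_char g b z.
Proof.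
have D (u : U) : (u (a + b) : R) = (u a : R) + (u b : R) by exact: linearD.
rewrite /lift_char !D phaseD rmorphD mulrDl cexpD; exact: mulrACA.
Qed.

Lemma real_pairingN (x : U) psi : (x (- psi) : R)%:C = - (x psi : R)%:C :> C.
Proof. by rewrite (linearN x) rmorphN. Qed.

Lemma lift_charN g a z : lift_char g (- a) z = (lift_char g a z)^-1.
Proof.
have D (u : U) : (u (- a) : R) = - (u a : R) by exact: linearN.
rewrite /lift_char !D phaseN rmorphN mulNr cexpN -invfM.
reflexivity.
Qed.

Lemma lift_char_neq0 g a z : lift_char g a z != 0.
Proof. exact: mulf_neq0 (phase_neq0 _) (cexp_neq0 _). Qed.

Lemma cexp_cpairing a x g z :
  cexp (cpairing a x g E z) = lift_char g a z * cexp (x a : R)%:C.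
Proof.
rewrite /cpairing !cexpD /lift_char /phase (mulrC z).
exact: mul_cycle.
Qed.

Lemma cexp_cpairingN a x g z :
  cexp (- cpairing a x g E z) = pole_coef g a z * cexp (- (x a : R)%:C).
Proof. by rewrite cexpN cexp_cpairing invfM /pole_coef lift_charN cexpN. Qed.

Lemma para_kernel_eval l a g z x : para_kernel l E a g z x = eval (kernel_expr g l a z) x.
Proof.
rewrite /para_kernel /kernel_expr /= eval_Invs cexp_cpairing -mulrA.
congr (_ * (_ * _)); rewrite /pole_coefs big_map prodfV; congr (_^-1).
by apply: eq_bigr => psi _; rewrite cexp_cpairingN.
Qed.

(** All the pole factors are regular at x = 0; this holds for small z <> 0. *)
Definition offpole g l z := forall psi, psi \in l -> pole_coef g psi z != 1.

Lemma regular_kernel g l a z : offpole g l z -> regular (kernel_expr g l a z) 0.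
Proof.
move=> h; split=> //; apply: regular_Invs0 => _ /mapP[psi pl ->]; exact: h.
Qed.

Definition kernel_value g l a z := polyD_expr P (kernel_expr g l a z).

Lemma polyD_kernel g l a z : offpole g l z ->
  polyD P (para_kernel l E a g z) 0 = kernel_value g l a z.
Proof.
move=> h; apply: polyD_exprE => [x _|]; first exact: para_kernel_eval.
exact: regular_kernel.
Qed.

Definition transverse l := forall psi, psi \in l -> (E psi : R) != 0.

Lemma one_minus_pole_coef g psi z :
  1 - pole_coef g psi z = one_minus_exp (phase (- (g psi : R))) (- (E psi : R))%:C z.
Proof. by rewrite /pole_coef /lift_char /one_minus_exp !linearN. Qed.

Lemma near_offpole g l : transverse l -> near_zero (offpole g l).
Proof.
move=> tl; apply: near_zero_allin => psi /tl Epsi.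
have k0 : (- (E psi : R))%:C != 0 :> C by rewrite -(rmorph0 (real_complex R)) (inj_eq (@complexI R)) oppr_eq0.
apply: near_zeroW (near_zero_one_minus_exp (phase (- (g psi : R))) k0) => z _.
by rewrite -one_minus_pole_coef subr_eq0 eq_sym.
Qed.

Lemma kernel_valueE g l a z : offpole g l z ->
  kernel_value g l a z = lift_char g a z * expand_invs P (Exp a) (pole_coefs g l z).
Proof.
move=> h; rewrite /kernel_value polyD_expr_Scale polyD_expr_Invs// => _ /mapP[psi pl ->]; exact: h.
Qed.

Lemma analytic0_lift_char g a : analytic0 (lift_char g a).
Proof.
apply: analytic0M; [exact: analytic0_cst | exact: analytic0_cexp_scale].
Qed.

Lemma meromorphic0_expand_invs n g l : transverse l ->
  meromorphic0 (fun z => expand_invs P n (pole_coefs g l z)).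
Proof.
elim: l n => [|psi l IH] n tl; first exact: meromorphic0_cst.
rewrite /=; apply: meromorphic0_sum => j; apply: meromorphic0M; last first.
  by apply: IH => phi pl; apply: tl; rewrite inE pl orbT.
have Epsi : (- (E psi : R))%:C != 0 :> C.
  by rewrite -(rmorph0 (real_complex R)) (inj_eq (@complexI R)) oppr_eq0 tl ?mem_head.
apply: meromorphic0M.
  apply: meromorphic0X; apply: analytic0_meromorphic0.
  under eq_fun do rewrite -mulN1r.
  by apply: analytic0M; [exact: analytic0_cst | exact: analytic0_lift_char].
under eq_fun do rewrite one_minus_pole_coef -exprVn.
by apply: meromorphic0X; exact: meromorphic0_one_minus_expV.
Qed.

Lemma analytic0_expand_invs n g l :
  (forall psi, psi \in l -> phase (- (g psi : R)) != 1) ->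
  analytic0 (fun z => expand_invs P n (pole_coefs g l z)).
Proof.
elim: l n => [|psi l IH] n tl; first exact: analytic0_cst.
rewrite /=; apply: analytic0_sum => j; apply: analytic0M; last first.
  by apply: IH => phi pl; apply: tl; rewrite inE pl orbT.
apply: analytic0M.
  apply: analytic0X.
  under eq_fun do rewrite -mulN1r.
  by apply: analytic0M; [exact: analytic0_cst | exact: analytic0_lift_char].
under eq_fun do rewrite one_minus_pole_coef -exprVn.
by apply: analytic0X; apply: analytic0_one_minus_expV; apply: tl; rewrite mem_head.
Qed.

Lemma meromorphic0_kernel_value g l a : transverse l -> meromorphic0 (kernel_value g l a).
Proof.
move=> tl; have h := meromorphic0M (analytic0_meromorphic0 (analytic0_lift_char g a))
  (meromorphic0_expand_invs (Exp a) g tl).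
by apply: meromorphic0_eq h; apply: near_zeroW (near_offpole g tl) => z _ /kernel_valueE ->.
Qed.

Definition kernel_residue g l a := residue0 (fun z => polyD P (para_kernel l E a g z) 0).

Lemma kernel_residue_value g l a : transverse l -> kernel_residue g l a = residue0 (kernel_value g l a).
Proof.
move=> tl; apply: residue0_eq; apply: near_zeroW (near_offpole g tl) => z _.
exact: polyD_kernel.
Qed.

Lemma kernel_residue_expand g l a : transverse l -> kernel_residue g l a =
  residue0 (fun z => lift_char g a z * expand_invs P (Exp a) (pole_coefs g l z)).
Proof.
move=> tl; rewrite (kernel_residue_value _ _ tl); apply: residue0_eq.
by apply: near_zeroW (near_offpole g tl) => z _; exact: kernel_valueE.
Qed.

(** If no character of the list is trivial at g, then no factor has a pole at
z = 0. This is why finitely many points of the torus contribute. *)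
Lemma kernel_residue_regular g l a : transverse l ->
  (forall psi, psi \in l -> phase (- (g psi : R)) != 1) -> kernel_residue g l a = 0.
Proof.
move=> tl hl; rewrite (kernel_residue_expand _ _ tl); apply: analytic0_residue0.
by apply: analytic0M; [exact: analytic0_lift_char | exact: analytic0_expand_invs].
Qed.

Lemma transverse_cons psi l : transverse (psi :: l) ->
  (E psi : R) != 0 /\ transverse l.
Proof.
by move=> h; split=> [|phi pl]; apply: h; rewrite inE ?eqxx// pl orbT.
Qed.

Lemma eval_kernel_cons g psi l a z x : eval (kernel_expr g (psi :: l) a z) x =
  (1 - pole_coef g psi z * cexp (- (x psi : R)%:C))^-1 * eval (kernel_expr g l a z) x.
Proof. by rewrite /=; exact: mul_rotate. Qed.

Lemma eval_kernel_shift g l a b z x : eval (kernel_expr g l (a + b) z) x =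
  lift_char g b z * cexp (x b : R)%:C * eval (kernel_expr g l a z) x.
Proof. by rewrite /= lift_charD linearD rmorphD cexpD; exact: mul_regroup. Qed.

Lemma regular_kernel_head g psi l a z x : regular (kernel_expr g (psi :: l) a z) x ->
  1 - pole_coef g psi z * cexp (- (x psi : R)%:C) != 0.
Proof. by case=> _ []. Qed.

Lemma kernel_value_perm g l1 l2 a z : perm_eq l1 l2 -> offpole g l1 z -> kernel_value g l1 a z = kernel_value g l2 a z.
Proof.
move=> l12 h; apply: polyD_expr_eq; [exact: regular_kernel | |].
  by apply: regular_kernel => psi; rewrite -(perm_mem l12); exact: h.
move=> x _ _; rewrite /= !eval_Invs /pole_coefs !big_map.
by rewrite (perm_big _ l12).
Qed.

Lemma kernel_value_diff g psi l a z : offpole g (psi :: l) z ->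
  kernel_value g (psi :: l) a z - kernel_value g (psi :: l) (a - psi) z = kernel_value g l a z.
Proof.
move=> h; have hl : offpole g l z by move=> phi pl; apply: h; rewrite inE pl orbT.
rewrite -mulN1r /kernel_value -polyD_expr_Scale -polyD_expr_Add; apply: polyD_expr_eq.
- by split; [exact: (regular_kernel a h) | exact: (regular_kernel (a - psi) h)].
- exact: regular_kernel.
move=> x [/regular_kernel_head r1 _] _.
have -> : eval (Add (kernel_expr g (psi :: l) a z)
   (Scale (-1) (kernel_expr g (psi :: l) (a - psi) z))) x =
   eval (kernel_expr g (psi :: l) a z) x + -1 * eval (kernel_expr g (psi :: l) (a - psi) z) x by [].
rewrite eval_kernel_shift !eval_kernel_cons -/(pole_coef g psi z) real_pairingN.
by apply: pole_difference; exact: r1.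
Qed.

Lemma kernel_value_flip g psi l a z : offpole g (psi :: l) z ->
  kernel_value g (psi :: l) a z = - kernel_value g (- psi :: l) (a + psi) z.
Proof.
move=> h.
have kN : pole_coef g (- psi) z = (pole_coef g psi z)^-1 by rewrite /pole_coef lift_charN.
have h' : offpole g (- psi :: l) z.
  move=> phi; rewrite inE => /predU1P[->|pl]; last by apply: h; rewrite inE pl orbT.
  by rewrite kN invr_eq1 h// mem_head.
rewrite -mulN1r /kernel_value -polyD_expr_Scale; apply: polyD_expr_eq.
- exact: (regular_kernel a h).
- exact: (regular_kernel (a + psi) h').
move=> x r1 r2.
have {r1} := regular_kernel_head r1; have {r2} := @regular_kernel_head _ _ _ _ _ x r2.
have -> : eval (Scale (-1) (kernel_expr g (- psi :: l) (a + psi) z)) x =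
  -1 * eval (kernel_expr g (- psi :: l) (a + psi) z) x by [].
rewrite eval_kernel_shift !eval_kernel_cons kN real_pairingN opprK.
have -> : cexp (x psi : R)%:C = (cexp (- (x psi : R)%:C))^-1 :> C by rewrite -cexpN opprK.
have -> : lift_char g psi z = (pole_coef g psi z)^-1 by rewrite /pole_coef lift_charN invrK.
move=> r2 r1; apply: pole_flip.
- exact: lift_char_neq0.
- exact: cexp_neq0.
- exact: r1.
- exact: r2.
Qed.

Lemma cexp_pairingMn (x : U) psi n :
  cexp (- (x (psi *+ n) : R)%:C) = cexp (- (x psi : R)%:C) ^+ n :> C.
Proof.
rewrite -cexpMn; congr cexp; have -> : (x (psi *+ n) : R) = (x psi : R) *+ n by exact: linearMn.
by rewrite rmorphMn mulNrn.
Qed.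

Lemma pole_coef_mulrn g psi n z : pole_coef g (psi *+ n) z = pole_coef g psi z ^+ n.
Proof.
rewrite /pole_coef -mulNrn; elim: n => [|n IH]; last by rewrite mulrS exprS lift_charD IH.
by rewrite mulr0n /lift_char !linear0 phase0 mul0r cexp0 mulr1.
Qed.

Lemma kernel_value_multiple g psi k l a z : offpole g (psi :: psi *+ k :: l) z ->
  kernel_value g (psi :: l) a z = \sum_(i < k) kernel_value g (psi *+ k :: l) (a - psi *+ i) z.
Proof.
move=> h.
have h1 : offpole g (psi :: l) z.
  by move=> phi; rewrite inE => /orP[|] pl; apply: h; rewrite !inE pl ?orbT.
have h2 : offpole g (psi *+ k :: l) z.
  by move=> phi; rewrite inE => /orP[|] pl; apply: h; rewrite !inE pl ?orbT.
rewrite /kernel_value -(polyD_expr_Sum P (fun i => kernel_expr g (psi *+ k :: l) (a - psi *+ i) z)).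
apply: polyD_expr_eq; [exact: regular_kernel | |].
  by apply: regular_Sum => j; exact: regular_kernel.
move=> x r1 r2; rewrite eval_Sum.
have {}r1 := regular_kernel_head r1.
have {}r2 : 1 - (pole_coef g psi z * cexp (- (x psi : R)%:C)) ^+ k != 0.
  case: k h h2 r2 {h1} => [|k] h h2 r2.
    have := h2 (psi *+ 0); rewrite mem_head => /(_ isT).
    by rewrite pole_coef_mulrn expr0 eqxx.
  have {}r2 := regular_kernel_head r2.2.
  by rewrite pole_coef_mulrn cexp_pairingMn -exprMn in r2; exact: r2.
rewrite eval_kernel_cons (pole_multiple _ r1 r2); apply: eq_bigr => i _.
rewrite eval_kernel_shift eval_kernel_cons pole_coef_mulrn cexp_pairingMn -exprMn.
have -> : lift_char g (- (psi *+ i)) z = pole_coef g psi z ^+ i by rewrite -pole_coef_mulrn.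
by rewrite real_pairingN cexp_pairingMn -exprMn.
Qed.

End Kernel.

(** * Identities between residues of the kernel *)

Section ResidueIdentities.
Variables (R : realType) (V : vectType R).
Local Notation C := R[i].
Local Notation U := 'Hom(V, R^o).
Local Notation polyfun := (mpoly (\dim {:V}) C).
Local Open Scope complex_scope.

Lemma residue0B (F H : C -> C) : meromorphic0 F -> meromorphic0 H ->
  residue0 (fun z => F z - H z) = residue0 F - residue0 H.
Proof.
move=> hF hH.
have hH' : meromorphic0 (fun z => -1 * H z) := meromorphic0M (meromorphic0_cst (-1)) hH.
have eH := residue0Z (-1) hH; rewrite mulN1r in eH.
rewrite -eH -(residue0D hF hH').
by apply: residue0_eq; apply: near_zero_all => z _; rewrite mulN1r.
Qed.

Lemma meromorphic0B (F H : C -> C) : meromorphic0 F -> meromorphic0 H ->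
  meromorphic0 (fun z => F z - H z).
Proof.
move=> hF hH.
have hH' : meromorphic0 (fun z => -1 * H z) := meromorphic0M (meromorphic0_cst (-1)) hH.
apply: meromorphic0_eq (meromorphic0D hF hH').
by apply: near_zero_all => z _; rewrite mulN1r.
Qed.

Lemma iter_shift_residue0 (g : V) (c : C) (F : V -> C -> C) k a :
  (forall b, meromorphic0 (F b)) ->
  meromorphic0 (fun z => iter k (shift_sub g c) (fun b => F b z) a) /\
  residue0 (fun z => iter k (shift_sub g c) (fun b => F b z) a) =
  iter k (shift_sub g c) (fun b => residue0 (F b)) a.
Proof.
move=> hF; elim: k a => [|k IH] a; first by split=> //; exact: hF.
have [m1 e1] := IH (a + g); have [m2 e2] := IH a.
have m3 := meromorphic0M (meromorphic0_cst c) m2.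
have e3 := residue0Z c m2.
split; first exact: (meromorphic0B m1 m3).
have -> : iter k.+1 (shift_sub g c) (fun b => residue0 (F b)) a =
  iter k (shift_sub g c) (fun b => residue0 (F b)) (a + g) -
  c * iter k (shift_sub g c) (fun b => residue0 (F b)) a by [].
rewrite -e1 -e2 -e3.
exact: (residue0B m1 m3).
Qed.

Variables (E : U) (P : polyfun).
Implicit Types (g : U) (a psi : V) (l : seq V).

(** The factor 1 - e^(-psi) cancels one factor of the denominator. *)
Lemma kernel_residue_diff g psi l a : transverse E (psi :: l) ->
  kernel_residue E P g (psi :: l) a - kernel_residue E P g (psi :: l) (a - psi) = kernel_residue E P g l a.
Proof.
move=> tl; have [_ tl'] := transverse_cons tl.
rewrite !(kernel_residue_value _ _ _ tl) (kernel_residue_value _ _ _ tl') -residue0B.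
- by apply: residue0_eq; apply: near_zeroW (near_offpole g tl) => z _; exact: kernel_value_diff.
- exact: meromorphic0_kernel_value.
- exact: meromorphic0_kernel_value.
Qed.

(** From 1 / (1 - v) = - v^-1 / (1 - v^-1). *)
Lemma kernel_residue_flip g psi l a : transverse E (psi :: l) ->
  kernel_residue E P g (psi :: l) a = - kernel_residue E P g (- psi :: l) (a + psi).
Proof.
move=> tl; have [Epsi tl'] := transverse_cons tl.
have tN : transverse E (- psi :: l).
  move=> phi; rewrite inE => /predU1P[->|]; last exact: tl'.
  have -> : (E (- psi) : R) = - (E psi : R) by exact: linearN.
  by rewrite oppr_eq0.
rewrite (kernel_residue_value _ _ _ tl) (kernel_residue_value _ _ _ tN).
rewrite -[RHS]mulN1r -residue0Z; last exact: meromorphic0_kernel_value.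
apply: residue0_eq; apply: near_zeroW (near_offpole g tl) => z _ h.
by rewrite mulN1r; exact: kernel_value_flip.
Qed.

Lemma kernel_residue_perm g l1 l2 a : perm_eq l1 l2 -> transverse E l1 ->
  kernel_residue E P g l1 a = kernel_residue E P g l2 a.
Proof.
move=> l12 tl; have tl2 : transverse E l2 by move=> psi; rewrite -(perm_mem l12); exact: tl.
rewrite (kernel_residue_value _ _ _ tl) (kernel_residue_value _ _ _ tl2).
by apply: residue0_eq; apply: near_zeroW (near_offpole g tl) => z _; exact: kernel_value_perm.
Qed.

(** From 1 / (1 - v) = (1 + v + ... + v^(k-1)) / (1 - v^k). *)
Lemma kernel_residue_multiple g psi k l a : (0 < k)%N -> transverse E (psi :: l) ->
  kernel_residue E P g (psi :: l) a = \sum_(i < k) kernel_residue E P g (psi *+ k :: l) (a - psi *+ i).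
Proof.
move=> k0 tl; have [Epsi tl'] := transverse_cons tl.
have tk : transverse E (psi :: psi *+ k :: l).
  move=> phi; rewrite !inE => /or3P[/eqP ->|/eqP ->|]; [exact: Epsi| |exact: tl'].
  have -> : (E (psi *+ k) : R) = (E psi : R) *+ k by exact: linearMn.
  by rewrite mulrn_eq0 negb_or -lt0n k0.
have tk' := (transverse_cons tk).2.
rewrite (kernel_residue_value _ _ _ tl).
transitivity (residue0 (fun z => \sum_(i < k) kernel_value E P g (psi *+ k :: l) (a - psi *+ i) z)).
  by apply: residue0_eq; apply: near_zeroW (near_offpole g tk) => z _; exact: kernel_value_multiple.
rewrite residue0_sum; last by move=> i; exact: meromorphic0_kernel_value.
by apply: eq_bigr => i _; rewrite (kernel_residue_value _ _ _ tk').
Qed.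

Let annih (gam : V) : expr V := Add (Exp gam) (Scale (-1) (One V)).

Let annih_step (K : comNzRingType) (c p f k : K) :
  p * (c * f * k) + - c * (p * k) = c * (p * (f + -1) * k).
Proof. by ring. Qed.

(** Along a vector gam of the wall the exponent does not involve z. The shift
minus its character multiplies the expression by e^gam - 1, which vanishes at
x = 0, so that enough such factors are annihilated by P(d). *)
Lemma kernel_value_annihilated g gam l z a : (E gam : R) = 0 -> offpole E g l z ->
  iter (pdeg P) (shift_sub gam (phase (g gam : R))) (fun b => kernel_value E P g l b z) a = 0.
Proof.
move=> Eg h; set c := phase (g gam : R).
have reg b : regular (kernel_expr E g l b z) 0 by exact: regular_kernel.
have regA x : regular (annih gam) x by [].
suff -> k : iter k (shift_sub gam c) (fun b => kernel_value E P g l b z) a =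
    c ^+ k * polyD_expr P (Mul (Pow (annih gam) k) (kernel_expr E g l a z)).
  rewrite polyD_expr_vanishes ?mulr0//; apply: vanishes_Mull; apply: vanishes_Pow.
  by rewrite /= !lfunE/= cexp0 mulN1r subrr.
elim: k a => [|k IH] a.
  rewrite /kernel_value expr0 mul1r; apply: polyD_expr_eq.
  - exact: reg.
  - by split; [|exact: reg].
  by move=> x _ _; rewrite [RHS]/= linear0 cexp0 mul1r.
have -> : iter k.+1 (shift_sub gam c) (fun b => kernel_value E P g l b z) a =
  iter k (shift_sub gam c) (fun b => kernel_value E P g l b z) (a + gam) -
  c * iter k (shift_sub gam c) (fun b => kernel_value E P g l b z) a by [].
rewrite !IH exprSr -mulrA mulrCA -mulrBr; congr (_ * _).
rewrite -mulNr -!polyD_expr_Scale -polyD_expr_Add; apply: polyD_expr_eq.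
- by split; split; [exact: regular_Pow|exact: (reg (a + gam))|exact: regular_Pow|exact: (reg a)].
- by split; [split; [exact: regular_Pow|exact: regA]|exact: (reg a)].
move=> x _ _.
have cg : lift_char E g gam z = c by rewrite /lift_char Eg mul0r cexp0 mulr1.
have -> : eval (Scale c (Mul (Pow (annih gam) k.+1) (kernel_expr E g l a z))) x =
  c * (eval (Pow (annih gam) k) x * (cexp (x gam : R)%:C + -1 * eval (One V) x) *
   eval (kernel_expr E g l a z) x) by [].
rewrite eval_One mulr1.
have -> : eval (Add (Mul (Pow (annih gam) k) (kernel_expr E g l (a + gam) z))
   (Scale (- c) (Mul (Pow (annih gam) k) (kernel_expr E g l a z)))) x =
  eval (Pow (annih gam) k) x * eval (kernel_expr E g l (a + gam) z) x +
  - c * (eval (Pow (annih gam) k) x * eval (kernel_expr E g l a z) x) by [].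
rewrite eval_kernel_shift cg; exact: annih_step.
Qed.

Lemma kernel_residue_annihilated g gam l a : (E gam : R) = 0 -> transverse E l ->
  iter (pdeg P) (shift_sub gam (phase (g gam : R))) (kernel_residue E P g l) a = 0.
Proof.
move=> Eg tl.
have -> : kernel_residue E P g l = fun b => residue0 (kernel_value E P g l b).
  by apply/funext => b; exact: kernel_residue_value.
have [_ <-] := iter_shift_residue0 gam (phase (g gam : R)) (pdeg P) a
  (fun b => meromorphic0_kernel_value P g b tl).
rewrite -[RHS](residue0_0 R); apply: residue0_eq.
by apply: near_zeroW (near_offpole g tl) => z _; exact: kernel_value_annihilated.
Qed.

Lemma kernel_residue_nil g a : kernel_residue E P g [::] a = 0.
Proof. by apply: kernel_residue_regular. Qed.

Lemma polyD_expr_Exp a : polyD_expr P (Exp a) = poly_eval P a.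
Proof.
rewrite -(@polyD_exprE _ _ P (Exp a) (fun x => cexp (x a : R)%:C))//.
have -> : polyD P (fun x : U => cexp (x a : R)%:C) 0 =
  poly_eval P a * cexp ((0 : U) a : R)%:C by exact: polyD_exp.
by rewrite lfunE/= cexp0 mulr1.
Qed.

End ResidueIdentities.

(** * Sums of residues over finite cyclic cosets *)

Section Strip.

(** One term of the geometric expansion of 1 / (1 - s^-1 e^(-psi)), rewritten
in terms of s and s - 1. *)
Lemma quotient_step (K : fieldType) (s X : K) p q m j : s != 0 -> s - 1 != 0 ->
  s ^+ p / (s - 1) ^+ q / s ^+ m.+1 * ((- s^-1) ^+ j / (1 - s^-1) ^+ j.+1 * X) =
  (-1) ^+ j * (s ^+ p / (s - 1) ^+ (q + j).+1 / s ^+ m * X).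
Proof.
move=> s0 s1; have -> : 1 - s^-1 = (s - 1) / s by field.
have -> : (- s^-1) ^+ j = (-1) ^+ j * s ^- j by rewrite -exprVn -exprMn mulN1r.
rewrite expr_div_n -addnS exprD !exprS.
have := expf_neq0 q s1; have := expf_neq0 j s1.
have := expf_neq0 j s0; have := expf_neq0 m s0.
move: (s ^+ p) (s ^+ m) (s ^+ j) ((s - 1) ^+ q) ((s - 1) ^+ j) => a b c d e.
by move=> b0 c0 e0 d0; field; rewrite s0 s1 b0 c0 d0 e0.
Qed.

Lemma power_quotient (K : fieldType) (s : K) e m : s != 0 -> (e <= m)%N ->
  (s ^+ e)^-1 = s ^+ (m - e) / (s - 1) ^+ 0 / s ^+ m.
Proof.
move=> s0 em; rewrite expr0 divr1 -{2}(subnK em) exprD invfM mulrA.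
by rewrite divff ?mul1r// expf_neq0.
Qed.

Lemma strip_value (K : fieldType) (a b c n : K) : n != 0 ->
  a * n * (n^-1 * b * c) = b * (a * c).
Proof. by move=> n0; field. Qed.

Variables (R : realType) (V : vectType R).
Local Notation C := R[i].
Local Notation U := 'Hom(V, R^o).
Local Notation polyfun := (mpoly (\dim {:V}) C).
Local Open Scope complex_scope.
Variables (E : U) (P : polyfun).
Implicit Types (N : R) (g y : U) (a psi : V) (l : seq V).

(** All the pole factors have the same coefficient e^(-Nz). *)
Definition uniform (N : R) g l :=
  forall psi, psi \in l -> (E psi : R) = N /\ phase (- (g psi : R)) = 1.

Lemma pole_coef_uniform N g l psi z : uniform N g l -> psi \in l ->
  pole_coef E g psi z = (cexp (N%:C * z))^-1.
Proof.
move=> ul pl; have [e1 e2] := ul _ pl.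
have N1 (u : U) : (u (- psi) : R) = - (u psi : R) by exact: linearN.
by rewrite /pole_coef /lift_char !N1 e1 e2 mul1r rmorphN mulNr cexpN.
Qed.

(** With s = e^(Nz): s^p / ((s - 1)^q s^|l|) times the value at 0 of P(d) on n
times the product of the 1 / (1 - s^-1 e^(-psi)). *)
Definition strip_fun N g l n p q (z : C) : C :=
  exp_quotient p q (N%:C * z) / cexp (N%:C * z) ^+ size l *
  expand_invs P n (pole_coefs E g l z).

Lemma uniform_transverse N g l : N != 0 -> uniform N g l -> transverse E l.
Proof. by move=> N0 ul psi /ul[-> _]. Qed.

Lemma realC_neq0 (N : R) : N != 0 -> N%:C != 0 :> C.
Proof. by move=> N0; rewrite -(rmorph0 (real_complex R)) (inj_eq (@complexI R)). Qed.

Lemma meromorphic0_strip_fun N g l n p q : N != 0 -> transverse E l ->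
  meromorphic0 (strip_fun N g l n p q).
Proof.
move=> N0 tl; apply: meromorphic0M; last exact: meromorphic0_expand_invs.
apply: meromorphic0M.
  exact: (meromorphic0_scale (realC_neq0 N0) (meromorphic0_exp_quotient R p q)).
have h := meromorphic0X (size l) (analytic0_meromorphic0 (analytic0_cexp_scale (- N%:C))).
apply: meromorphic0_eq h; apply: near_zero_all => z _.
by rewrite mulNr cexpN exprVn.
Qed.

(** The j-th term of the expansion of one factor raises q by j + 1 and
multiplies n by (1 - e^(-psi))^j. As p is at most q + |l|, the residues of
quotients of exponentials leave only the terms with j = 0 throughout, and only
when p equals q + |l|. *)
Lemma residue0_strip_fun N g l n p q : N != 0 -> uniform N g l ->
  (forall x, regular n x) -> (0 < p <= q + size l)%N ->
  residue0 (strip_fun N g l n p q) = N%:C^-1 * (p == q + size l)%N%:R * polyD_expr P n.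
Proof.
move=> N0; have NC0 := realC_neq0 N0.
elim: l n q => [|psi l IH] n q ul rn.
  rewrite addn0 => pq.
  have -> : residue0 (strip_fun N g [::] n p q) =
      residue0 (fun z => polyD_expr P n * exp_quotient p q (N%:C * z)).
    apply: residue0_eq; apply: near_zero_all => z _.
    by rewrite /strip_fun /= expr0 divr1 mulrC.
  have mq := meromorphic0_scale NC0 (meromorphic0_exp_quotient R p q).
  rewrite (residue0Z _ mq) (residue0_scale NC0 (meromorphic0_exp_quotient R p q)).
  by rewrite (exp_quotient_residue R pq) mulrC.
move=> pq; have ul' : uniform N g l by move=> phi pl; apply: ul; rewrite inE pl orbT.
have tl' := uniform_transverse N0 ul'.
pose n' j := Mul n (Pow (OneSubExp psi) j).
have rn' j x : regular (n' j) x by split; [exact: rn | exact: regular_Pow].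
pose T j z := (-1) ^+ j * strip_fun N g l (n' j) p (q + j).+1 z.
have mT j : meromorphic0 (T j).
  exact: (meromorphic0M (meromorphic0_cst _) (meromorphic0_strip_fun g (n' j) p _ N0 tl')).
transitivity (residue0 (fun z => \sum_(j < pdeg P) T j z)).
  apply: residue0_eq.
  apply: near_zeroW (near_zero_scale NC0 (near_zero_cexp_neq1 R)) => z _ hz.
  rewrite /strip_fun /T /= (pole_coef_uniform _ ul (mem_head _ _)) mulr_sumr.
  apply: eq_bigr => j _; rewrite /strip_fun /exp_quotient.
  by apply: quotient_step; [exact: cexp_neq0 | rewrite subr_eq0].
rewrite (residue0_sum _ (fun j : 'I_(pdeg P) => mT j)).
have eT j : residue0 (T j) = (-1) ^+ j *
    (N%:C^-1 * (p == (q + j).+1 + size l)%N%:R * polyD_expr P (n' j)).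
  rewrite (residue0Z _ (meromorphic0_strip_fun g (n' j) p _ N0 tl')) IH//.
  move: pq => /= /andP[-> pq]; apply: leq_trans pq _.
  by rewrite addnS addSn ltnS leq_add2r leq_addr.
transitivity (\sum_(j < pdeg P) (-1) ^+ j *
    (N%:C^-1 * (p == (q + j).+1 + size l)%N%:R * polyD_expr P (n' j))).
  by apply: eq_bigr => j _; exact: eT.
have [M ->] : exists M, pdeg P = M.+1 by eexists.
rewrite big_ord_recl big1 ?addr0; last first.
  move=> j _; have -> : (p == (q + lift ord0 j).+1 + size l)%N = false.
    by apply/negP => /eqP; rewrite lift0; move: pq => /= /andP[_]; lia.
  by rewrite mulr0 mul0r mulr0.
rewrite expr0 mul1r addn0 /= addSnnS; congr (_ * _).
apply: polyD_expr_eq; [exact: rn' | exact: rn |].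
by move=> x _ _; rewrite /= linear0 cexp0 mulr1.
Qed.

(** The points y + (i / N) E have the same restriction to the wall as y. *)
Definition phase_sum (N : nat) y l a : C :=
  \sum_(i < N) kernel_residue E P (y + (i%:R / N%:R : R) *: E) l a.

Lemma geometric_root (K : fieldType) (w : K) n : w ^+ n = 1 -> w != 1 ->
  \sum_(i < n) w ^+ i = 0.
Proof.
move=> wn w1; have := subrX1 w n; rewrite wn subrr => /esym/eqP.
by rewrite mulf_eq0 subr_eq0 (negPf w1) => /eqP.
Qed.

(** If N does not divide E a, the characters of the N points sum to 0 at a.
Otherwise E a = - e N with 0 <= e < |l|, and the residue is that of the
exponential quotient with p = |l| - e, which vanishes unless e = 0. *)
Lemma phase_sum_strip (N : nat) y l a : (0 < N)%N -> (0 < size l)%N ->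
  (forall psi, psi \in l -> (E psi : R) = N%:R /\ phase (y psi : R) = 1) ->
  (E a : R) \is a Num.int -> - ((size l)%:R * N%:R) < (E a : R) <= 0 ->
  phase_sum N y l a = ((E a : R) == 0)%:R * (phase (y a : R) * poly_eval P a).
Proof.
move=> N0 l0 hl Ea_int Ea.
have NR0 : N%:R != 0 :> R by rewrite pnatr_eq0 -lt0n.
pose g i := y + (i%:R / N%:R : R) *: E.
have gE i b : (g i b : R) = (y b : R) + i%:R / N%:R * (E b : R).
  by rewrite add_lfunE scale_lfunE.
have ul i : uniform N%:R (g i) l.
  move=> psi /hl[e1 e2]; split=> //; rewrite phaseN gE e1 phaseD e2 mul1r.
  by rewrite divfK// phase_int ?invr1// natr_int.
pose G z : C := cexp ((E a : R)%:C * z) * expand_invs P (Exp a) (pole_coefs E y l z).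
have tl : transverse E l by move=> psi /hl[-> _].
have mG : meromorphic0 G.
  apply: meromorphic0M; last exact: meromorphic0_expand_invs.
  exact: analytic0_meromorphic0 (analytic0_cexp_scale _).
have uy : uniform N%:R y l.
  by move=> psi /hl[e1 e2]; split=> //; rewrite phaseN e2 invr1.
have eR (i : nat) : kernel_residue E P (g i) l a = phase (y a : R) * phase ((E a : R) / N%:R) ^+ i * residue0 G.
  rewrite (kernel_residue_expand _ _ _ tl) -(residue0Z _ mG); apply: residue0_eq.
  apply: near_zero_all => z _; rewrite /lift_char gE /G.
  have -> : pole_coefs E (g i) l z = pole_coefs E y l z.
    apply/eq_in_map => psi pl /=.
    by rewrite (pole_coef_uniform z (ul i) pl) (pole_coef_uniform z uy pl).
  have -> : i%:R / N%:R * (E a : R) = ((E a : R) / N%:R) *+ i.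
    by rewrite -[RHS]mulr_natl; ring.
  by rewrite phaseD phaseMn !mulrA.
transitivity (\sum_(i < N) phase (y a : R) * phase ((E a : R) / N%:R) ^+ i * residue0 G).
  by apply: eq_bigr => i _; exact: eR.
rewrite -mulr_suml -mulr_sumr.
set w := phase ((E a : R) / N%:R); have wN : w ^+ N = 1.
  have <- : phase (((E a : R) / N%:R) *+ N) = w ^+ N by rewrite phaseMn.
  have -> : ((E a : R) / N%:R) *+ N = (E a : R) by rewrite -[LHS]mulr_natr divfK.
  exact: phase_int.
have [w1|w1] := eqVneq w 1; last first.
  rewrite (geometric_root wN w1) mulr0 mul0r.
  have [e0|_] := eqVneq (E a : R) 0; last by rewrite mul0r.
  by move: w1; rewrite /w e0 mul0r phase0 eqxx.
(* Here N divides E a, say E a = - e N with e < size l. *)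
have /intrP[k ek] := phase_eq1 w1.
have Ea' : (E a : R) = k%:~R * N%:R by rewrite -ek divfK.
have NR : 0 < N%:R :> R by rewrite ltr0n.
have k_le0 : k <= 0.
  by rewrite -(ler_int R) -(pmulr_lle0 _ NR) -Ea'; case/andP: Ea.
have k_gt : - (size l)%:Z < k.
  rewrite -(ltr_int R) -(ltr_pM2r NR) -Ea' rmorphN/= mulNr; case/andP: Ea => h _; exact: h.
pose e := `|k|%N; have ke : k = - (e%:Z) by rewrite /e; lia.
have el : (e < size l)%N by rewrite /e; lia.
have eG : residue0 G = residue0 (strip_fun N%:R y l (Exp a) (size l - e) 0).
  apply: residue0_eq; apply: near_zero_all => z _; rewrite /G /strip_fun.
  have -> : cexp ((E a : R)%:C * z) = (cexp (N%:R%:C * z) ^+ e)^-1.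
    have -> : (E a : R) = - (e%:R * N%:R) by rewrite Ea' ke rmorphN/= mulNr -pmulrn.
    rewrite -cexpMn -cexpN rmorphN mulNr; congr (cexp (- _)).
    by rewrite rmorphM -mulrA rmorph_nat mulr_natl.
  by rewrite (power_quotient (cexp_neq0 _) (ltnW el)).
have hpq : (0 < size l - e <= 0 + size l)%N by rewrite subn_gt0 el leq_subr.
have rE x : regular (Exp a : expr V) x by [].
rewrite eG (residue0_strip_fun NR0 uy rE hpq) polyD_expr_Exp w1.
have -> : (size l - e == 0 + size l)%N = ((E a : R) == 0).
  rewrite Ea' mulf_eq0 (negPf NR0) orbF intr_eq0 ke oppr_eq0.
  by apply/eqP/eqP; lia.
have -> : \sum_(i < N) (1 : C) ^+ i = N%:R%:C.
  rewrite (rmorph_nat (real_complex R)) -[N in RHS]card_ord -sumr_const.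
  by apply: eq_bigr => i _; rewrite expr1n.
exact: (strip_value _ _ _ (realC_neq0 NR0)).
Qed.

End Strip.

(** * The strip below the wall *)

Section WallStrip.
Variables (R : realType) (V : vectType R).
Local Notation C := R[i].
Local Notation U := 'Hom(V, R^o).
Local Notation polyfun := (mpoly (\dim {:V}) C).
Local Open Scope complex_scope.
Variables (E : U) (P : polyfun) (N : nat) (y : U).
Implicit Types (a psi : V) (l : seq V).
Hypothesis N_gt0 : (0 < N)%N.

Local Notation Ysum := (phase_sum E P N y).

Local Notation ev := (fun a : V => (E a : R)).
Local Notation neg_part := (neg_part ev).
Local Notation pos_part := (pos_part ev).
Local Notation neg_count := (neg_count ev).

(** Some multiple of each vector, up to sign, has level N and a trivial
character at y. *)
Definition commensurable l := forall psi, psi \in l ->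
  (E psi : R) \is a Num.int /\
  exists2 k : nat, `|E psi : R| * k%:R = N%:R & k%:R * (y psi : R) \is a Num.int.

Lemma commensurable_transverse l : commensurable l -> transverse E l.
Proof.
move=> cl psi /cl[_ [k ek _]]; apply/eqP => e0; move/eqP: ek.
by rewrite e0 normr0 mul0r eq_sym pnatr_eq0 eqn0Ngt N_gt0.
Qed.

Lemma phase_sum_flip psi l a : transverse E (psi :: l) ->
  Ysum (psi :: l) a = - Ysum (- psi :: l) (a + psi).
Proof. by move=> tl; rewrite /phase_sum -sumrN; apply: eq_bigr => i _; exact: kernel_residue_flip. Qed.

Lemma phase_sum_perm l1 l2 a : perm_eq l1 l2 -> transverse E l1 -> Ysum l1 a = Ysum l2 a.
Proof. by move=> l12 tl; apply: eq_bigr => i _; exact: kernel_residue_perm. Qed.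

Lemma phase_sum_multiple psi k l a : (0 < k)%N -> transverse E (psi :: l) ->
  Ysum (psi :: l) a = \sum_(i < k) Ysum (psi *+ k :: l) (a - psi *+ i).
Proof.
move=> k0 tl; rewrite /phase_sum exchange_big/=; apply: eq_bigr => i _.
exact: kernel_residue_multiple.
Qed.

Lemma pairingD (u : U) a b : (u (a + b) : R) = (u a : R) + (u b : R).
Proof. exact: linearD. Qed.

Lemma pairingN (u : U) a : (u (- a) : R) = - (u a : R).
Proof. exact: linearN. Qed.

Lemma pairingMn (u : U) a n : (u (a *+ n) : R) = (u a : R) *+ n.
Proof. exact: linearMn. Qed.

Lemma pairing0 (u : U) : (u 0 : R) = 0.
Proof. exact: linear0. Qed.

Definition standard l := forall psi, psi \in l ->
  (E psi : R) = N%:R /\ phase (y psi : R) = 1.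

(** The value that Q dictates on the lower edge of the strip. *)
Definition wall_value l a : C := ((E (a + neg_part l) : R) == 0)%:R *
  ((-1) ^+ neg_count l *
   (phase (y (a + neg_part l) : R) * poly_eval P (a + neg_part l))).

Lemma transverse_cat l l' : transverse E (l ++ l') <-> transverse E l /\ transverse E l'.
Proof.
split=> [h|[h h'] psi].
  by split=> psi pl; apply: h; rewrite mem_cat pl ?orbT.
by rewrite mem_cat => /orP[/h|/h'].
Qed.

Lemma standard_transverse l : standard l -> transverse E l.
Proof. by move=> h psi /h[-> _]; rewrite pnatr_eq0 -lt0n. Qed.

(** One step of the induction below, for a vector psi on the positive side: psi
is traded for k psi, and of the k translates by multiples of psi only the first
one can reach the edge of the strip. *)
Lemma wall_step psi k l l' a : (0 < k)%N -> 0 < (E psi : R) ->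
  (E psi : R) * k%:R = N%:R -> transverse E (psi :: l ++ l') ->
  (forall b, (E b : R) - (E a : R) \is a Num.int ->
     - ((size l').+1%:R * N%:R) - (E (pos_part l) : R) < (E b : R) ->
     (E (b + neg_part l) : R) <= 0 ->
     Ysum (l ++ psi *+ k :: l') b = wall_value l b) ->
  (E psi : R) \is a Num.int ->
  - ((size l')%:R * N%:R) - (E psi : R) - (E (pos_part l) : R) < (E a : R) ->
  (E (a + neg_part l) : R) <= 0 ->
  Ysum (psi :: l ++ l') a = wall_value l a.
Proof.
move=> k0 Epsi ek tl IH Epsi_int lo hi; rewrite (phase_sum_multiple _ k0 tl).
have tk : transverse E (psi *+ k :: l ++ l').
  move=> phi; rewrite inE => /predU1P[->|pl]; last by apply: tl; rewrite inE pl orbT.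
  by rewrite pairingMn -mulr_natr ek pnatr_eq0 -lt0n.
have pe : perm_eq (psi *+ k :: l ++ l') (l ++ psi *+ k :: l').
  by rewrite perm_sym perm_catC/= perm_cons perm_catC.
have Ei i : (E (a - psi *+ i) : R) = (E a : R) - i%:R * (E psi : R).
  by rewrite pairingD pairingN pairingMn mulr_natl.
have eT (i : 'I_k) : Ysum (psi *+ k :: l ++ l') (a - psi *+ i) = wall_value l (a - psi *+ i).
  rewrite (phase_sum_perm _ pe tk); apply: IH.
  - by rewrite Ei addrAC subrr add0r rpredN rpredM// natr_int.
  - have ik : i%:R * (E psi : R) <= N%:R - (E psi : R).
      rewrite -ek mulrC -[X in _ <= _ - X]mulr1 -mulrBr ler_wpM2l ?(ltW Epsi)//.
      by rewrite lerBrDr natr1 ler_nat.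
    rewrite Ei -natr1 mulrDl mul1r; lra.
  - rewrite pairingD Ei; rewrite pairingD in hi.
    have : 0 <= i%:R * (E psi : R) by rewrite mulr_ge0 ?(ltW Epsi).
    lra.
rewrite (eq_bigr _ (fun i _ => eT i)); case: k k0 {ek tk pe IH eT} => // k _.
rewrite big_ord_recl big1 ?addr0; first by rewrite mulr0n subr0.
move=> i _; rewrite /wall_value pairingD Ei lift0.
have -> : ((E a : R) - i.+1%:R * (E psi : R) + (E (neg_part l) : R) == 0) = false.
  apply/negbTE; rewrite lt_eqF//; rewrite pairingD in hi.
  have : 0 < i.+1%:R * (E psi : R) by rewrite mulr_gt0.
  lra.
by rewrite mul0r.
Qed.

(** The list l' collects vectors brought to level N with trivial character, for
which phase_sum_strip applies. Each vector of l is flipped to the positive side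
if necessary and replaced by such a multiple. *)
Lemma phase_sum_wall l l' a : commensurable l -> standard l' ->
  (0 < size l + size l')%N -> (E a : R) \is a Num.int ->
  - ((size l')%:R * N%:R) - (E (pos_part l) : R) < (E a : R) ->
  (E (a + neg_part l) : R) <= 0 ->
  Ysum (l ++ l') a = wall_value l a.
Proof.
elim: l l' a => [|psi l IH] l' a cl sl' sz Ea lo hi.
  rewrite /wall_value /neg_part /neg_count big_nil addr0 expr0 mul1r.
  apply: phase_sum_strip => //; rewrite /pos_part big_nil pairing0 subr0 in lo.
  by rewrite lo; rewrite /neg_part big_nil addr0 in hi.
have cl1 : commensurable l by move=> phi pl; apply: cl; rewrite inE pl orbT.
have [Epsi_int [k ek yk]] := cl psi (mem_head _ _).
have k0 : (0 < k)%N.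
  rewrite lt0n; apply/eqP => k0; move: ek; rewrite k0 mulr0 => /eqP.
  by rewrite eq_sym pnatr_eq0 eqn0Ngt N_gt0.
have tl : transverse E (psi :: l ++ l').
  rewrite -cat_cons; apply/transverse_cat; split; last exact: standard_transverse.
  exact: commensurable_transverse.
have Epsi0 := (transverse_cons tl).1.
have [Epos|Eneg] := ltrP 0 (E psi : R).
  rewrite gtr0_norm// in ek.
  have en : neg_part (psi :: l) = neg_part l by rewrite neg_part_cons ltNge ltW//= add0r.
  have ep : (E (pos_part (psi :: l)) : R) = (E psi : R) + (E (pos_part l) : R).
    by rewrite pos_part_cons Epos pairingD.
  have -> : wall_value (psi :: l) a = wall_value l a.
    by rewrite /wall_value en /neg_count/= ltNge (ltW Epos).
  rewrite en in hi; rewrite ep in lo.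
  have lo' : - ((size l')%:R * N%:R) - (E psi : R) - (E (pos_part l) : R) < (E a : R).
    by lra.
  apply: (wall_step k0 Epos ek tl _ Epsi_int lo' hi).
  move=> b Eb lob hib; apply: (IH (psi *+ k :: l') b cl1 _ _ _ lob hib).
  - move=> phi; rewrite inE => /predU1P[->|]; last exact: sl'.
    split; first by rewrite pairingMn -[LHS]mulr_natr ek.
    by rewrite pairingMn -mulr_natl phase_int.
  - by rewrite addnS.
  - by rewrite -(subrK (E a : R) (E b : R)) rpredD.
have {}Eneg : (E psi : R) < 0 by rewrite lt_neqAle Epsi0.
rewrite ltr0_norm// in ek.
have en : neg_part (psi :: l) = psi + neg_part l by rewrite neg_part_cons Eneg.
have ep : pos_part (psi :: l) = pos_part l by rewrite pos_part_cons ltNge ltW//= add0r.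
rewrite en in hi; rewrite ep in lo.
rewrite cat_cons (phase_sum_flip _ tl).
have ENpsi : (E (- psi) : R) = - (E psi : R) by exact: pairingN.
have tN : transverse E (- psi :: l ++ l').
  move=> phi; rewrite inE => /predU1P[->|pl]; last by apply: tl; rewrite inE pl orbT.
  by rewrite ENpsi oppr_eq0.
have -> : wall_value (psi :: l) a = - wall_value l (a + psi).
  by rewrite /wall_value en /neg_count/= Eneg exprS addrA mulN1r !mulNr mulrN.
congr (- _); rewrite -ENpsi in ek.
have Epos : 0 < (E (- psi) : R) by rewrite ENpsi oppr_gt0.
have Eint : (E (- psi) : R) \is a Num.int by rewrite ENpsi rpredN.
have lo' : - ((size l')%:R * N%:R) - (E (- psi) : R) - (E (pos_part l) : R) <
    (E (a + psi) : R) by rewrite ENpsi pairingD; lra.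
have hi' : (E (a + psi + neg_part l) : R) <= 0 by rewrite -addrA.
apply: (wall_step k0 Epos ek tN _ Eint lo' hi').
- move=> b Eb lob hib; apply: (IH (- psi *+ k :: l') b cl1 _ _ _ lob hib).
  - move=> phi; rewrite inE => /predU1P[->|]; last exact: sl'.
    split; first by rewrite pairingMn -[LHS]mulr_natr ek.
    by rewrite pairingMn pairingN mulNrn phaseN -mulr_natl phase_int// invr1.
  - by rewrite addnS.
  - by rewrite -(subrK (E (a + psi) : R) (E b : R)) rpredD// pairingD rpredD.
Qed.

End WallStrip.

(** * The torus and its restriction to the wall *)

Section TorusEquality.
Variables (R : realType) (V : vectType R) (G : set V).
Local Notation U := 'Hom(V, R^o).
Local Open Scope complex_scope.
Local Open Scope quotient_scope.
Implicit Types (u v : U) (g y : torus G).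

Lemma dual_latticeP u : reflect (forall a, G a -> (u a : R) \is a Num.int)
  (u \in dual_lattice G).
Proof. exact: asboolP. Qed.

Lemma torus_eqP u v : reflect (forall a, G a -> ((u - v) a : R) \is a Num.int)
  (\pi_(torus G) u == \pi_(torus G) v).
Proof.
have -> : (\pi_(torus G) u == \pi_(torus G) v) = (u - v \in dual_lattice G).
  by rewrite Quotient.idealrBE.
exact: dual_latticeP.
Qed.

End TorusEquality.

Lemma dual_restrictE (R : realType) (V : vectType R) (W : {vspace V}) (u : 'Hom(V, R^o))
  (w : subvs_of W) : (dual_restrict W u w : R) = (u (vsval w) : R).
Proof. by rewrite /dual_restrict comp_lfunE lfunE. Qed.

Section TorusRestriction.
Variables (R : realType) (V : vectType R) (G : set V).
Local Notation U := 'Hom(V, R^o).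
Local Open Scope complex_scope.
Local Open Scope quotient_scope.
Implicit Types (u v : U) (g y : torus G).

Lemma repr_pi_phase u a : G a -> phase ((repr (\pi_(torus G) u) : U) a : R) = phase (u a : R).
Proof.
move=> Ga.
have /torus_eqP/(_ a Ga) : \pi_(torus G) (repr (\pi_(torus G) u)) == \pi_(torus G) u.
  by rewrite reprK.
have -> : ((repr (\pi_(torus G) u) - u) a : R) =
   ((repr (\pi_(torus G) u) : U) a : R) - (u a : R).
  by rewrite add_lfunE opp_lfunE.
move=> hi; rewrite -[X in phase X = _](subrK (u a : R)) phaseD.
by rewrite phase_int// mul1r.
Qed.

Lemma torus_repr_mulrn y n a : G a -> y *+ n = 0 ->
  n%:R * ((repr y : U) a : R) \is a Num.int.
Proof.
move=> Ga yn; have : \pi_(torus G) ((repr y : U) *+ n) == \pi_(torus G) (0 : U).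
  have -> : \pi_(torus G) ((repr y : U) *+ n) = (\pi_(torus G) (repr y : U)) *+ n.
    exact: raddfMn.
  have -> : \pi_(torus G) (0 : U) = 0 by exact: raddf0.
  by rewrite reprK yn.
move/torus_eqP => /(_ a Ga).
have -> : (((repr y : U) *+ n - 0) a : R) = n%:R * ((repr y : U) a : R).
  rewrite subr0 mulr_natl; elim: n {yn} => [|n IH]; first by rewrite !mulr0n lfunE.
  by rewrite !mulrS add_lfunE IH.
by [].
Qed.

Variables (W : {vspace V}) (E : U).
Hypothesis WE : forall a, a \in W <-> (E a : R) = 0.
Hypothesis G0 : G 0.
Hypothesis GD : forall a b, G a -> G b -> G (a + b).
Hypothesis GN : forall a, G a -> G (- a).
Hypothesis E_int : forall a, G a -> (E a : R) \is a Num.int.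
Hypothesis E_one : exists2 a, G a & (E a : R) = 1.

Lemma lattice_mulz a (k : int) : G a -> G (a *~ k).
Proof.
move=> Ga; have Gn n : G (a *+ n) by elim: n => [|n IH]; rewrite ?mulr0n// mulrS; exact: GD.
by case: k => n; [exact: Gn | rewrite NegzE mulrNz; apply: GN; exact: Gn].
Qed.

(** The difference u of two lifts is integral on the vectors of the lattice in
the wall. If E b = 1, then u and u(b) E agree modulo integers on the lattice,
because a - E(a) b lies in the wall. *)
Lemma torus_restrict_eqP g y : torus_restrict W g = torus_restrict W y ->
  exists t : R, g = \pi_(torus G) ((repr y : U) + t *: E).
Proof.
move=> /eqP egy.
have /torus_eqP h : \pi_(torus (lattice_in W G)) (dual_restrict W (repr g)) ==
  \pi_(torus (lattice_in W G)) (dual_restrict W (repr y)) by exact: egy.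
have [b Gb Eb] := E_one.
pose u := (repr g : U) - (repr y : U).
have hu a : G a -> (E a : R) = 0 -> (u a : R) \is a Num.int.
  move=> Ga Ea; have aW : a \in W by apply/WE.
  have := h (Subvs aW) Ga; rewrite add_lfunE opp_lfunE !dual_restrictE/=.
  by rewrite /u add_lfunE opp_lfunE.
exists (u b); rewrite -[LHS]reprK; apply/eqP/torus_eqP => a Ga.
have /intrP[k Ek] := E_int Ga.
have := hu (a - b *~ k); rewrite !linearB/= => /(_ (GD Ga (GN (lattice_mulz k Gb)))).
have EM (v : U) : (v (b *~ k) : R) = k%:~R * (v b : R).
  have -> : (v (b *~ k) : R) = (v b : R) *~ k by exact: raddfMz.
  by rewrite mulrzl.
rewrite !EM Eb mulr1 Ek subrr => /(_ erefl).
move=> hi.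
have -> : (((repr g : U) - ((repr y : U) + (u b : R) *: E)) a : R) =
    (u a : R) - k%:~R * (u b : R).
  rewrite !add_lfunE !opp_lfunE !add_lfunE scale_lfunE Ek.
  by rewrite opprD addrA [k%:~R * _]mulrC.
exact: hi.
Qed.

End TorusRestriction.

(** * Points of the torus over a restriction *)

Section CosetSum.
Variables (R : realType) (V : vectType R) (G : set V).
Local Notation C := R[i].
Local Notation U := 'Hom(V, R^o).
Local Open Scope complex_scope.
Local Open Scope quotient_scope.
Variables (W : {vspace V}) (E : U).
Hypothesis WE : forall a, a \in W <-> (E a : R) = 0.
Hypothesis G0 : G 0.
Hypothesis GD : forall a b, G a -> G b -> G (a + b).
Hypothesis GN : forall a, G a -> G (- a).
Hypothesis E_int : forall a, G a -> (E a : R) \is a Num.int.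
Hypothesis E_one : exists2 a, G a & (E a : R) = 1.
Implicit Types (u v : U) (g y : torus G) (P : mpoly (\dim {:V}) C).

(** The kernel depends on g through its characters at a and at the vectors of
the list only. *)
Lemma kernel_residue_congr P u v l a :
  (forall b, b \in a :: l -> phase (u b : R) = phase (v b : R)) ->
  kernel_residue E P u l a = kernel_residue E P v l a.
Proof.
move=> h; have hc z b : b \in a :: l -> lift_char E u b z = lift_char E v b z.
  by move=> /h e; rewrite /lift_char e.
have hk z : para_kernel l E a u z = para_kernel l E a v z.
  apply/funext => x; rewrite /para_kernel !cexp_cpairing (hc _ _ (mem_head _ _)).
  congr (_ / _); rewrite big_seq [RHS]big_seq; apply: eq_bigr => psi pl.
  rewrite !cexp_cpairingN /pole_coef !lift_charN hc//.
  by rewrite inE pl orbT.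
by congr residue0; apply/funext => z; rewrite hk.
Qed.

(** N is a common multiple of the levels of the list and of the order of y. *)
Lemma commensurable_exists l y n : y *+ n.+1 = 0 ->
  (forall psi, psi \in l -> G psi /\ (E psi : R) != 0) ->
  exists2 N : nat, (0 < N)%N & commensurable E N (repr y) l.
Proof.
move=> yn hl.
have [D D0 hD] : exists2 D : nat, (0 < D)%N & forall psi, psi \in l ->
    exists k : nat, `|E psi : R| * k%:R = D%:R.
  elim: l hl => [|psi l IH] hl; first by exists 1%N.
  have [D D0 hD] : exists2 D : nat, (0 < D)%N & forall psi, psi \in l ->
      exists k : nat, `|E psi : R| * k%:R = D%:R.
    by apply: IH => phi pl; apply: hl; rewrite inE pl orbT.
  have [Gpsi Epsi] := hl psi (mem_head _ _).
  have /natrP[m em] : `|E psi : R| \is a Num.nat by apply: natr_norm_int; exact: E_int.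
  have m0 : (0 < m)%N by rewrite -(ltr_nat R) -em normr_gt0.
  exists (m * D)%N; first by rewrite muln_gt0 m0.
  move=> phi; rewrite inE => /predU1P[->|/hD[k ek]].
    by exists D; rewrite em natrM.
  by exists (m * k)%N; rewrite !natrM -ek mulrCA.
exists (D * n.+1)%N; first by rewrite muln_gt0 D0.
move=> psi pl; have [Gpsi Epsi] := hl psi pl; split; first exact: E_int.
have [k ek] := hD psi pl; exists (k * n.+1)%N; first by rewrite !natrM mulrA ek.
by rewrite natrM -mulrA rpredM ?natr_int// torus_repr_mulrn.
Qed.

Let coset_point N y (i : nat) : torus G :=
  \pi_(torus G) ((repr y : U) + (i%:R / N%:R : R) *: E).

Let coset_pointE N y i a : G a -> phase ((repr (coset_point N y i) : U) a : R) =
  phase (((repr y : U) + (i%:R / N%:R : R) *: E) a : R).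
Proof. exact: repr_pi_phase. Qed.

(** The points with the restriction of y are the y + t E. Such a point can only
contribute if it has a trivial character on the list, which forces N t to be an
integer. The N points obtained are distinct, since E takes the value 1 on the
lattice. *)
Lemma coset_sum P l y N a : (0 < N)%N -> commensurable E N (repr y) l ->
  (forall psi, psi \in l -> G psi) -> G a ->
  \sum_(g \in [set g : torus G | torus_restrict W g = torus_restrict W y])
     residue0 (fun z => polyD P (para_kernel l E a (repr g) z) 0) =
  phase_sum E P N (repr y) l a.
Proof.
move=> N0 cl Gl Ga; have NR0 : N%:R != 0 :> R by rewrite pnatr_eq0 -lt0n.
have tl := commensurable_transverse N0 cl.
pose r := [seq coset_point N y i | i <- iota 0 N].
have [b Gb Eb] := E_one.
have lin (u : U) (t : R) c : ((u + t *: E) c : R) = (u c : R) + t * (E c : R).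
  by rewrite add_lfunE scale_lfunE.
(* The N points are distinct: evaluate at b, where E is 1. *)
have ur : uniq r.
  rewrite map_inj_in_uniq ?iota_uniq// => i j; rewrite !mem_iota !add0n /= => iN jN.
  move=> eij.
  have /torus_eqP/(_ b Gb) :
      \pi_(torus G) ((repr y : U) + (i%:R / N%:R : R) *: E) ==
      \pi_(torus G) ((repr y : U) + (j%:R / N%:R : R) *: E) by apply/eqP; exact: eij.
  rewrite add_lfunE opp_lfunE !lin Eb !mulr1.
  have -> : (repr y : U) b + i%:R / N%:R - ((repr y : U) b + j%:R / N%:R) =
     (i%:R - j%:R) / N%:R :> R by rewrite mulrBl opprD addrACA subrr add0r.
  move=> /intrP[k ek]; have {}ek : (i%:R - j%:R : R) = k%:~R * N%:R by rewrite -ek divfK.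
  have : (i%:Z - j%:Z = k * N%:Z)%R.
    by apply/eqP; rewrite -(eqr_int R) rmorphB rmorphM/= -!pmulrn ek.
  have mulN (m : nat) : (N <= m.+1 * N)%N by rewrite leq_pmull.
  by case: k {ek} => [[|m]|m] ekz; [lia | have := mulN m; lia | have := mulN m; lia].
have rA : [set` r] `<=` [set g : torus G | torus_restrict W g = torus_restrict W y].
  move=> _ /mapP[i _ ->] /=; apply/eqP; rewrite /torus_restrict.
  apply/(@torus_eqP _ _ (lattice_in W G)) => w Gw.
  rewrite add_lfunE opp_lfunE !dual_restrictE.
  apply: phase_eq1; rewrite phaseD phaseN coset_pointE// lin.
  have -> : (E (vsval w) : R) = 0 by apply/WE; exact: subvsP.
  by rewrite mulr0 addr0 divff// phase_neq0.
rewrite (fsbigE r _ ur rA); first (rewrite big_rmcond_in; last first).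
- by move=> g gr; rewrite notin_setE => h; case: h; exact: rA.
- rewrite /r big_map -{1}(subn0 N) -/(index_iota 0 N) big_mkord.
  apply: eq_bigr => i _; apply: kernel_residue_congr => c; rewrite inE => /predU1P[->|/Gl Gc].
    exact: coset_pointE.
  exact: coset_pointE.
(* A point outside r with this restriction is y + t E where N t is not an
   integer, and no character of the list is trivial there. *)
- move=> g /= gy gr; have [t et] := torus_restrict_eqP WE G0 GD GN E_int E_one gy.
  apply: kernel_residue_regular => // psi pl; apply/eqP => h; move/negP: gr; apply.
  have [_ [k ek yk]] := cl psi pl.
  have : phase ((repr g : U) psi : R) = 1.
    by rewrite -[RHS]invr1 -h phaseN invrK.
  rewrite et repr_pi_phase; last exact: Gl.
  rewrite lin => /phase_eq1 hi.
  have tN : t * N%:R \is a Num.int.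
    have : k%:R * ((repr y : U) psi + t * (E psi : R)) - k%:R * ((repr y : U) psi) \is a Num.int.
      by rewrite rpredB// rpredM// natr_int.
    have -> : k%:R * ((repr y : U) psi + t * (E psi : R)) - k%:R * ((repr y : U) psi) =
      t * ((E psi : R) * k%:R) :> R by ring.
    have [Ep|Ep] := ger0P (E psi : R); rewrite ?(ger0_norm Ep) ?(ltr0_norm Ep) in ek.
      by rewrite ek.
    have -> : (E psi : R) * k%:R = - N%:R by rewrite -ek mulNr opprK.
    by rewrite mulrN rpredN.
  have /intrP[m em] := tN.
  have NZ0 : N%:Z != 0 by lia.
  apply/mapP; exists `|(m %% N%:Z)%Z|%N.
    rewrite mem_iota add0n /=; have := modz_ge0 m NZ0.
    by have := @ltz_pmod m N%:Z; lia.
  apply/eqP/torus_eqP => c Gc; rewrite add_lfunE opp_lfunE !lin.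
  have et' : t = m%:~R / N%:R by rewrite -em mulfK.
  have ei : (`|(m %% N%:Z)%Z|%N%:R : R) = (m %% N%:Z)%Z%:~R.
    by rewrite pmulrn (gez0_abs (modz_ge0 m NZ0)).
  have em' : m%:~R = (m %/ N%:Z)%Z%:~R * N%:R + (m %% N%:Z)%Z%:~R :> R.
    by rewrite {1}(divz_eq m N%:Z) rmorphD rmorphM/= pmulrn.
  have -> : (repr y : U) c + t * (E c : R) - ((repr y : U) c +
      `|(m %% N%:Z)%Z|%N%:R / N%:R * (E c : R)) = (m %/ N%:Z)%Z%:~R * (E c : R) :> R.
    rewrite et' ei em' mulrDl mulfK// opprD addrACA subrr add0r -mulrBl.
    by rewrite addrK.
  by rewrite rpredM ?intr_int// E_int.
Qed.

End CosetSum.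

(** * Recurrences satisfied by Para *)

Section ParaProperties.
Variables (R : realType) (V : vectType R) (G : set V).
Local Notation C := R[i].
Local Notation U := 'Hom(V, R^o).
Local Open Scope complex_scope.
Variables (W : {vspace V}) (E : U).
Hypothesis WE : forall a, a \in W <-> (E a : R) = 0.
Hypothesis G0 : G 0.
Hypothesis GD : forall a b, G a -> G b -> G (a + b).
Hypothesis GN : forall a, G a -> G (- a).
Hypothesis E_int : forall a, G a -> (E a : R) \is a Num.int.
Hypothesis E_one : exists2 a, G a & (E a : R) = 1.
Variables (Q : quasipoly G) (l : seq V).
Local Notation ev := (fun a : V => (E a : R)).
Hypothesis al : admissible ev G l.

Lemma diff_sum (I : Type) (s : seq I) (F : I -> V -> C) k a :
  diff k (fun b => \sum_(i <- s) F i b) a = \sum_(i <- s) diff k (F i) a.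
Proof. by elim: k a => //= psi k IH a; rewrite !IH -sumrB. Qed.

Lemma diff_phase_sum P N (y : U) k a : transverse E k -> diff k (phase_sum E P N y k) a = 0.
Proof.
elim: k a => [|psi k IH] a tk.
  by rewrite /= /phase_sum big1// => i _; exact: kernel_residue_nil.
have step (f : V -> C) b : diff (psi :: k) f b = diff k (fun c => f c - f (c + - psi)) b.
  by rewrite diffB diff_translate.
rewrite step.
have -> : (fun b => phase_sum E P N y (psi :: k) b - phase_sum E P N y (psi :: k) (b + - psi)) =
    phase_sum E P N y k.
  apply/funext => b; rewrite /phase_sum -sumrB; apply: eq_bigr => i _; exact: kernel_residue_diff.
exact: IH (transverse_cons tk).2.
Qed.

Lemma recurrent_phase_sum P N (y : U) k g : transverse E k -> (E g : R) = 0 ->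
  recurrent g (phase_sum E P N y k).
Proof.
move=> tk Eg; apply: recurrent_sum => i.
apply: (recurrent_iter (phase_neq0 _)) => a; exact: (kernel_residue_annihilated _ _ _ Eg tk).
Qed.

(** Each term e_y Q_y is the value of a kernel with an empty list, and is
annihilated along every direction by a power of the shift minus e_y(g). *)
Lemma recurrent_qeval (T : quasipoly G) g : recurrent g (qeval T).
Proof.
have -> : qeval T = fun a => \sum_(y <- finmap.enum_fset (fset_set [set y | T y != 0]))
    phase ((repr y : U) a : R) * poly_eval (T y) a.
  apply/funext => a; rewrite /qeval.
  rewrite (fsbigTE (fset_set [set y | T y != 0]))// => y.
  rewrite in_fset_set; last exact: (qcoef_finite T).
  rewrite notin_setE /= => /negP; rewrite negbK => /eqP ->.
  by rewrite /poly_eval meval0 mulr0.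
apply: recurrent_sum => y; pose u : U := repr y.
apply: (@recurrent_iter _ _ g (phase (u g : R)) (pdeg (T y)) _ (phase_neq0 _)) => a.
have g0 : ((0 : U) g : R) = 0 by rewrite lfunE.
have off : offpole 0 u [::] (0 : C) by [].
have := @kernel_value_annihilated _ _ 0 (T y) u g [::] 0 a g0 off.
have -> : (fun b => kernel_value 0 (T y) u [::] b 0) = (fun b => phase (u b : R) * poly_eval (T y) b).
  apply/funext => b; rewrite (kernel_valueE _ _ off) /= /lift_char mulr0 cexp0 mulr1.
  by rewrite polyD_expr_Exp.
exact.
Qed.

(** Para is a sum over the support of Q of sums of residues over cosets. The
last clause combines the strip of each term: above -E(pos_part l) and up to the
lower edge, Para vanishes except on the edge, where it copies Q. *)
Lemma Para_recurrence : l != [::] -> exists P : V -> C,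
  [/\ forall a, G a -> Para W Q l E a = P a,
      forall a, diff l P a = 0,
      forall g, (E g : R) = 0 -> recurrent g P &
      forall a, G a -> - (E (pos_part ev l) : R) < (E a : R) ->
        (E (a + neg_part ev l) : R) <= 0 ->
        P a = ((E (a + neg_part ev l) : R) == 0)%:R *
          ((-1) ^+ neg_count ev l * qeval Q (a + neg_part ev l))].
Proof.
move=> l0; set S := fset_set [set y | Q y != 0].
have inS y : (y \in S) = (Q y != 0).
  rewrite in_fset_set; last exact: (qcoef_finite Q).
  by apply/idP/idP => [/set_mem//|h]; exact: mem_set.
have Gl psi : psi \in l -> G psi by move=> /al[].
have : forall y : torus G, exists N : nat, Q y != 0 -> (0 < N)%N /\ commensurable E N (repr y) l.
  move=> y; have [Qy|Qy] := boolP (Q y != 0); last by exists 0%N.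
  have [n yn] := qcoef_torsion Qy.
  by have [N N0 cN] := commensurable_exists E_int yn al; exists N.
move=> /choice[N hN].
have tl : transverse E l by move=> psi /al[].
pose P a := \sum_(y <- finmap.enum_fset S) phase_sum E (Q y) (N y) (repr y) l a.
have qevalE a : qeval Q a = \sum_(y <- finmap.enum_fset S)
    phase ((repr y : U) a : R) * poly_eval (Q y) a.
  rewrite /qeval (fsbigTE S)// => y; rewrite inS negbK => /eqP ->.
  by rewrite /poly_eval meval0 mulr0.
exists P; split.
- move=> a Ga; rewrite /Para (fsbigTE S).
    rewrite /P big_seq [RHS]big_seq; apply: eq_bigr => y; rewrite inS => Qy.
    have [N0 cN] := hN y Qy; exact: coset_sum.
  move=> y; rewrite inS negbK => /eqP Qy; apply: fsbig1 => g _; rewrite Qy.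
  have -> : (fun z : C => polyD 0 (para_kernel l E a (repr g) z) 0) = fun=> 0.
    by apply/funext => z; rewrite /polyD msupp0 big_nil.
  exact: residue0_0.
- by move=> a; rewrite /P diff_sum big1// => y _; exact: diff_phase_sum.
- by move=> g Eg; apply: recurrent_sum => y; exact: recurrent_phase_sum.
move=> a Ga lo hi; rewrite qevalE !mulr_sumr /P big_seq [RHS]big_seq.
apply: eq_bigr => y; rewrite inS => Qy; have [N0 cN] := hN y Qy.
have std : standard E (N y) (repr y) [::] by [].
have sz : (0 < size l + size ([::] : seq V))%N by rewrite addn0 lt0n size_eq0.
have lo' : - ((size ([::] : seq V))%:R * (N y)%:R) - (E (pos_part ev l) : R) < (E a : R).
  by rewrite mul0r oppr0 add0r.
have := @phase_sum_wall _ _ E (Q y) (N y) (repr y) N0 l [::] a cN std sz (E_int Ga) lo' hi.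
by rewrite cats0.
Qed.

End ParaProperties.

(** * Differences of the partition function *)

Section PartitionCounts.
Local Arguments partitions {R V} Phi a _.
Variables (R : realType) (V : vectType R).
Local Notation C := R[i].
Local Notation U := 'Hom(V, R^o).
Local Open Scope complex_scope.
Implicit Types (s : seq V) (a phi : V) (u : U).

Definition positive u s := forall phi, phi \in s -> 0 < (u phi : R).

Lemma positive_cons u phi s : positive u (phi :: s) -> 0 < (u phi : R) /\ positive u s.
Proof.
by move=> h; split=> [|psi ps]; apply: h; rewrite inE ?eqxx// ps orbT.
Qed.

Lemma pairing_partition u s (n : {ffun 'I_(size s) -> nat}) :
  (u (\sum_(i < size s) s`_i *+ n i) : R) = \sum_(i < size s) (n i)%:R * (u s`_i : R).
Proof.
rewrite linear_sum; apply: eq_bigr => i _.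
by rewrite mulr_natl; exact: linearMn.
Qed.

Lemma partition_term_ge0 u s (n : {ffun 'I_(size s) -> nat}) i : positive u s ->
  0 <= (n i)%:R * (u s`_i : R).
Proof. by move=> us; rewrite mulr_ge0// ltW// us// mem_nth. Qed.

Lemma partitions_neg u s a : positive u s -> (u a : R) < 0 -> partitions s a = set0.
Proof.
move=> us ua; apply/seteqP; split=> // n /= na; move: ua.
rewrite -na pairing_partition ltNge => /negP; apply; apply: sumr_ge0 => i _.
exact: partition_term_ge0.
Qed.

Lemma kfun_neg u s a : positive u s -> (u a : R) < 0 -> kfun s a = 0%N.
Proof. by move=> us ua; rewrite /kfun (partitions_neg us ua) fset_set0. Qed.

Lemma partitions_finite u s a : positive u s -> finite_set (partitions s a).
Proof.
move=> us.
have [B hB] : exists B : nat, forall i : 'I_(size s), (u a : R) < B%:R * (u s`_i : R).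
  pose b (i : 'I_(size s)) := Num.Def.archi_bound (`|u a : R| / (u s`_i : R)).
  exists (\max_i b i)%N => i; have ui : 0 < (u s`_i : R) by rewrite us// mem_nth.
  rewrite -ltr_pdivrMr//; apply: (@le_lt_trans _ _ (`|u a : R| / (u s`_i : R))).
    by rewrite ler_pM2r ?invr_gt0// ler_norm.
  apply: lt_le_trans (archi_boundP _) _; first by rewrite divr_ge0// ltW.
  by rewrite ler_nat (leq_bigmax i).
pose f (m : {ffun 'I_(size s) -> 'I_B.+1}) : {ffun 'I_(size s) -> nat} :=
  [ffun i => nat_of_ord (m i)].
apply: (@sub_finite_set _ _ (f @` setT)); last exact: finite_image.
move=> n /= na; exists [ffun i => inord (n i)] => //; apply/ffunP => i.
rewrite !ffunE inordK// ltnS -(ler_nat R).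
have ui : 0 < (u s`_i : R) by rewrite us// mem_nth.
rewrite -(ler_pM2r ui); apply: le_trans (ltW (hB i)).
rewrite -na pairing_partition (bigD1 i)//= lerDl; apply: sumr_ge0 => j _.
exact: partition_term_ge0.
Qed.

Lemma card_fset_image (S T : choiceType) (f : S -> T) (A : set S) : injective f ->
  finite_set A -> #|` fset_set (f @` A)| = #|` fset_set A|.
Proof.
move=> fi fA; rewrite fset_set_image//; apply/eqP/card_in_imfsetP => x y _ _.
exact: fi.
Qed.

(** Partitions of a either use phi or not. *)
Lemma kfun_cons u phi s a : positive u (phi :: s) ->
  kfun (phi :: s) a = (kfun (phi :: s) (a - phi) + kfun s a)%N.
Proof.
move=> us; have [up us'] := positive_cons us.
pose pad (n : {ffun 'I_(size s) -> nat}) : {ffun 'I_(size (phi :: s)) -> nat} :=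
  [ffun i : 'I_(size s).+1 => if unlift ord0 i is Some j then n j else 0%N].
pose bump0 (n : {ffun 'I_(size (phi :: s)) -> nat}) : {ffun 'I_(size (phi :: s)) -> nat} :=
  [ffun i : 'I_(size s).+1 => if unlift ord0 i is Some j then n i else (n i).+1].
have padi : injective pad.
  move=> m n /ffunP h; apply/ffunP => j; have := h (lift ord0 j).
  by rewrite !ffunE liftK.
have bumpi : injective bump0.
  move=> m n /ffunP h; apply/ffunP => j; have := h j; rewrite !ffunE.
  by case: unliftP => // _ [].
have sumS (n : {ffun 'I_(size (phi :: s)) -> nat}) :
  \sum_(i < size (phi :: s)) (phi :: s)`_i *+ n i =
  phi *+ n ord0 + \sum_(i < size s) s`_i *+ n (lift ord0 i).
  by rewrite big_ord_recl.
have eU : partitions (phi :: s) a =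
    (bump0 @` partitions (phi :: s) (a - phi)) `|` (pad @` partitions s a).
  apply/seteqP; split=> n.
    rewrite /partitions /= => na; have [n0|n0] := posnP (n ord0).
      right; exists [ffun j => n (lift ord0 j)].
        rewrite /= -na sumS n0 mulr0n add0r.
        by apply: eq_bigr => i _; rewrite ffunE.
      apply/ffunP => i; rewrite !ffunE; case: unliftP => [j ->|->].
        by rewrite ffunE.
      by rewrite n0.
    left; exists [ffun i : 'I_(size s).+1 => if i == ord0 then (n i).-1 else n i].
      rewrite /= -na !sumS. rewrite ffunE eqxx.
      under eq_bigr => i _ do rewrite ffunE /=.
      by rewrite -{2}(prednK n0) mulrS addrAC [phi + _]addrC addrK.
    apply/ffunP => i; rewrite !ffunE; case: unliftP => [j ->|->].
      by [].
    by rewrite eqxx prednK.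
  case=> -[m]; rewrite /partitions /= => ma <-; rewrite sumS !ffunE unlift_none.
    under eq_bigr => i _ do rewrite ffunE liftK.
    by rewrite -[RHS](subrK phi) -ma sumS mulrS -addrA [RHS]addrC.
  rewrite mulr0n add0r -ma; apply: eq_bigr => i _.
  by rewrite ffunE liftK.
have f1 := partitions_finite (a - phi) us; have f2 := partitions_finite a us'.
have F1 : finite_set (bump0 @` partitions (phi :: s) (a - phi)) by exact: finite_image.
have F2 : finite_set (pad @` partitions s a) by exact: finite_image.
rewrite /kfun eU fset_setU// cardfsU !card_fset_image//.
have -> : (fset_set (bump0 @` partitions (phi :: s) (a - phi)) `&`
   fset_set (pad @` partitions s a))%fset = fset0.
  apply/fsetP => n; rewrite inE in_fset0 !in_fset_set//; apply/negbTE/negP.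
  move=> /andP[/set_mem[m _ <-] /set_mem[m' _ /ffunP/(_ ord0)]].
  by rewrite !ffunE unlift_none.
by rewrite cardfs0 subn0.
Qed.

Lemma kfun_nil a : kfun [::] a = (a == 0).
Proof.
rewrite /kfun; have [->|a0] := eqVneq a 0.
  have -> : partitions [::] (0 : V) = setT.
    by apply/seteqP; split=> // n _; exact: big_ord0.
  have -> : [set: {ffun 'I_(@size V [::]) -> nat}] = [set [ffun=> 0%N]].
    by apply/seteqP; split=> // n _ /=; apply/ffunP => -[].
  by rewrite fset_set1 cardfs1.
have -> : partitions [::] a = set0.
  by apply/seteqP; split=> // n /= e; move: a0; rewrite -e => /eqP; apply; exact: big_ord0.
by rewrite fset_set0 cardfs0.
Qed.

Definition kfunC s a : C := (kfun s a)%:R.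

Lemma kfunC_cons u phi s a :
  positive u (phi :: s) -> kfunC (phi :: s) a - kfunC (phi :: s) (a - phi) = kfunC s a.
Proof.
by move=> us; rewrite /kfunC (kfun_cons a us) natrD addrC addKr.
Qed.

End PartitionCounts.

Section WallReduction.
Variables (R : realType) (V : vectType R) (W : {vspace V}).
Local Notation C := R[i].
Local Notation U := 'Hom(V, R^o).
Implicit Types (s : seq V) (a phi : V) (u : U).

Definition wall_count s a : C := (a \in W)%:R * kfunC (seq_in W s) (vsproj W a).

Lemma seq_in_cons phi s :
  seq_in W (phi :: s) = if phi \in W then vsproj W phi :: seq_in W s else seq_in W s.
Proof. by rewrite /seq_in /=; case: (phi \in W). Qed.

Lemma seq_out_cons phi s :
  seq_out W (phi :: s) = if phi \in W then seq_out W s else phi :: seq_out W s.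
Proof. by rewrite /seq_out /=; case: (phi \in W). Qed.

Lemma positive_seq_in u s : positive u s -> positive (dual_restrict W u) (seq_in W s).
Proof.
move=> us w /mapP[phi]; rewrite mem_filter => /andP[pW ps] ->.
by rewrite dual_restrictE vsprojK// us.
Qed.

Lemma diff_neg u l (f : V -> C) a : positive u l ->
  (forall b, (u b : R) < 0 -> f b = 0) -> (u a : R) < 0 -> diff l f a = 0.
Proof.
elim: l a => [|psi l IH] a ul hf ua /=; first exact: hf.
have [up ul'] := positive_cons ul.
rewrite !IH ?subrr// linearB/=; set x := u a in ua *; set z := u psi in up *.
by move: x z ua up => x z ua up; rewrite subr_lt0 (lt_trans ua).
Qed.

Lemma opp_exchange (K : zmodType) (x y z w : K) :
  x - z - (y - w) = x - y - (z - w).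
Proof. by rewrite opprB opprD opprK !addrA [LHS]addrAC; congr (_ + _); rewrite addrAC. Qed.

(** Multiplying the generating series of the partitions by the product of the
1 - e^psi over the vectors outside W leaves the partitions into vectors of W. A
vector phi outside W is removed by the recursion of kfun_cons. If phi is in W,
both sides have the same first differences along phi, and both vanish far in
the direction of - phi. *)
Lemma diff_kfun u s a : positive u s -> diff (seq_out W s) (kfunC s) a = wall_count s a.
Proof.
elim: s a => [|phi s IH] a us.
  rewrite /= /wall_count /kfunC !kfun_nil -natrM mulnb; congr (nat_of_bool _)%:R.
  apply/eqP/andP => [->|[aW /eqP a0]]; first by rewrite mem0v linear0.
  by rewrite -(vsprojK aW) a0 linear0.
have [up us'] := positive_cons us.
rewrite seq_out_cons; case: (boolP (phi \in W)) => pW; last first.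
  have -> : wall_count (phi :: s) a = wall_count s a.
    by rewrite /wall_count seq_in_cons (negPf pW).
  rewrite -(IH a us') /=.
  have -> : kfunC s = (fun b => kfunC (phi :: s) b - kfunC (phi :: s) (b + - phi)).
    by apply/funext => b; rewrite (kfunC_cons _ us).
  by rewrite diffB diff_translate.
pose h := diff (seq_out W s) (kfunC (phi :: s)).
have uout : positive u (seq_out W s).
  by move=> psi; rewrite mem_filter => /andP[_]; exact: us'.
have h_step b : h b - h (b - phi) = wall_count s b.
  rewrite -(IH b us') /h -(diff_translate _ _ (- phi)) -diffB.
  by congr (diff _ _ b); apply/funext => c; rewrite (kfunC_cons _ us).
have uin := positive_seq_in us.
have t_step b : wall_count (phi :: s) b - wall_count (phi :: s) (b - phi) = wall_count s b.
  rewrite /wall_count; have -> : (b - phi \in W) = (b \in W) by rewrite rpredBr.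
  rewrite -mulrBr linearB/=; congr (_ * _).
  by move: uin; rewrite seq_in_cons pW => uin; rewrite (kfunC_cons _ uin).
(* Both sides have the same differences along phi. *)
have e_step b : h b - wall_count (phi :: s) b = h (b - phi) - wall_count (phi :: s) (b - phi).
  have e1 := h_step b; rewrite -t_step in e1.
  apply/eqP; rewrite -subr_eq0; apply/eqP; rewrite -[RHS](subrr (h b - h (b - phi))) {2}e1.
  by move: (h b) (h (b - phi)) (wall_count _ b) (wall_count _ (b - phi)); exact: opp_exchange.
have e_iter n : h a - wall_count (phi :: s) a =
    h (a - phi *+ n) - wall_count (phi :: s) (a - phi *+ n).
  elim: n => [|n IHn]; first by rewrite mulr0n subr0.
  by rewrite IHn e_step mulrSr opprD addrA.
have h_neg b : (u b : R) < 0 -> h b = 0.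
  by apply: diff_neg uout _ => c uc; rewrite /kfunC (kfun_neg us uc).
have t_neg b : (u b : R) < 0 -> wall_count (phi :: s) b = 0.
  move=> ub; rewrite /wall_count; case: (boolP (b \in W)) => bW; last exact: mul0r.
  have ub' : (dual_restrict W u (vsproj W b) : R) < 0 by rewrite dual_restrictE vsprojK.
  by rewrite /kfunC (kfun_neg uin ub') mulr0.
have [n un] : exists n, (u (a - phi *+ n) : R) < 0.
  exists (Num.Def.archi_bound (`|u a : R| / (u phi : R))).
  set n := Num.Def.archi_bound _.
  have hn : `|u a : R| / (u phi : R) < n%:R by rewrite archi_boundP// divr_ge0// ltW.
  have -> : (u (a - phi *+ n) : R) = (u a : R) - n%:R * (u phi : R).
    by rewrite linearB/= mulr_natl; congr (_ - _); exact: linearMn.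
  by rewrite subr_lt0; apply: le_lt_trans (ler_norm _) _; rewrite -ltr_pdivrMr.
have := e_iter n; rewrite (h_neg _ un) (t_neg _ un) subrr => /eqP.
by rewrite subr_eq0 => /eqP.
Qed.

End WallReduction.

(** * Segments, cones and chambers *)

Section Euclidean.
Variables (R : realType) (V : vectType R).
Local Notation U := 'Hom(V, R^o).
Implicit Types (v a : V) (f : U).

(** The topology is that of the coordinates, where the line is affine. *)
Lemma continuous_line a v : continuous (fun t : R => a + t *: v : euclidean V).
Proof.
apply: continuous_comp_initial => t A [P hP PA].
rewrite nbhs_filterE /=.
have h i j : \forall s \near t, P i j (coords (a + s *: v) i j).
  have c : continuous (fun s : R => coord (vbasis {:V}) j a + s * coord (vbasis {:V}) j v).
    move=> s; apply: cvgD; first exact: cvg_cst.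
    by apply: cvgM; [exact: cvg_id | exact: cvg_cst].
  have e s : coords (a + s *: v) i j = coord (vbasis {:V}) j a + s * coord (vbasis {:V}) j v.
    by rewrite mxE linearD linearZ.
  have := c t (P i j); rewrite nbhs_filterE /= => ct.
  have ht := hP i j; rewrite /= e in ht; apply: filterS (ct ht) => s /=; rewrite e.
  by [].
have : \forall s \near t, forall i j, P i j (coords (a + s *: v) i j).
  apply: (@filter_forall _ _ (fun i s => forall j, P i j (coords (a + s *: v) i j)) (nbhs t)) => i.
  by apply: (@filter_forall _ _ (fun j s => P i j (coords (a + s *: v) i j)) (nbhs t)) => j; exact: h.
by apply: filterS => s hs; apply: PA.
Qed.

Lemma continuous_functional f : continuous (fun v : euclidean V => f v : R).
Proof.
pose F (M : 'rV[R]_(\dim {:V})) : R := \sum_i M 0 i * (f (vbasis {:V})`_i : R).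
have cF : continuous F.
  rewrite /F; elim: (index_enum _) => [|i s IH].
    have -> : (fun M : 'rV[R]_(\dim {:V}) => \sum_(i <- [::]) M 0 i * (f (vbasis {:V})`_i : R)) = cst 0.
      by apply/funext => M; rewrite big_nil.
    exact: cst_continuous.
  have -> : (fun M : 'rV[R]_(\dim {:V}) => \sum_(j <- i :: s) M 0 j * (f (vbasis {:V})`_j : R)) =
      (fun M => M 0 i * (f (vbasis {:V})`_i : R) + \sum_(j <- s) M 0 j * (f (vbasis {:V})`_j : R)).
    by apply/funext => M; rewrite big_cons.
  move=> M; apply: (@continuousD R R^o _ (fun N : 'rV[R]_(\dim {:V}) => N 0 i * (f (vbasis {:V})`_i : R)));
    last exact: IH.
  by apply: continuousM; [exact: coord_continuous | exact: cst_continuous].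
have -> : (fun v : euclidean V => f v : R) = F \o (@coords R V : euclidean V -> _).
  apply/funext => v; rewrite /F /= {1}(coord_vbasis (memvf v)) linear_sum.
  by apply: eq_bigr => i _; rewrite mxE linearZ.
move=> v; apply: continuous_comp; [exact: initial_continuous | exact: cF].
Qed.

Lemma near_functional_gt0 f (v : euclidean V) : 0 < (f v : R) ->
  \forall w \near v, 0 < (f w : R).
Proof.
move=> fv; have := @continuous_functional f v [set x | 0 < x].
by apply; exact: lt_nbhsr.
Qed.

Lemma near_line (A : set (euclidean V)) a v : nbhs (a : euclidean V) A ->
  \forall t \near (0 : R), A (a + t *: v).
Proof.
move=> nA; apply: (@continuous_line a v 0); by rewrite scale0r addr0.
Qed.

End Euclidean.

Section Sides.
Variables (R : realType) (V : vectType R).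
Local Notation U := 'Hom(V, R^o).
Implicit Types (v w p q : V) (f : U) (L : seq U).

Lemma functional_line f p q (t : R) : (f (p + t *: q) : R) = (f p : R) + t * (f q : R).
Proof. by rewrite linearD linearZ. Qed.

Lemma functional_segment f p q (t : R) :
  (f (p + t *: (q - p)) : R) = (1 - t) * (f p : R) + t * (f q : R).
Proof. by rewrite functional_line linearB/= mulrBr mulrBl mul1r addrA addrAC. Qed.

Lemma convex_gt0 (t x y : R) : 0 <= t <= 1 -> 0 < x -> 0 < y -> 0 < (1 - t) * x + t * y.
Proof.
move=> /andP[t0 t1] x0 y0; have [->|tn] := eqVneq t 0; first by lra.
have {}tn : 0 < t by rewrite lt_neqAle eq_sym tn.
by rewrite ltr_wpDl// ?mulr_gt0// mulr_ge0 ?subr_ge0// ltW.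
Qed.

Definition side L w : set V := [set v | forall f, f \in L -> 0 < (f v : R) * (f w : R)].

Lemma side_self L w : (forall f, f \in L -> (f w : R) != 0) -> side L w w.
Proof. by move=> h f /h fw; rewrite -expr2 exprn_even_gt0. Qed.

Lemma side_segment L w p q (t : R) : 0 <= t <= 1 ->
  side L w p -> side L w q -> side L w (p + t *: (q - p)).
Proof.
move=> t01 sp sq f fL; rewrite functional_segment mulrDl -!mulrA.
by apply: convex_gt0 => //; [exact: sp | exact: sq].
Qed.

Lemma near_side L w v : side L w v -> nbhs (v : euclidean V) (side L w).
Proof.
elim: L => [|f L IH] sv; first by apply: filterS filterT => u _ f.
have s1 : side L w v by move=> g gL; apply: sv; rewrite inE gL orbT.
have fwE u : (((f w : R) *: f) u : R) = (f u : R) * (f w : R).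
  by rewrite scale_lfunE; exact: mulrC.
have s2 : 0 < (((f w : R) *: f) v : R).
  by rewrite fwE; apply: sv; rewrite inE eqxx.
apply: filterS (filterI (near_functional_gt0 (v := v) s2) (IH s1)) => u [/= u1 u2] g; rewrite inE => /predU1P[->|gL]; last exact: u2.
by move: u1; rewrite scale_lfunE mulrC.
Qed.

Lemma nbhs0_pos (A : set R) : (\forall t \near 0, A t) -> exists2 t : R, 0 < t & A t.
Proof.
move=> /nbhs_ballP[e /= e0 he]; exists (e / 2); first by rewrite divr_gt0.
apply: he; rewrite /ball /= sub0r normrN gtr0_norm ?divr_gt0//.
by rewrite ltr_pdivrMr// ltr_pMr// ltr1n.
Qed.

(** An open set is not covered by finitely many hyperplanes. *)
Lemma generic_point L (A : set (euclidean V)) : A° !=set0 ->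
  (forall f, f \in L -> exists v, (f v : R) != 0) ->
  exists2 w, A w & forall f, f \in L -> (f w : R) != 0.
Proof.
elim: L A => [|f L IH] A.
  by move=> [w /interior_subset Aw] _; exists w.
move=> [w Aw] hL; have [v fv] := hL f (mem_head _ _).
have [t [At ft]] : exists t : R, A° (w + t *: v) /\ (f (w + t *: v) : R) != 0.
  have [fw|fw] := eqVneq (f w : R) 0; last first.
    by exists 0; rewrite scale0r addr0.
  have [t t0 At] := nbhs0_pos (near_line v (nbhs_interior Aw)).
  exists t; split=> //; rewrite functional_line fw add0r mulf_neq0//.
  by rewrite gt_eqF.
have [|//|z [Az fz] hz] := IH (A `&` [set u | (f u : R) != 0]).
- exists (w + t *: v); apply: filterI => //.
  have st : side [:: f] (w + t *: v) (w + t *: v).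
    by apply: side_self => g; rewrite inE => /eqP ->.
  apply: filterS (near_side st) => u /(_ f (mem_head _ _)) /=.
  by case: eqP => // ->; rewrite mul0r ltxx.
- by move=> g gL; apply: hL; rewrite inE gL orbT.
by exists z => // g; rewrite inE => /predU1P[->|/hz].
Qed.

Lemma eventually_side (L : seq U) w (u : nat -> V) :
  (forall f, f \in L -> exists k0, forall k, (k0 <= k)%N -> 0 < (f (u k) : R) * (f w : R)) ->
  exists k0, forall k, (k0 <= k)%N -> side L w (u k).
Proof.
elim: L => [|f L IH] h; first by exists 0%N => k _ f.
have [n1 h1] := h f (mem_head _ _).
have [|n2 h2] := IH.
  by move=> g gL; apply: h; rewrite inE gL orbT.
exists (n1 + n2)%N => k nk g; rewrite inE => /predU1P[->|gL].
  by apply: h1; exact: leq_trans (leq_addr _ _) nk.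
by apply: h2 => //; exact: leq_trans (leq_addl _ _) nk.
Qed.

End Sides.

Section ChamberSegments.
Variables (R : realType) (V : vectType R).
Implicit Types (Phi : seq V) (c : set (euclidean V)) (p q : V).

Lemma chamberE Phi c p : chamber Phi c -> c p ->
  c = connected_component (~` cone_sing Phi) p.
Proof. by move=> [x _ ->] xp; exact: same_connected_component. Qed.

(** Chambers are connected components, and a segment is connected. *)
Lemma chamber_segment Phi c p q : chamber Phi c -> c p ->
  (forall t : R, 0 <= t <= 1 -> ~ cone_sing Phi (p + t *: (q - p))) -> c q.
Proof.
move=> cc cp hs; rewrite (chamberE cc cp).
pose line (t : R) : euclidean V := p + t *: (q - p).
pose A : set (euclidean V) := line @` `[0, 1].
have Ap : A p by exists 0; [rewrite /= in_itv/= lexx ler01 | rewrite /line scale0r addr0].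
have Aq : A q by exists 1; [rewrite /= in_itv/= lexx ler01 | rewrite /line scale1r addrC subrK].
have sub : A `<=` ~` cone_sing Phi.
  by move=> _ [t t01 <-]; apply: hs; move: t01; rewrite /= in_itv.
have cA : connected A.
  apply: (@connected_continuous_connected R (euclidean V) `[0, 1]%classic line).
    exact: segment_connected.
  by apply: (@continuous_subspaceT R (euclidean V)); exact: continuous_line.
exact: (@connected_component_max _ _ A p Ap sub cA q Aq).
Qed.

Lemma closure_meets c (v : V) (A : set (euclidean V)) : closure c v -> nbhs (v : euclidean V) A ->
  exists p, c p /\ A p.
Proof. by move=> cv /cv[p [? ?]]; exists p. Qed.

Lemma closure_line c (b v : V) : (forall A : set R, (\forall t \near 0, A t) ->
  exists2 t, A t & c (b + t *: v)) -> closure c b.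
Proof.
move=> h A nA; have [t At ct] := h _ (near_line v nA).
by exists (b + t *: v).
Qed.

Lemma cone_nil v : cone [::] (v : V) <-> v = 0.
Proof.
split=> [[t _ ->]|->]; first by rewrite big_ord0.
by exists (fun=> 0) => //; rewrite big_ord0.
Qed.

(** The form in which cones are handled by induction on their generators. *)
Lemma cone_cons phi s v : cone (phi :: s) (v : V) <->
  exists2 t : R, 0 <= t & cone s (v - t *: phi).
Proof.
split=> [[t t0 ->]|[t t0 [s' s0 e]]].
  exists (t ord0) => //; exists (fun i => t (lift ord0 i)) => [i|].
    exact: t0.
  by rewrite big_ord_recl addrC addKr.
exists (fun i : 'I_(size s).+1 => if unlift ord0 i is Some j then s' j else t).
  by move=> i; case: unliftP.
rewrite big_ord_recl unlift_none -[LHS](subrK (t *: phi)) e addrC; congr (_ + _).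
by apply: eq_bigr => i _; rewrite liftK.
Qed.

Lemma cone_subseq s1 s2 v : subseq s1 s2 -> cone s1 (v : V) -> cone s2 v.
Proof.
elim: s2 s1 v => [|phi s2 IH] [|psi s1] v //=.
- move=> _ /cone_nil ->; apply/cone_cons; exists 0 => //; rewrite scale0r subr0.
  by apply: (IH [::]); [exact: sub0seq | exact/cone_nil].
case: eqVneq => [->|_] sub.
  by move=> /cone_cons[t t0 ct]; apply/cone_cons; exists t => //; exact: IH ct.
move=> cv; apply/cone_cons; exists 0 => //; rewrite scale0r subr0.
exact: IH cv.
Qed.

Lemma cone_add_mem phi s v (t : R) : phi \in s -> 0 <= t -> cone s (v : V) ->
  cone s (v + t *: phi).
Proof.
move=> ps t0; elim: s v ps => // psi s IH v; rewrite inE => /predU1P[<-|ps] /cone_cons[u u0 cu];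
  apply/cone_cons.
  by exists (u + t); rewrite ?addr_ge0// scalerDl opprD addrACA subrr addr0.
by exists u => //; rewrite addrAC; exact: IH.
Qed.

Lemma cone_partition (phi : seq V) a n : (\sum_(i < size phi) phi`_i *+ n i) = a -> cone phi (a : V).
Proof.
move=> <-; exists (fun i => (n i)%:R) => [i|]; first exact: ler0n.
by apply: eq_bigr => i _; rewrite scaler_nat.
Qed.

Lemma cone_vanish f s v : (forall phi, phi \in s -> (f : 'Hom(V, R^o)) phi = 0) ->
  cone s (v : V) -> f v = 0.
Proof.
move=> h [t _ ->]; rewrite linear_sum big1// => i _.
by rewrite linearZ/= h ?mem_nth// scaler0.
Qed.

Lemma cone_span s v : cone s (v : V) -> v \in << s >>%VS.
Proof.
by move=> [t _ ->]; apply: memv_suml => i _; apply: memvZ; apply: memv_span; exact: mem_nth.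
Qed.

Lemma kfun_ext Phi a : c_ext Phi (a : V) -> kfun Phi a = 0%N.
Proof.
move=> na; rewrite /kfun (_ : partitions a = set0) ?fset_set0//.
by apply/seteqP; split=> // n /= /cone_partition.
Qed.

End ChamberSegments.

(** * A generic point of the common wall *)

Section TestFunctionals.
Variables (R : realType) (V : vectType R) (W : {vspace V}).
Local Notation U := 'Hom(V, R^o).
Implicit Types (v w : V) (f : U) (L : seq U) (nu Phi : seq V).

Definition basis_coord nu (i : 'I_(size nu)) : U :=
  linfun (coord (in_tuple nu) i : V -> R^o).

Lemma basis_coordE nu i v : (basis_coord (nu := nu) i v : R) = coord (in_tuple nu) i v.
Proof. by rewrite lfunE. Qed.

(** Either a functional of L, which proper_on_wall makes nonzero on W, shows
that the span of nu does not contain W, or nu is a basis of W whose coordinates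
are in L. *)
Definition tested L nu :=
  (exists2 f, f \in L & forall phi, phi \in nu -> (f phi : R) = 0) \/
  [/\ W = <<nu>>%VS, free nu & forall i, basis_coord (nu := nu) i \in L].

Definition proper_on_wall L := forall f, f \in L -> exists2 v, v \in W & (f v : R) != 0.

Lemma tested_sub L1 L2 nu : {subset L1 <= L2} -> tested L1 nu -> tested L2 nu.
Proof.
move=> s12 [[f fL hf]|[h1 h2 h3]]; first by left; exists f => //; exact: s12.
by right; split=> // i; exact: s12.
Qed.

(** Some coordinate of the component of v in a complement of S. *)
Lemma separating_functional (S : {vspace V}) v : v \notin S ->
  exists2 f : U, forall s, s \in S -> (f s : R) = 0 & (f v : R) != 0.
Proof.
move=> vS; have gv : v - projv S v != 0.
  by apply: contraNneq vS => /eqP; rewrite subr_eq0 => /eqP ->; exact: memv_proj.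
have /existsP[i hi] : [exists i, coord (vbasis {:V}) i (v - projv S v) != 0].
  apply: contraNT gv; rewrite negb_exists => /forallP h.
  rewrite (coord_vbasis (memvf (v - projv S v))) big1// => i _.
  by move: (h i); rewrite negbK => /eqP ->; rewrite scale0r.
pose g : U := linfun (coord (vbasis {:V}) i : V -> R^o).
exists (g \o (\1 - projv S))%VF => [s sS|].
  by rewrite comp_lfunE add_lfunE opp_lfunE id_lfunE projv_id// subrr linear0.
by rewrite comp_lfunE add_lfunE opp_lfunE id_lfunE lfunE.
Qed.

(** A list nu of at most dim W vectors whose span contains W is a basis of
W. *)
Lemma tested_exists1 nu : (size nu <= \dim W)%N ->
  exists2 L, proper_on_wall L & tested L nu.
Proof.
move=> sz; have [Wnu|/subvPn[v vW vnu]] := boolP (W <= <<nu>>)%VS; last first.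
  have [f f0 fv] := separating_functional vnu.
  exists [:: f]; first by move=> g; rewrite inE => /eqP ->; exists v.
  by left; exists f; rewrite ?mem_head// => phi pnu; apply: f0; exact: memv_span.
have dnu : (\dim <<nu>> <= size nu)%N by exact: dim_span.
have eW : W = <<nu>>%VS by apply/eqP; rewrite eqEdim Wnu (leq_trans dnu).
have fnu : free nu by rewrite /free eqn_leq dnu -eW.
exists [seq basis_coord (nu := nu) i | i <- enum 'I_(size nu)]; last first.
  by right; split=> // i; apply: map_f; rewrite mem_enum.
move=> f /mapP[i _ ->]; exists nu`_i.
  by rewrite eW memv_span// mem_nth.
by rewrite basis_coordE (coord_free (X := in_tuple nu)) ?eqxx ?oner_eq0.
Qed.

Lemma test_functionals Phi n : (n <= \dim W)%N -> exists2 L, proper_on_wall L &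
  forall nu, subseq nu Phi -> (size nu <= n)%N -> tested L nu.
Proof.
move=> nW; suff [L pL tL] : exists2 L, proper_on_wall L &
    forall nu, nu \in [seq mask (val m) Phi | m <- enum {: (size Phi).-tuple bool}] ->
      (size nu <= n)%N -> tested L nu.
  exists L => // nu /subseqP[m sm ->]; apply: tL; apply/mapP.
  by exists (tcast sm (in_tuple m)); [rewrite mem_enum | rewrite /= val_tcast].
elim: [seq _ | m <- _] => [|nu N [L pL tL]]; first by exists [::].
have [sn|sn] := leqP (size nu) n; last first.
  exists L => // mu; rewrite inE => /predU1P[->|]; last exact: tL.
  by rewrite leqNgt sn.
have [L' pL' tL'] := tested_exists1 (leq_trans sn nW).
exists (L' ++ L) => [f|mu]; first by rewrite mem_cat => /orP[/pL'|/pL].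
rewrite inE => /predU1P[-> _|mN smu].
  by apply: tested_sub tL' => f; rewrite mem_cat => ->.
by apply: tested_sub (tL mu mN smu) => f; rewrite mem_cat orbC => ->.
Qed.

End TestFunctionals.

Section WallGeometry.
Variables (R : realType) (V : vectType R) (G : set V) (Phi : seq V) (W : {vspace V}).
Variables (E : 'Hom(V, R^o)) (c1 c2 : set (euclidean V)) (c12 : set (euclidean (subvs_of W))).
Local Notation U := 'Hom(V, R^o).
Hypothesis G0 : G 0.
Hypothesis GD : forall a b, G a -> G b -> G (a + b).
Hypothesis GPhi : forall phi, phi \in Phi -> G phi.
Hypothesis wallW : wall Phi W.
Hypothesis WE : forall a, a \in W <-> (E a : R) = 0.
Hypothesis ch1 : chamber Phi c1.
Hypothesis ch2 : chamber Phi c2.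
Hypothesis adj : adjacent_along W Phi E c1 c2.
Hypothesis Phi_pos : exists2 phi, phi \in Phi & 0 < (E phi : R).
Hypothesis ch12 : chamber (seq_in W Phi) c12.
Hypothesis closure12 : common_wall W c1 c2 `<=` closure c12.

Let dimW : (\dim W).+1 = \dim {:V}.
Proof. by have [nu [_ <- /eqP <- <-]] := wallW. Qed.

Let generic_wall_point : exists L w, [/\ w \in W, closure c1 w /\ closure c2 w,
  closure c12 (vsproj W w),
  (forall nu, subseq nu Phi -> (size nu < \dim {:V})%N -> tested W L nu) &
  forall f, f \in L -> (f w : R) != 0].
Proof.
have [L pL tL] := test_functionals Phi (leqnn (\dim W)).
have [_ _ cw] := adj.
have [|w [w1 w2] hw] := generic_point (L := [seq dual_restrict W f | f <- L]) cw.
  move=> _ /mapP[f /pL[v vW fv] ->]; exists (vsproj W v).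
  by rewrite dual_restrictE vsprojK.
exists L, (vsval w); split=> //.
- exact: subvsP.
- by rewrite vsvalK; apply: closure12; split.
- by move=> nu sub; rewrite -dimW ltnS; exact: tL.
by move=> f fL; rewrite -dual_restrictE; apply: hw; exact: map_f.
Qed.

Section TestCone.
Variables (L : seq U) (w : V).
Hypothesis wW : w \in W.
Hypothesis w1 : closure c1 w.
Hypothesis w2 : closure c2 w.
Hypothesis w12 : closure c12 (vsproj W w).
Hypothesis tL : forall nu, subseq nu Phi -> (size nu < \dim {:V})%N -> tested W L nu.
Hypothesis Lw : forall f, f \in L -> (f w : R) != 0.

(** A basis of W taken from Phi with w in the interior of its cone. *)
Definition positive_basis nu := [/\ subseq nu Phi, W = <<nu>>%VS, free nu &
  forall i, basis_coord (nu := nu) i \in L /\ 0 < (basis_coord (nu := nu) i w : R)].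

(** A functional vanishing on nu cannot have the sign of w at a point of its
cone. So only the bases of W are left, and a point of the cone of such a basis
has the coordinates of w up to positive factors. *)
Lemma side_sing v : side L w v -> cone_sing Phi v ->
  v \in W /\ exists nu, positive_basis nu.
Proof.
move=> sv [nu [sub sz cv]].
have [[f fL f0]|[eW fnu cL]] := tL sub sz.
  by have := sv f fL; rewrite (cone_vanish f0 cv) mul0r ltxx.
split; first by rewrite eW; exact: cone_span cv.
exists nu; split=> // i; split; first exact: cL.
have := sv _ (cL i); case: cv => t t0 ->.
rewrite !basis_coordE (coord_sum_free (X := in_tuple nu) _ _ fnu) => h.
have ti : 0 < t i.
  by rewrite lt_neqAle t0 andbT eq_sym; apply: contraTneq h => ->; rewrite mul0r ltxx.
by move: h; rewrite pmulr_rgt0.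
Qed.

Let meets (c : set (euclidean V)) : closure c w -> exists p, c p /\ side L w p.
Proof.
move=> cw; apply: (closure_meets cw); apply: near_side; exact: side_self.
Qed.

(** Without such a basis no singular cone would meet the open set of points on
the side of w, which is convex. As c1 comes close to w, it would contain w, and
E would be positive at w. *)
Lemma positive_basis_exists : exists nu, positive_basis nu.
Proof.
apply: contrapT => h; have [p [cp sp]] := meets w1.
have : c1 w.
  apply: (chamber_segment ch1 cp) => t t01 sing; apply: h.
  by have [] := side_sing (side_segment t01 sp (side_self Lw)) sing.
have [E1 _ _] := adj; move=> /E1; rewrite (proj1 (WE w) wW) ltxx.
by [].
Qed.

Lemma side_wall_cone nu v : positive_basis nu -> side L w v -> v \in W -> cone nu (v : V).
Proof.
move=> [_ eW fnu hL] sv; rewrite eW => vnu.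
exists (fun i => (basis_coord (nu := nu) i v : R)) => [i|].
  have [iL iw] := hL i; have := sv _ iL.
  by rewrite pmulr_lgt0// => /ltW.
rewrite {1}(coord_span (X := in_tuple nu) vnu); apply: eq_bigr => i _.
by rewrite basis_coordE.
Qed.

Lemma side_wall_inner v : side L w v -> v \in W -> cone Phi (v : V).
Proof.
move=> sv vW; have [nu pnu] := positive_basis_exists; have [sub _ _ _] := pnu.
exact: cone_subseq sub (side_wall_cone pnu sv vW).
Qed.

(** A functional f that vanishes on the wall and is positive at p and q keeps
the segment between them away from the wall, hence from the singular cones. *)
Lemma side_chamber (f : U) c p q : chamber Phi c -> c p -> side L w p -> side L w q ->
  (forall v, (f v : R) != 0 -> v \notin W) -> 0 < (f p : R) -> 0 < (f q : R) -> c q.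
Proof.
move=> cc cp sp sq fW fp fq; apply: (chamber_segment cc cp) => t t01 sing.
have [+ _] := side_sing (side_segment t01 sp sq) sing.
by apply/negP/fW; rewrite functional_segment gt_eqF// convex_gt0.
Qed.

Let Epos v : (E v : R) != 0 -> v \notin W.
Proof. by move=> Ev; apply/negP => /WE /eqP; rewrite (negPf Ev). Qed.

Lemma side_pos v : side L w v -> 0 < (E v : R) -> c1 v.
Proof.
move=> sv Ev; have [p [cp sp]] := meets w1; have [E1 _ _] := adj.
exact: side_chamber ch1 cp sp sv Epos (E1 p cp) Ev.
Qed.

Lemma side_push v : side L w v -> exists2 phi, [/\ phi \in Phi & 0 < (E phi : R)] &
  forall A : set R, (\forall t \near 0, A t) ->
    exists t, [/\ 0 < t, A t & side L w (v + t *: phi)].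
Proof.
move=> sv; have [phi pPhi Ephi] := Phi_pos; exists phi => // A nA.
have [t t0 [At st]] := nbhs0_pos (filterI nA (near_line phi (near_side sv))).
by exists t.
Qed.

(** A vector of Phi on the positive side, added to a point of W in the cone,
gives a point of the cone in c1. *)
Lemma c1_inner : c1 <> c_ext Phi.
Proof.
move=> c1e; have [phi [pPhi Ephi] push] := side_push (side_self Lw).
have [t [t0 _ st]] := push setT filterT.
have : c1 (w + t *: phi).
  apply: side_pos => //; rewrite functional_line (proj1 (WE w) wW) add0r.
  exact: mulr_gt0.
rewrite c1e; apply; apply: cone_add_mem => //; first exact: ltW.
by apply: side_wall_inner => //; exact: side_self.
Qed.

(** When c2 is the exterior chamber, a point p of c2 on the side of w is not in
the cone, so it is not on the wall, nor above it where it would belong to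
c1. *)
Lemma side_neg v : side L w v -> (E v : R) < 0 -> c2 v.
Proof.
move=> sv Ev; have [p [cp sp]] := meets w2; have [_ E2 _] := adj.
suff Ep : (E p : R) < 0.
  apply: (side_chamber (f := - E) ch2 cp sp sv); rewrite ?opp_lfunE ?oppr_gt0//.
  by move=> u; rewrite opp_lfunE oppr_eq0; exact: Epos.
case: E2 => [|c2e]; first exact.
have pext : ~ cone Phi p by move: cp; rewrite c2e.
case: (ltrgtP (E p : R) 0) => // Ep; last first.
  by case: pext; apply: side_wall_inner => //; apply/WE.
case: c1_inner; rewrite (chamberE ch1 (side_pos sp Ep)) -c2e.
by rewrite -(chamberE ch2 cp).
Qed.

(** A point of the wall is approached from above along a vector of Phi. *)
Lemma side_closure v : side L w v -> 0 <= (E v : R) -> closure c1 v.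
Proof.
move=> sv; rewrite le_eqVlt => /predU1P[Ev|Ev]; last first.
  by apply: subset_closure; exact: side_pos.
have [phi [pPhi Ephi] push] := side_push sv; apply: (@closure_line _ _ _ _ phi) => A nA.
have [t [t0 At st]] := push A nA; exists t => //; apply: side_pos => //.
by rewrite functional_line -Ev add0r mulr_gt0.
Qed.

Let side_in (v : subvs_of W) : side L w (vsval v) ->
  side [seq dual_restrict W f | f <- L] (vsproj W w) v.
Proof.
move=> sv _ /mapP[f fL ->]; rewrite !dual_restrictE vsprojK//; exact: sv.
Qed.

(** A singular cone of the vectors in W is generated by fewer than dim W
vectors, so that a functional of L vanishes on it. *)
Lemma side_not_sing_in (v : subvs_of W) : side L w (vsval v) -> ~ cone_sing (seq_in W Phi) v.
Proof.
move=> sv [nu [sub sz [t t0 ev]]].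
have szn : (size nu < \dim W)%N.
  by apply: leq_trans sz _; rewrite dimvf.
have sub' : subseq (map vsval nu) Phi.
  have /subseqP[m sm ->] := sub; rewrite /seq_in -map_mask -map_comp.
  set s := [seq phi <- Phi | _]; have -> : [seq (vsval \o vsproj W) i | i <- mask m s] = mask m s.
    rewrite -[RHS]map_id; apply/eq_in_map => phi /mem_mask.
    by rewrite mem_filter => /andP[pW _]; exact: vsprojK.
  exact: subseq_trans (mask_subseq _ _) (filter_subseq _ _).
have sz' : (size (map vsval nu) < \dim {:V})%N.
  by rewrite size_map -dimW ltnS ltnW.
have [[f fL f0]|[eW _ _]] := tL sub' sz'; last first.
  have := dim_span (map vsval nu); rewrite -eW size_map leqNgt => /negP; apply.
  exact: szn.
have := sv f fL; suff -> : (f (vsval v) : R) = 0 by rewrite mul0r ltxx.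
rewrite ev !linear_sum big1// => i _; rewrite !linearZ/= f0 ?scaler0//.
by apply: map_f; exact: mem_nth.
Qed.

Lemma side_in_c12 v : side L w v -> v \in W -> c12 (vsproj W v).
Proof.
move=> sv vW; have sw := side_self Lw.
have near12 : nbhs (vsproj W w : euclidean (subvs_of W))
    (side [seq dual_restrict W f | f <- L] (vsproj W w)).
  by apply: near_side; apply: side_in; rewrite vsprojK.
have [p [cp sp]] := closure_meets w12 near12.
have sp' : side L w (vsval p).
  by move=> f fL; have := sp _ (map_f _ fL); rewrite !dual_restrictE vsprojK.
apply: (chamber_segment ch12 cp) => t t01; apply: side_not_sing_in.
by rewrite linearD linearZ linearB/= vsprojK//; exact: side_segment.
Qed.

Lemma c12_inner : c12 <> c_ext (seq_in W Phi).
Proof.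
move=> ce; have sw := side_self Lw.
have : c12 (vsproj W w) by exact: side_in_c12.
rewrite ce; apply; have [nu pnu] := positive_basis_exists; have [sub eW _ _] := pnu.
have [t t0 ew] := side_wall_cone pnu sw wW.
have nuW i : nu`_i \in W.
  have [si|si] := ltnP i (size nu); last by rewrite nth_default// mem0v.
  by rewrite eW memv_span// mem_nth.
apply: (@cone_subseq _ _ (map (vsproj W) nu)).
  apply: map_subseq; rewrite subseq_filter sub andbT; apply/allP => phi pnu'.
  by rewrite eW memv_span.
have sz : size (map (vsproj W) nu) = size nu by rewrite size_map.
exists (fun i => t (cast_ord sz i)) => [i|]; first exact: t0.
rewrite ew linear_sum (reindex (cast_ord sz)) /=; last first.
  by exists (cast_ord (esym sz)) => i _; rewrite ?cast_ordK ?cast_ordKV.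
by apply: eq_bigr => i _; rewrite linearZ/= (nth_map 0)// -sz.
Qed.

(** Rounding down the coordinates of n w in a positive basis changes it by a
bounded amount, so that it remains on the side of w for large n. *)
Lemma lattice_direction : exists g, [/\ G g, g \in W & side L w g].
Proof.
have [nu [sub eW fnu hL]] := positive_basis_exists.
pose x i : R := basis_coord (nu := nu) i w.
have x0 i : 0 < x i by have [] := hL i.
pose g n : V := \sum_(i < size nu) nu`_i *+ Num.trunc (n%:R * x i).
have ew : w = \sum_i x i *: nu`_i.
  rewrite {1}(coord_span (X := in_tuple nu) (_ : w \in _)) -?eW//.
  by apply: eq_bigr => i _; rewrite /x basis_coordE.
have [n0 hn] : exists n0, forall n, (n0 <= n)%N -> side L w (g n).
  apply: eventually_side => f fL.
  (* M bounds the effect of rounding on f. *)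
  pose M := \sum_(i < size nu) `|(f nu`_i : R)|.
  have fw := Lw fL.
  exists (Num.Def.archi_bound (M / `|f w : R|)) => n nn.
  have nM : M < n%:R * `|f w : R|.
    rewrite -ltr_pdivrMr ?normr_gt0//; apply: lt_le_trans (archi_boundP _) _.
      by rewrite divr_ge0// sumr_ge0.
    by rewrite ler_nat.
  have dM : `|(f (g n) : R) - n%:R * (f w : R)| <= M.
    have -> : (f (g n) : R) - n%:R * (f w : R) =
        \sum_(i < size nu) ((Num.trunc (n%:R * x i))%:R - n%:R * x i) * (f nu`_i : R).
      rewrite {1}ew !linear_sum mulr_sumr -sumrB; apply: eq_bigr => i _.
      have e1 m : (f (nu`_i *+ m) : R) = m%:R * (f nu`_i : R).
        by rewrite mulr_natl; exact: linearMn.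
      have e2 : (f (x i *: nu`_i) : R) = x i * (f nu`_i : R) by exact: linearZ.
      transitivity ((Num.trunc (n%:R * x i))%:R * (f nu`_i : R) - n%:R * (x i * (f nu`_i : R))); last first.
        by rewrite mulrBl mulrA.
      by rewrite -e2 -e1.
    apply: le_trans (ler_norm_sum _ _ _) _; apply: ler_sum => i _.
    rewrite normrM ler_piMl//.
    have /truncn_itv/andP[t1 t2] : 0 <= n%:R * x i by rewrite mulr_ge0// ltW.
    by rewrite -natr1 in t2; rewrite ler_norml; apply/andP; split; lra.
  move: dM nM fw; move: (f (g n) : R) (f w : R) => y z.
  rewrite ler_norml => /andP[d1 d2] nM z0.
  have [zp|zn] := ltrP 0 z.
    rewrite (gtr0_norm zp) in nM; rewrite mulr_gt0//; lra.
  have {}zn : z < 0 by rewrite lt_neqAle z0.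
  rewrite (ltr0_norm zn) mulrN in nM; rewrite nmulr_lgt0//; lra.
exists (g n0); split; last exact: hn.
  apply: big_ind => // i _; have pG : G nu`_i.
    by apply: GPhi; apply: (mem_subseq sub); exact: mem_nth.
  by elim: (Num.trunc _) => [|m IH]; rewrite ?mulr0n// mulrS; exact: GD.
by apply: rpred_sum => i _; apply: rpredMn; rewrite eW memv_span// mem_nth.
Qed.

Lemma side_absorbing g a : side L w g -> exists k0, forall k, (k0 <= k)%N -> side L w (a + g *+ k).
Proof.
move=> sg; apply: eventually_side => f fL; have := sg f fL.
set d := (f g : R) * (f w : R) => d0.
exists (Num.Def.archi_bound (`|(f a : R) * (f w : R)| / d)) => k kk.
have : `|(f a : R) * (f w : R)| < k%:R * d.
  rewrite -ltr_pdivrMr//; apply: lt_le_trans (archi_boundP _) _.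
    by rewrite divr_ge0// ltW.
  by rewrite ler_nat.
have -> : (f (a + g *+ k) : R) * (f w : R) = (f a : R) * (f w : R) + k%:R * d.
  have -> : (f (a + g *+ k) : R) = (f a : R) + k%:R * (f g : R).
    by rewrite linearD mulr_natl; congr (_ + _); exact: linearMn.
  by rewrite /d mulrDl mulrA.
by rewrite ltr_norml => /andP[h _]; rewrite addrC -subr_gt0 in h *; lra.
Qed.

End TestCone.

(** Pick w generic in the interior of the common wall, for finitely many
functionals that test all the singular cones. The open cone of the points on
the side of w then lies in c1 above the wall, in c2 below it and in c12 on it,
and any point enters it when moved along a lattice vector g of the wall inside
this cone. *)
Theorem wall_geometry : exists g, [/\ G g, (E g : R) = 0,
  c1 <> c_ext Phi, c12 <> c_ext (seq_in W Phi) &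
  forall a, exists k0, forall k, (k0 <= k)%N ->
    [/\ 0 <= (E a : R) -> closure c1 (a + g *+ k),
        (E a : R) < 0 -> c2 (a + g *+ k) &
        (E a : R) = 0 -> c12 (vsproj W (a + g *+ k))]].
Proof.
have [L [w [wW [w1 w2] w12 tL Lw]]] := generic_wall_point.
have [g [Gg gW sg]] := lattice_direction wW w1 tL Lw.
have Eg : (E g : R) = 0 by apply/WE.
have Egk a k : (E (a + g *+ k) : R) = E a.
  have -> : (E (a + g *+ k) : R) = (E a : R) + (E g : R) *+ k.
    by rewrite linearD; congr (_ + _); exact: linearMn.
  by rewrite Eg mul0rn addr0.
exists g; split=> //.
- exact: c1_inner wW w1 tL Lw.
- exact: c12_inner wW w1 w12 tL Lw.
move=> a; have [k0 hk] := side_absorbing a sg; exists k0 => k /hk sk; split.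
- by move=> Ea; apply: (side_closure w1 tL Lw sk); rewrite Egk.
- by move=> Ea; apply: (side_neg wW w1 w2 tL Lw sk); rewrite Egk.
- by move=> Ea; apply: (side_in_c12 wW w12 tL Lw sk); apply/WE; rewrite Egk.
Qed.

End WallGeometry.

(** * The wall-crossing formula *)

Section LatticeFacts.
Variables (R : realType) (V : vectType R).
Implicit Types (s : seq V) (a b : V) (G : set V).

Lemma zspan0 s : zspan s 0.
Proof. by exists [ffun=> 0]; rewrite big1// => i _; rewrite ffunE mulr0z. Qed.

Lemma zspanD s a b : zspan s a -> zspan s b -> zspan s (a + b).
Proof.
move=> [x ->] [y ->]; exists [ffun i => x i + y i]; rewrite -big_split/=.
by apply: eq_bigr => i _; rewrite ffunE mulrzDr.
Qed.

Lemma zspanN s a : zspan s a -> zspan s (- a).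
Proof.
move=> [x ->]; exists [ffun i => - x i]; rewrite -sumrN.
by apply: eq_bigr => i _; rewrite ffunE mulrNz.
Qed.

Lemma mem_zspan s a : a \in s -> zspan s a.
Proof.
move=> /(nthP 0)[i si <-]; exists [ffun j => (j == Ordinal si)%:R].
rewrite (bigD1 (Ordinal si))//= big1 ?addr0 => [|j /negPf ji]; rewrite ffunE.
  by rewrite eqxx mulr1z.
by rewrite ji mulr0z.
Qed.

(** The values of E on the lattice are the multiples of some n > 0, so that
E / n is in the dual lattice. *)
Lemma primitive_value1 G (E : 'Hom(V, R^o)) : G 0 ->
  (forall a b, G a -> G b -> G (a + b)) -> (forall a, G a -> G (- a)) ->
  primitive_dual G E -> (exists2 a, G a & 0 < (E a : R)) ->
  exists2 a, G a & (E a : R) = 1.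
Proof.
move=> G0 GD GN [/asboolP E_int prim] [a0 Ga0 Ea0].
pose P (n : nat) := `[< (0 < n)%N /\ exists2 a, G a & (E a : R) = n%:R >].
have [|n /asboolP[n0 [a Ga Ea]] n_min] := @ex_minnP P.
  have /intrP[z ez] := E_int _ Ga0.
  have z0 : 0 < z by rewrite ez ltr0z in Ea0.
  exists `|z|%N; apply/asboolP; split; first by rewrite absz_gt0 gt_eqF.
  by exists a0 => //; rewrite ez -[in LHS](gtz0_abs z0) pmulrn.
have div b : G b -> exists z : int, (E b : R) = n%:R * z%:~R.
  move=> Gb; have /intrP[z ez] := E_int _ Gb; exists (z %/ n)%Z.
  have eM (m : int) : (E (a *~ m) : R) = n%:R * m%:~R.
    by rewrite -Ea mulrzr; exact: raddfMz.
  have ed := divz_eq z n; have r0 : 0 <= (z %% n)%Z by apply: modz_ge0; rewrite -lt0n.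
  have rn : (z %% n)%Z < n by apply: ltz_pmod.
  have er : (E (b - a *~ (z %/ n)%Z) : R) = ((z %% n)%Z)%:~R.
    have -> : (E (b - a *~ (z %/ n)%Z) : R) = (E b : R) - (E (a *~ (z %/ n)%Z) : R).
      by rewrite linearB.
    by rewrite eM ez {1}ed intrD intrM pmulrn; ring.
  have [rz|rp] := eqVneq (z %% n)%Z 0; first by rewrite ez {1}ed rz addr0 intrM mulrC.
  have /n_min : P `|(z %% n)%Z|%N.
    apply/asboolP; split; first by rewrite absz_gt0.
    exists (b - a *~ (z %/ n)%Z); first exact: (GD _ _ Gb (GN _ (lattice_mulz G0 GD GN _ Ga))).
    by rewrite er -[in LHS](gez0_abs r0) pmulrn.
  by rewrite leqNgt -ltz_nat gez0_abs// rn.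
have nR : n%:R != 0 :> R by rewrite pnatr_eq0 -lt0n.
have n1 : n = 1%N.
  apply: (prim n (n%:R^-1 *: E)); last first.
    by rewrite -scaler_nat scalerA mulfV// scale1r.
  apply/asboolP => b /div[z ez]; rewrite scale_lfunE.
  have -> : n%:R^-1 *: (E b) = z%:~R :> R.
    by rewrite /GRing.scale /= ez mulKf.
  exact: intr_int.
by exists a; rewrite // Ea n1.
Qed.

End LatticeFacts.

Theorem theorem42 (R : realType) (V : vectType R) (G : set V) (Phi : seq V)
    (W : {vspace V}) (E : 'Hom(V, R^o)) (c1 c2 : set (euclidean V))
    (c12 : set (euclidean (subvs_of W))) (k1 k2 : quasipoly G)
    (k12 : quasipoly (lattice_in W G)) (Q : quasipoly G) :
  full_lattice G ->
  0 \notin Phi ->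
  in_open_half_space Phi ->
  zspan Phi = G ->
  wall Phi W ->
  (forall a, a \in W <-> (E a : R) = 0) ->
  primitive_dual G E ->
  chamber Phi c1 ->
  chamber Phi c2 ->
  adjacent_along W Phi E c1 c2 ->
  (exists2 phi, phi \in seq_out W Phi & 0 < (E phi : R)) ->
  chamber (seq_in W Phi) c12 ->
  common_wall W c1 c2 `<=` closure c12 ->
  is_kchamber Phi c1 k1 ->
  is_kchamber Phi c2 k2 ->
  is_kchamber (seq_in W Phi) c12 k12 ->
  qextends Q k12 ->
  forall a, G a ->
    qeval k1 a - qeval k2 a = Para W Q (seq_out W Phi) E a.
Proof.
move=> _ _ [u u_pos] zG wW WE prim ch1 ch2 adj [phi phi_out Ephi] ch12 cl12
  [_ k1E] [k2ext k2E] [_ k12E] QE.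
have G0 : G 0 by rewrite -zG; exact: zspan0.
have GD a b : G a -> G b -> G (a + b) by rewrite -zG; exact: zspanD.
have GN a : G a -> G (- a) by rewrite -zG; exact: zspanN.
have GPhi psi : psi \in Phi -> G psi by rewrite -zG; exact: mem_zspan.
have E_int a : G a -> (E a : R) \is a Num.int by case: prim => /asboolP + _; apply.
have ED a b : (E (a + b) : R) = (E a : R) + (E b : R) by rewrite linearD.
have phi_Phi : phi \in Phi by move: phi_out; rewrite mem_filter => /andP[].
have E_one : exists2 a, G a & (E a : R) = 1.
  by apply: (primitive_value1 G0 GD GN prim); exists phi => //; exact: GPhi.
have al : admissible (fun a => E a : R) G (seq_out W Phi).
  move=> psi; rewrite mem_filter => /andP[pW pPhi]; split; first exact: GPhi.
  by apply: contra pW => /eqP /WE.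
have out0 : seq_out W Phi != [::] by apply: contraTneq phi_out => ->.
have [P [PE diffP recP stripP]] := Para_recurrence WE G0 GD GN E_int E_one Q al out0.
have [|g [Gg Eg c1_in c12_in gE]] :=
  wall_geometry G0 GD GPhi wW WE ch1 ch2 adj _ ch12 cl12.
  by exists phi.
have Gk a k : G a -> G (a + g *+ k).
  by move=> Ga; elim: k => [|k IH]; rewrite ?mulr0n ?addr0// mulrSr addrA; exact: GD.
move=> a Ga; rewrite (PE a Ga).
pose t b : R[i] := kfunC (seq_in W Phi) (vsproj W b).
apply: (@jump_formula R R[i] V (fun a => E a : R) G ED G0 GD GN E_int (seq_out W Phi)
  (qeval k1) (qeval k2) P (kfunC Phi) t (qeval Q) g phi al Gg Eg phi_out Ephi) => //.
- move=> b Gb Eb; have [k0 hk] := gE b; exists k0 => k /hk[/(_ Eb) cb _ _].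
  by rewrite (k1E c1_in _ (Gk b k Gb) cb); exact: subrr.
- move=> b Gb Eb; have [k0 hk] := gE b; exists k0 => k /hk[_ /(_ Eb) cb _].
  have [c2e|c2n] := pselect (c2 = c_ext Phi).
    have k0E : kfun Phi (b + g *+ k) = 0%N by apply: kfun_ext; rewrite -c2e.
    by rewrite (k2ext c2e _ (Gk b k Gb)) /kfunC k0E; exact: subrr.
  by rewrite (k2E c2n _ (Gk b k Gb) (subset_closure cb)); exact: subrr.
- move=> b Gb Eb; have [k0 hk] := gE b; exists k0 => k /hk[_ _ /(_ Eb) cb].
  have bW : b + g *+ k \in W.
    by apply: memvD; [|apply: rpredMn]; apply/WE.
  have wG : lattice_in W G (vsproj W (b + g *+ k)).
    by rewrite /lattice_in /= vsprojK//; exact: Gk.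
  have := QE _ wG; rewrite vsprojK// => ->.
  by rewrite (k12E c12_in _ wG (subset_closure cb)); exact: subrr.
- exact: recurrent_qeval.
- exact: recurrent_qeval.
- exact: recP.
- move=> b Gb; rewrite (diff_kfun W b u_pos) /wall_count (_ : (b \in W) = (E b == 0 :> R))//.
  by apply/idP/eqP => /WE.
Qed.
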